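(* Let $T\in\mathfrak{E}_1(H)$ with characteristic line bundle $F$ and canonical model space $\mathfrak{H}$. For every nonzero $s\in\mathfrak{H}$, $$N_s(r)\le \mathrm{T}_F(r)+O(1)$$ as $r\to+\infty$.
   Context: Entire operators. $H$ denotes a separable infinite-dimensional complex Hilbert space (inner products are linear in the first variable). A symmetric operator $T$ in $H$ is a linear operator on a subspace $D(T)\subset H$, not necessarily dense, with $(Tx,y)=(x,Ty)$ for all $x,y\in D(T)$; it is always assumed closed. $T$ is simple if it has no nontrivial self-adjoint part as an orthogonal direct summand. On $\mathbb{H}=H\oplus H$ put $[x,y]_c=(x_2,y_1)_H-(x_1,y_2)_H$. Let $A_T\subset\mathbb{H}$ be the graph of $T$, $A_T^{\bot_s}=\{x\in\mathbb{H}: [x,y]_c=0\ \forall y\in A_T\}\supset A_T$, and $\mathcal{B}_T=A_T^{\bot_s}/A_T$ with the induced form $[\cdot,\cdot]_q$. The signature of $-\mathrm{i}[\cdot,\cdot]_q$ is the pair of deficiency indices of $T$, assumed to be $(1,1)$. $T$ is called regular (equivalently: entire) if for every $\lambda\in\mathbb{C}$ there is $c_\lambda>0$ with $\|(T-\lambda)x\|\ge c_\lambda\|x\|$ for all $x\in D(T)$. $\mathfrak{E}_1(H)$ is the set of closed simple symmetric entire operators in $H$ with deficiency indices $(1,1)$. Characteristic line bundle and model space. For $\lambda\in\mathbb{C}$ let $E_\lambda=\{x\in H:(x,\lambda x)\in A_T^{\bot_s}\}$, a one-dimensional subspace of $H$; these form a holomorphic line bundle $E\subset\mathbb{C}\times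 H$. Let $F^\dag_\lambda=E_{\bar\lambda}$ with the norm of $H$, and let $F_\lambda$ be the space of conjugate-linear functionals on $F^\dag_\lambda$ with the dual norm $|\cdot|$. $F$ is a holomorphic Hermitian line bundle over $\mathbb{C}$: a section $s$ is holomorphic iff $\lambda\mapsto\langle s(\lambda),v(\bar\lambda)\rangle$ is holomorphic for every local holomorphic section $v$ of $E$. For $x\in H$ let $\hat x$ be the holomorphic section of $F$ with $\langle\hat x(\lambda),w\rangle=(x,w)_H$ for $w\in F^\dag_\lambda$. The canonical model space is $\mathfrak{H}=\{\hat x:x\in H\}$, with the Hilbert space structure transferred from $H$ (the map $x\mapsto\hat x$ is injective). Growth functions. Let $R=\bar\partial\partial\ln|\sigma|^2$ ($\sigma$ any local holomorphic frame of $F$) be the Chern curvature, $c_1(F)=\frac{\mathrm{i}}{2\pi}R$, $\mathbb{D}_t=\{|\lambda|<t\}$, and $\mathrm{T}_F(r)=\int_0^r\frac{dt}{t}\int_{\mathbb{D}_t}c_1(F)$. For a nontrivial holomorphic section $s$, with $n_s(r)$ the number of zeros of $s$ in $\mathbb{D}_r$ counted with multiplicity and $n_s(0)$ the multiplicity of $0$ as a zero, $N_s(r)=\int_0^r\frac{n_s(t)-n_s(0)}{t}dt+n_s(0)\ln r$. *)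

(* Defs.v *)
From HB Require Import structures.
From mathcomp Require Import all_boot all_order all_algebra complex.
From mathcomp Require Import all_classical all_reals all_analysis.

Set Implicit Arguments.
Unset Strict Implicit.
Unset Printing Implicit Defensive.

Import Order.TTheory GRing.Theory Num.Theory.
Import numFieldNormedType.Exports.

Local Open Scope classical_set_scope.
Local Open Scope ring_scope.
Local Open Scope complex_scope.

(* The regular module R[i]^o is the form of R[i] that carries the topology and
   the normed module structure of the complex plane. *)
Notation cplx R := (R[i]^o).

Section Operators.
Context {R : realType} {H : completeNormedModType R[i]}.
Local Notation C := (cplx R).

Definition separable_space : Prop :=
  exists2 S : set H, countable S & dense S.

Definition infinite_dimensional : Prop :=
  forall (n : nat) (e : 'I_n -> H),
    exists x : H, forall a : 'I_n -> C, x <> \sum_(i < n) a i *: e i.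

Definition subspace (D : set H) : Prop :=
  D 0 /\ forall (a : C) (x y : H), D x -> D y -> D (a *: x + y).

(* The values of [op_fun] outside [dom] are irrelevant. *)
Record linear_operator := LinearOperator {
  dom : set H;
  op_fun :> H -> H;
  dom_subspace : subspace dom;
  op_linear : forall (a : C) (x y : H), dom x -> dom y ->
    op_fun (a *: x + y) = a *: op_fun x + op_fun y }.

Definition graph (T : linear_operator) : set (H * H) :=
  [set p | dom T p.1 /\ p.2 = T p.1].

Variable ip : {dot H for (@conjc R)}.

Definition orthocompl (M : set H) : set H :=
  [set x | forall y, M y -> ip x y = 0].

Definition symmetric_op (T : linear_operator) : Prop :=
  forall x y, dom T x -> dom T y -> ip (T x) y = ip x (T y).

Definition closed_op (T : linear_operator) : Prop := closed (graph T).

(* T is the orthogonal direct sum of its parts in M and in the orthogonal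
   complement of M. *)
Definition reduces (M : set H) (T : linear_operator) : Prop :=
  [/\ subspace M, closed M &
    forall x, dom T x -> exists x1 x2,
      [/\ x = x1 + x2,
          dom T x1, M x1 & M (T x1)] /\
      [/\ dom T x2, orthocompl M x2 & orthocompl M (T x2)]].

(* The part of T in M is densely defined in M and equals its adjoint in M. *)
Definition selfadjoint_part (M : set H) (T : linear_operator) : Prop :=
  M `<=` closure (dom T `&` M) /\
  forall x y, M x -> M y ->
    (forall u, dom T u -> M u -> ip (T u) x = ip u y) <->
    (dom T x /\ y = T x).

Definition simple_op (T : linear_operator) : Prop :=
  forall M, reduces M T -> selfadjoint_part M T -> M = [set 0].

Definition cform (x y : H * H) : C := ip x.2 y.1 - ip x.1 y.2.

Definition sperp (A : set (H * H)) : set (H * H) :=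
  [set x | forall y, A y -> cform x y = 0].

(* The Hermitian form induced by h on the quotient V / N (N being contained in
   the radical of h on V) has signature (m, n).  The families u and v represent
   a basis of V / N in which the induced form is diagonal; linear independence
   modulo N follows from orthogonality. *)
Definition quotient_signature (V N : set (H * H)) (h : H * H -> H * H -> C)
    (m n : nat) : Prop :=
  exists (u : 'I_m -> H * H) (v : 'I_n -> H * H),
  [/\ (forall i, V (u i)) /\ (forall j, V (v j)),
      forall x, V x -> exists (a : 'I_m -> C) (b : 'I_n -> C),
        N (x - (\sum_(i < m) a i *: u i + \sum_(j < n) b j *: v j)),
      (forall i, 0 < h (u i) (u i)) /\ (forall j, h (v j) (v j) < 0),
      (forall i i', i != i' -> h (u i) (u i') = 0) /\
      (forall j j', j != j' -> h (v j) (v j') = 0) &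
      forall i j, h (u i) (v j) = 0].

Definition deficiency_indices (T : linear_operator) (m n : nat) : Prop :=
  quotient_signature (sperp (graph T)) (graph T)
    (fun x y => - 'i%C * cform x y) m n.

Definition entire_op (T : linear_operator) : Prop :=
  forall l : C, exists2 c : R, 0 < c &
    forall x, dom T x -> c%:C * `|x| <= `|T x - l *: x|.

Definition entire_class (T : linear_operator) : Prop :=
  [/\ symmetric_op T, closed_op T, simple_op T,
      deficiency_indices T 1%N 1%N & entire_op T].

End Operators.

Arguments linear_operator {R} H.
Arguments separable_space {R} H.
Arguments infinite_dimensional {R} H.

Section LineBundle.
Context {R : realType} {H : completeNormedModType R[i]}.
Local Notation C := (cplx R).
Variables (ip : {dot H for (@conjc R)}) (T : linear_operator H).

Definition Efib (l : C) : set H :=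
  [set x | sperp ip (graph T) (x, l *: x)].

Definition Fdag (l : C) : set H := Efib (l^*).

(* A conjugate-linear functional on [Fdag l] is encoded as its extension by
   zero to H, so that functionals are equal iff their encodings are. *)
Definition Ffib (l : C) : set (H -> C) :=
  [set phi | (forall (a : C) u v, Fdag l u -> Fdag l v ->
                phi (a *: u + v) = a^* * phi u + phi v) /\
             (forall w, ~ Fdag l w -> phi w = 0)].

Definition dual_norm (l : C) (phi : H -> C) : R :=
  sup [set complex.Re `|phi w| | w in [set w | Fdag l w /\ `|w| <= 1]].

Definition Eholo (U : set C) (v : C -> H) : Prop :=
  open U /\ forall l, U l -> Efib l (v l) /\ derivable v l 1.

Definition Fholo (U : set C) (s : C -> H -> C) : Prop :=
  [/\ open U,
      forall l, U l -> Ffib l (s l) &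
      forall V v, Eholo V v -> forall l, U l -> V (l^*) ->
        derivable (fun z : C => s z (v (z^*)) : C) l 1].

Definition Fframe (U : set C) (sigma : C -> H -> C) : Prop :=
  Fholo U sigma /\ forall l, U l -> sigma l <> cst 0.

Definition hat (x : H) : C -> H -> C :=
  fun l => patch (cst 0) (Fdag l) (ip x).

Definition model_space : set (C -> H -> C) := range hat.

End LineBundle.

Section Wirtinger.
Context {R : realType}.
Local Notation C := (cplx R).

Definition partial_x (f : C -> C) (z : C) : C :=
  derive1 (fun t => complex.Re (f (t +i* complex.Im z))) (complex.Re z)
  +i* derive1 (fun t => complex.Im (f (t +i* complex.Im z))) (complex.Re z).

Definition partial_y (f : C -> C) (z : C) : C :=
  derive1 (fun t => complex.Re (f (complex.Re z +i* t))) (complex.Im z)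
  +i* derive1 (fun t => complex.Im (f (complex.Re z +i* t))) (complex.Im z).

Definition d_z (f : C -> C) (z : C) : C :=
  (partial_x f z - 'i%C * partial_y f z) / 2.

Definition d_zbar (f : C -> C) (z : C) : C :=
  (partial_x f z + 'i%C * partial_y f z) / 2.

Definition disc (t : R) : set C := [set z | `|z| < t%:C].

End Wirtinger.

Section Growth.
Context {R : realType} {H : completeNormedModType R[i]}.
Local Notation C := (cplx R).
Variables (ip : {dot H for (@conjc R)}) (T : linear_operator H).

(* The Chern curvature is K d\bar z /\ dz with K = d_zbar (d_z ln |sigma|^2),
   which does not depend on the local frame sigma. *)
Definition curvature (l : C) : C :=
  xget 0 [set K | exists U sigma, [/\ Fframe ip T U sigma, U l &
    K = d_zbar (d_z (fun z => (ln (dual_norm ip T z (sigma z) ^+ 2))%:C)) l]].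

(* The density of c_1(F) = (i / 2 pi) K d\bar z /\ dz with respect to dx /\ dy,
   as d\bar z /\ dz = 2i dx /\ dy; it is real. *)
Definition c1_density (l : C) : R :=
  complex.Re ('i%C / (2 * pi)%:C * curvature l * (2 * 'i%C)).

Definition area_c1 (t : R) : R :=
  (\int[(lebesgue_measure \x lebesgue_measure)%E]_(p in
       [set p : R * R | disc t (p.1 +i* p.2)]) c1_density (p.1 +i* p.2))%R.

Definition char_fun (r : R) : R :=
  (\int[lebesgue_measure]_(t in `]0%R, r]) (t^-1 * area_c1 t))%R.

(* Order of vanishing: s = (z - l)^m tau near l with tau holomorphic and
   tau(l) <> 0. *)
Definition zero_mult (s : C -> H -> C) (l : C) : nat :=
  xget 0%N [set m | exists U tau, [/\ Fholo ip T U tau, U l, tau l <> cst 0 &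
    forall z, U z -> forall w, s z w = (z - l) ^+ m * tau z w]].

Definition zero_count (s : C -> H -> C) (t : R) : nat :=
  (\sum_(z \in disc t) zero_mult s z)%N.

Definition counting_fun (s : C -> H -> C) (r : R) : R :=
  (\int[lebesgue_measure]_(t in `]0%R, r])
     (((zero_count s t)%:R - (zero_mult s 0)%:R) / t))%R
  + (zero_mult s 0)%:R * ln r.

End Growth.

(* Main.v *)
(** Let [s] be the section of [F] given by [x <> 0].  Off its zeros [h = ln |s|^2] is smooth with
    Laplacian [-4 pi] times the density of [c_1(F)], so the right-hand side of Jensen's formula on
    the disc of radius [r] is governed by [T_F(r)].  At a zero [a] of order [m] the pole of [h] is
    cancelled by replacing [|z - a|^(2 m)] by the nonvanishing [|rho - conj a z / rho|^(2 m)],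
    [rho > r], which changes [h] arbitrarily little from above on the circle and by [2 N_s(r)] plus
    a constant at the centre.  Since [|s(z)| <= |x|] everywhere, the mean over the circle is bounded.

    The local structure of [F] comes from the resolvent-like family [v(l) = (1 - (l - l0) A)^-1 e],
    where [e] spans the fibre [E_l0] and [A] is a bounded weak inverse of [T - conj l0]: it is a
    holomorphic frame of [E], whose fibres are lines because the deficiency indices are (1,1).
    That different frames of [F] give the same curvature is the harmonicity of [ln |g|^2], for
    which Goursat's theorem is needed, frames being only assumed complex differentiable. *)

Require Import Defs.
From HB Require Import structures.
From mathcomp Require Import all_boot all_order all_algebra complex.
From mathcomp Require Import all_classical all_reals all_analysis.
From mathcomp Require Import measurable_realfun ring lra.

Set Implicit Arguments.
Unset Strict Implicit.
Unset Printing Implicit Defensive.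

Import Order.TTheory GRing.Theory Num.Theory.
Import numFieldNormedType.Exports.

Local Open Scope classical_set_scope.
Local Open Scope ring_scope.
Local Open Scope complex_scope.

(** Zeros of [s] may lie on the circle of radius r itself, where h is singular, and the estimate is
    wanted for every large r. This is why rho is strictly larger than r: the new factors have no
    zero on the closed disc, and Jensen's formula is needed only for functions smooth up to the
    boundary. The cost on the circle is estimated for the exponentials, where a zero on the boundary
    is harmless; rho is chosen in terms of r so that the bound |x|^2 degrades at most to |x|^2 + 1.
    Hence the additive constant (ln (|x|^2 + 1) - u(0)) / 2 is independent of r, u(0) being ln
    |s(0)|^2 or its regularised value when [s] vanishes at 0.

    Jensen's formula itself is obtained without a change of variables in the plane: the disc is cut
    into slices in each coordinate direction, and the boundary terms are written over four
    quadrants, on each of which sine and cosine are monotone. *)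

Lemma is_derive_ler (K : numFieldType) (V : normedModType K) (f : K^o -> V) (x : K^o) (d : V) :
  is_derive x (1 : K^o) f d <->
  forall e : K, 0 < e -> \forall y \near x, `|f y - f x - (y - x) *: d| <= e * `|y - x|.
Proof.
have E (h : K) : h != 0 -> `|d - h^-1 *: (f (h *: (1 : K^o) + x) - f x)| =
    `|f (h + x) - f x - (h + x - x) *: d| / `|h|.
  move=> h0; rewrite distrC addrK -(_ : h *: (h^-1 *: (f (h *: 1 + x) - f x) - d) = f (h + x) - f x - h *: d).
    by rewrite normrZ mulrC mulKf ?normr_eq0.
  by rewrite scalerBr scalerA divff// scale1r [h *: 1]mulr1.
split.
  move=> [/cvg_ex[l fl]]; rewrite /derive (cvg_lim _ fl)// => ld; rewrite {l}ld in fl.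
  move=> e e0; have /cvgrPdist_le /(_ e e0) := fl.
  rewrite near_withinE => P; rewrite (near_shift 0) /=; move: P; apply: filterS => h P.
  rewrite /= subr0; have [->|h0] := eqVneq (h : K) 0.
    by rewrite /= add0r !subrr scale0r subr0 !normr0 mulr0.
  have := P h0; rewrite /= E// ler_pdivrMr ?normr_gt0//.
  by rewrite [h + x - x]addrK.
move=> P; suff fl : (fun h => h^-1 *: ((f \o shift x) (h *: (1 : K^o)) - f x)) @ 0^' --> d.
  by apply: DeriveDef; [apply/cvg_ex; exists d|apply/cvg_lim].
apply/cvgrPdist_le => e e0; rewrite near_withinE.
have := P e e0; rewrite (near_shift 0) /=; apply: filterS => h Ph h0.
rewrite E// ler_pdivrMr ?normr_gt0//; move: Ph; rewrite /= subr0 => /le_trans; apply.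
by rewrite addrK.
Qed.

Lemma near_continuous (U V : topologicalType) (u : U -> V) (x : U) (P : set V) :
  {for x, continuous u} -> (\forall y \near u x, P y) -> \forall t \near x, P (u t).
Proof. by move=> cu Pu; exact: (cu P Pu). Qed.

Lemma continuous_pair (U V W : topologicalType) (u : U -> V) (v : U -> W) (x : U) :
  {for x, continuous u} -> {for x, continuous v} -> {for x, continuous (fun t => (u t, v t))}.
Proof. by move=> cu cv; exact: (cvg_pair cu cv). Qed.

Lemma continuous_comp2 (U V W X : topologicalType) (f : V * W -> X) (u : U -> V) (v : U -> W)
    (x : U) : {for x, continuous u} -> {for x, continuous v} ->
  {for (u x, v x), continuous f} -> {for x, continuous (fun t => f (u t, v t))}.
Proof.
move=> cu cv cf; apply: (@continuous_comp _ _ _ (fun t => (u t, v t)) f) => //.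
exact: continuous_pair.
Qed.

(** * Integration over intervals and discs *)

Section Integration.
Context {R : realType}.
Local Notation mu := (@lebesgue_measure R).
Implicit Types (f F : R -> R) (a b : R).

Lemma continuous_itv_within f a b :
  (forall x, a <= x <= b -> {for x, continuous f}) ->
  {within `[a, b], continuous f}.
Proof.
by move=> cf; apply: continuous_in_subspaceT => x; rewrite inE /= in_itv /= => /cf.
Qed.

Lemma continuous_itv_integrable f a b :
  (forall x, a <= x <= b -> {for x, continuous f}) ->
  mu.-integrable `[a, b] (EFin \o f).
Proof.
move=> cf; apply: continuous_compact_integrable; first exact: segment_compact.
exact: continuous_itv_within.
Qed.

Lemma Rintegral_FTC f F a b : a <= b ->
  (forall x, a <= x <= b -> {for x, continuous f}) ->
  (forall x, a <= x <= b -> is_derive x 1 F (f x)) ->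
  (\int[mu]_(x in `[a, b]) f x = F b - F a)%R.
Proof.
rewrite le_eqVlt => /predU1P[<-|ab] cf dF.
  by rewrite set_itv1 Rintegral_set1 subrr.
have dFx x : a <= x <= b -> derivable F x 1 by move=> /dF[].
have cF x : a <= x <= b -> {for x, continuous F}.
  by move=> /dFx /derivable1_diffP/differentiable_continuous.
rewrite /Rintegral (@continuous_FTC2 _ f F a b)//.
- exact: continuous_itv_within.
- split.
  + by move=> x; rewrite in_itv /= => /andP[ax xb]; apply: dFx; rewrite !ltW.
  + by apply: cvg_at_right_filter; apply: cF; rewrite lexx ltW.
  + by apply: cvg_at_left_filter; apply: cF; rewrite lexx ltW.
- move=> x; rewrite in_itv /= => /andP[ax xb].
  by rewrite derive1E; apply: (@derive_val _ _ _ _ _ _ _ (dF x _)); rewrite !ltW.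
Qed.

(** An open set is the union of the countably many rational boxes that it contains. *)
Lemma open_measurable_prod (A : set (R * R)) : open A -> measurable A.
Proof.
move=> oA.
pose B (q : (rat * rat) * (rat * rat)) : set (R * R) :=
  `]ratr q.1.1, ratr q.1.2[%classic `*` `]ratr q.2.1, ratr q.2.2[%classic.
have -> : A = \bigcup_(q in [set q | B q `<=` A]) B q.
  apply/seteqP; split=> [[x y] Axy|p [q qA Bq]]; last exact: qA.
  have [[/= U V] [/= nU nV UV]] : nbhs (x, y) A by rewrite openE in oA; exact: oA.
  have H (z : R) (W : set R) : nbhs z W -> exists q : rat * rat, ratr q.1 < z < ratr q.2 /\
      forall t, ratr q.1 < t < ratr q.2 -> W t.
    move=> /nbhs_ballP[e /= e0 eW].
    have [|q1 /[!in_itv]/= /andP[q11 q12]] := @rat_in_itvoo R (z - e) z.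
      by rewrite ltrBlDr ltrDl.
    have [|q2 /[!in_itv]/= /andP[q21 q22]] := @rat_in_itvoo R z (z + e).
      by rewrite ltrDl.
    exists (q1, q2); rewrite /= q12 q21; split => // t /andP[t1 t2].
    by apply: eW; rewrite /ball /= ltr_distl; apply/andP; split; lra.
  have [q1 [xq1 q1U]] := H _ _ nU; have [q2 [yq2 q2V]] := H _ _ nV.
  exists (q1, q2); last by split; rewrite /= in_itv.
  move=> [u v] [/= /[!in_itv]/= uq vq]; apply: UV; split => /=; [exact: q1U|exact: q2V].
rewrite bigcup_mkcond; apply: countable_bigcupT_measurable => [|q].
  exact: countableP.
case: ifP => // _; apply: measurableX; exact: measurable_itv.
Qed.

(** Continuity at the points of [A] holds in the ambient plane, so the preimage of an open interval
    meets [A] in the same set as its interior does, and that interior is measurable. *)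
Lemma near_measurable_fun (A : set (R * R)) (f : R * R -> R) : measurable A ->
  (forall p, A p -> {for p, continuous f}) -> measurable_fun A f.
Proof.
move=> mA cf; apply: (measurability _ (RGenOpens.measurableE R)) => //.
move=> _ [_ [c [d ->] <-]].
have -> : A `&` f @^-1` `]c, d[ = A `&` (f @^-1` `]c, d[)^°.
  apply/seteqP; split=> p [Ap /= fp]; split => //; last exact: interior_subset fp.
  apply: (cf _ Ap); apply: open_nbhs_nbhs; split => //; exact: interval_open.
by apply: measurableI => //; apply: open_measurable_prod; exact: open_interior.
Qed.

Local Notation mu2 := (mu \x mu)%E.

(** A bounded function on a set of finite measure: the bound comes from compactness of [K], the
    finite measure from a square containing [K]. *)
Lemma compact_continuous_integrable (A K : set (R * R)) (f : R * R -> R) :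
  measurable A -> A `<=` K -> compact K ->
  (forall p, K p -> {for p, continuous f}) -> mu2.-integrable A (EFin \o f).
Proof.
move=> mA AK cK cf.
have [M [_ Mb]] : bounded_set (f @` K).
  apply: compact_bounded; apply: continuous_compact => //.
  by apply: continuous_in_subspaceT => p; rewrite inE => /cf.
have [N [_ Nb]] := compact_bounded cK.
have cB : A `<=` `[- (N + 1), N + 1] `*` `[- (N + 1), N + 1].
  move=> [x y] /AK /(Nb (N + 1)); rewrite ltrDl ltr01 => /(_ isT).
  rewrite /= prod_normE /= ge_max => /andP[xN yN].
  by rewrite !in_itv /= -!ler_norml.
have mB : measurable (`[- (N + 1), N + 1] `*` `[- (N + 1), N + 1] : set (R * R)).
  by apply: measurableX; exact: measurable_itv.
apply: measurable_bounded_integrable => //.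
- have /= := le_measure mu2 (mem_set mA) (mem_set mB) cB.
  move=> /le_lt_trans; apply.
  rewrite [ltLHS]product_measure1E; [|exact: measurable_itv..].
  rewrite /= !lebesgue_measure_itv/=; case: ifP => // _; rewrite ?mule0 ?ltry//.
- by apply: near_measurable_fun => // p /AK /cf.
- exists M; split; rewrite ?num_real// => c Mc p Ap; apply: (Mb c Mc).
  by exists p => //; exact: AK.
Qed.

(** The real-valued inner integral agrees with the extended real one where the section is
    integrable, hence almost everywhere, which suffices for the outer integral. *)
Lemma Rintegral_fubini (A : set (R * R)) (f : R * R -> R) : measurable A ->
  mu2.-integrable A (EFin \o f) ->
  \int[mu2]_(p in A) f p = \int[mu]_x \int[mu]_y (f \_ A) (x, y) /\
  \int[mu2]_(p in A) f p = \int[mu]_y \int[mu]_x (f \_ A) (x, y).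
Proof.
move=> mA intf.
have intfA : mu2.-integrable setT (EFin \o (f \_ A)).
  by rewrite -restrict_EFin; apply/integrable_restrict => //; rewrite setTI.
rewrite Rintegral_mkcond; split.
  rewrite /Rintegral -(integral12_prod_meas1 intfA); congr fine.
  apply: ae_eq_integral => //; first exact: measurable_fubini_F intfA.
    apply/measurable_EFinP; apply: measurableT_comp => //.
    exact: measurable_fubini_F intfA.
  have := ae_integrable1 intfA; apply: filterS => x ix _ /=.
  by rewrite fineK//; exact: integrable_fin_num.
rewrite /Rintegral -(integral21_prod_meas1 intfA); congr fine.
apply: ae_eq_integral => //; first exact: measurable_fubini_G intfA.
  apply/measurable_EFinP; apply: measurableT_comp => //.
  exact: measurable_fubini_G intfA.
have := ae_integrable2 intfA; apply: filterS => x ix _ /=.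
by rewrite fineK//; exact: integrable_fin_num.
Qed.

End Integration.

(** * The divergence theorem on discs *)

Section Green.
Context {R : realType}.
Local Notation mu := (@lebesgue_measure R).
Local Notation mu2 := (mu \x mu)%E.

Definition cdisc (r : R) : set (R * R) := [set p | p.1 ^+ 2 + p.2 ^+ 2 <= r ^+ 2].
Definition odisc (r : R) : set (R * R) := [set p | p.1 ^+ 2 + p.2 ^+ 2 < r ^+ 2].

Lemma continuous_sqnorm : continuous (fun p : R * R => p.1 ^+ 2 + p.2 ^+ 2).
Proof.
under eq_fun do rewrite !expr2.
by move=> p; apply: cvgD; apply: cvgM; (exact: cvg_fst || exact: cvg_snd).
Qed.

Lemma cdisc_le r p : 0 <= r -> cdisc r p -> `|p.1| <= r /\ `|p.2| <= r.
Proof.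
move=> r0 pr; split; rewrite -(ler_pXn2r (n := 2))// ?nnegrE// real_normK ?num_real//.
  by apply: le_trans pr; rewrite lerDl sqr_ge0.
by apply: le_trans pr; rewrite lerDr sqr_ge0.
Qed.

Lemma compact_cdisc r : 0 <= r -> compact (cdisc r).
Proof.
move=> r0; apply: (@subclosed_compact _ _ (`[- r, r] `*` `[- r, r])).
- rewrite /cdisc (_ : [set p | _] = (fun p : R * R => p.1 ^+ 2 + p.2 ^+ 2) @^-1` [set x | x <= r ^+ 2])//.
  apply: preimage_closed; last exact: closed_le.
  by move=> p _; exact: continuous_sqnorm.
- by apply: compact_setX; exact: segment_compact.
- by move=> [x y] /(cdisc_le r0) [] /= /[!ler_norml] xr yr; split; rewrite /= in_itv /=.
Qed.

Lemma open_odisc r : open (odisc r).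
Proof.
rewrite /odisc (_ : [set p | _] = (fun p : R * R => p.1 ^+ 2 + p.2 ^+ 2) @^-1` [set x | x < r ^+ 2])//.
by apply: open_comp; [move=> p _; exact: continuous_sqnorm|exact: open_lt].
Qed.

Lemma odisc_cdisc r : odisc r `<=` cdisc r. Proof. by move=> p /ltW. Qed.

Lemma cdiscS r t : 0 <= t <= r -> cdisc t `<=` cdisc r.
Proof.
move=> /andP[t0 tr] p pt; apply: le_trans pt _.
by rewrite ler_pXn2r ?nnegrE//; exact: le_trans tr.
Qed.

(** Each horizontal slice of the open disc is an interval ]-s, s[, to which the fundamental theorem
    of calculus applies. For y^2 >= t^2 the slice is empty and [Num.sqrt] returns 0, so both sides
    vanish. *)
Lemma Rintegral_slice (t : R) (f g : R * R -> R) : 0 < t ->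
  (forall p, cdisc t p -> {for p, continuous f}) ->
  (forall p, cdisc t p -> {for p, continuous g}) ->
  (forall p, cdisc t p -> is_derive p.1 (1 : R) (fun x => g (x, p.2)) (f p)) ->
  \int[mu]_y \int[mu]_x (f \_ (odisc t)) (x, y) =
  \int[mu]_(y in `[- t, t]) (g (Num.sqrt (t ^+ 2 - y ^+ 2), y) -
                             g (- Num.sqrt (t ^+ 2 - y ^+ 2), y)).
Proof.
move=> t0 cf cg dg; rewrite [RHS]Rintegral_mkcond; apply: eq_Rintegral => y _.
rewrite [RHS]patchE; set s := Num.sqrt _; have s0 : 0 <= s by exact: sqrtr_ge0.
have [yt|yt] := ltP (y ^+ 2) (t ^+ 2); last first.
  have -> : s = 0 by apply/eqP; rewrite sqrtr_eq0; lra.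
  rewrite oppr0 subrr if_same.
  under eq_Rintegral => x _.
    rewrite patchE memNset; last by rewrite /odisc /= => xy; have := sqr_ge0 x; lra.
    over.
  by rewrite Rintegral_cst// mul0r.
have s2 : s ^+ 2 = t ^+ 2 - y ^+ 2 by rewrite sqr_sqrtr //; lra.
have {}s0 : 0 < s by rewrite sqrtr_gt0; lra.
have yt' : y \in `[- t, t]%classic.
  rewrite inE /= in_itv /= -ler_norml -(ler_pXn2r (n := 2))// ?nnegrE ?(ltW t0)//.
  by rewrite real_normK ?num_real// ltW.
have K x : - s <= x <= s -> cdisc t (x, y).
  rewrite -ler_norml -(ler_pXn2r (n := 2))// ?nnegrE ?(ltW s0)//.
  rewrite real_normK ?num_real// s2 => xs; rewrite /cdisc /=; lra.
have cfy x : - s <= x <= s -> {for x, continuous (fun x => f (x, y))}.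
  by move=> /K /cf cfx; apply: continuous_comp2 => //; exact: cvg_cst.
have FTC : \int[mu]_(x in `[- s, s]) f (x, y) = g (s, y) - g (- s, y).
  apply: (@Rintegral_FTC _ (fun x => f (x, y)) (fun x => g (x, y))) => //.
    by rewrite (@le_trans _ _ 0)// ?oppr_le0 ltW.
  by move=> x /K /dg.
rewrite yt' -FTC.
have int_f : mu.-integrable `[- s, s] (EFin \o (fun x => f (x, y))).
  exact: continuous_itv_integrable.
rewrite -Rintegral_itv_obnd_cbnd; last first.
  by apply: (integrableS _ _ _ int_f) => //; exact: subset_itv_oc_cc.
rewrite -Rintegral_itv_bndo_bndc; last first.
  by apply: (integrableS _ _ _ int_f) => //; exact: subset_itv_oo_cc.
rewrite [RHS]Rintegral_mkcond; apply: eq_Rintegral => x _; rewrite !patchE.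
suff -> : ((x, y) \in odisc t) = (x \in `]- s, s[%classic) by [].
have xs : (`|x| < s) = (x ^+ 2 < s ^+ 2).
  by rewrite -[LHS](ltr_pXn2r (n := 2)) ?nnegrE ?(ltW s0)// real_normK ?num_real.
by apply/idP/idP; rewrite !inE /odisc /= in_itv /= -ltr_norml xs s2 ltrBrDr.
Qed.

(** The change of variable has to be monotone, hence the quarter circle; this is what makes the
    boundary integrals below appear as sums over four quadrants. *)
Lemma Rintegral_sin_subst (t : R) (G : R -> R) : 0 < t ->
  (forall x, 0 <= x <= t -> {for x, continuous G}) ->
  \int[mu]_(x in `[0, t]) G x =
  \int[mu]_(a in `[0, pi / 2]) (G (t * sin a) * (t * cos a)).
Proof.
move=> t0 cG.
have dF a : is_derive a (1 : R) (fun a => t * sin a) (t * cos a).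
  by apply: is_derive_eq.
have dF' : derive1 (fun a : R => t * sin a) = (fun a => t * cos a).
  by apply/funext => a; rewrite derive1E; apply: derive_val.
have cF : continuous (fun a => t * sin a).
  by move=> a; apply: cvgM; [exact: cvg_cst|exact: continuous_sin].
have cF' : continuous (fun a => t * cos a).
  by move=> a; apply: cvgM; [exact: cvg_cst|exact: continuous_cos].
have := @integration_by_substitution_increasing R (fun a => t * sin a) G 0 (pi / 2).
rewrite dF' sin0 sin_pihalf mulr0 mulr1 /Rintegral => -> //.
- by rewrite divr_ge0// pi_ge0.
- move=> a b /[!in_itv]/= /andP[a0 api] /andP[b0 bpi] ab; rewrite ltr_pM2l// ltr_sin// in_itv /=;
    have := pi_ge0 R; lra.
- by apply: cvgP (cvg_at_right_filter _); exact: cF'.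
- by apply: cvgP (cvg_at_left_filter _); exact: cF'.
- split; first by move=> x _; case: (dF x).
  + by apply: cvg_at_right_filter; have := cF 0; rewrite /continuous_at /= sin0 mulr0.
  + by apply: cvg_at_left_filter; exact: cF.
- exact: continuous_itv_within.
Qed.

Lemma Rintegral_cos_subst (t : R) (G : R -> R) : 0 < t ->
  (forall x, 0 <= x <= t -> {for x, continuous G}) ->
  \int[mu]_(x in `[0, t]) G x =
  \int[mu]_(a in `[0, pi / 2]) (G (t * cos a) * (t * sin a)).
Proof.
move=> t0 cG.
have dF a : is_derive a (1 : R) (fun a => t * cos a) (- (t * sin a)).
  by apply: is_derive_eq; rewrite scalerN.
have dF' : derive1 (fun a : R => t * cos a) = (fun a => - (t * sin a)).
  by apply/funext => a; rewrite derive1E; apply: derive_val.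
have cF : continuous (fun a => t * cos a).
  by move=> a; apply: cvgM; [exact: cvg_cst|exact: continuous_cos].
have cF' : continuous (fun a => - (t * sin a)).
  by move=> a; apply: cvgN; apply: cvgM; [exact: cvg_cst|exact: continuous_sin].
have := @integration_by_substitution_decreasing R (fun a => t * cos a) G 0 (pi / 2).
rewrite dF' cos0 cos_pihalf mulr0 mulr1 /Rintegral => -> //.
- by congr fine; apply: eq_integral => a _; congr EFin; rewrite /= opprK.
- by rewrite divr_ge0// pi_ge0.
- move=> a b /[!in_itv]/= /andP[a0 api] /andP[b0 bpi] ab; rewrite ltr_pM2l// ltr_cos// in_itv /=;
    have := pi_ge0 R; lra.
- by apply: cvgP (cvg_at_right_filter _); exact: cF'.
- by apply: cvgP (cvg_at_left_filter _); exact: cF'.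
- split; first by move=> x _; case: (dF x).
  + by apply: cvg_at_right_filter; exact: cF.
  + by apply: cvg_at_left_filter; have := cF (pi / 2); rewrite /continuous_at /= cos_pihalf mulr0.
- exact: continuous_itv_within.
Qed.

Lemma Rintegral_symm (t : R) (G : R -> R) : 0 < t ->
  (forall x, - t <= x <= t -> {for x, continuous G}) ->
  \int[mu]_(x in `[- t, t]) G x = \int[mu]_(x in `[0, t]) (G x + G (- x)).
Proof.
move=> t0 cG.
have iG : mu.-integrable `[- t, t] (EFin \o G) by exact: continuous_itv_integrable.
have nt0 : - t <= 0 by rewrite oppr_le0 ltW.
have cGN x : - t <= x <= t -> {for x, continuous (G \o -%R)}.
  move=> xt; apply: continuous_comp; first exact: continuousN.
  by apply: cG; rewrite lerN2 lerNl andbC.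
rewrite RintegralD//; last 2 first.
- by apply: continuous_itv_integrable => x /andP[x0 xt]; apply: cG; rewrite xt (le_trans nt0).
- by apply: continuous_itv_integrable => x /andP[x0 xt]; apply: cGN; rewrite xt (le_trans nt0).
have <- : \int[mu]_(x in `[- t, 0]) G x = \int[mu]_(x in `[0, t]) G (- x).
  have := @integration_by_substitution_oppr R G 0 t (ltW t0).
  rewrite oppr0 /Rintegral => -> //; apply: continuous_itv_within => x /andP[tx x0].
  by apply: cG; rewrite tx (le_trans x0)// ltW.
have <- : \int[mu]_(x in `]0, t]) G x = \int[mu]_(x in `[0, t]) G x.
  apply: Rintegral_itv_obnd_cbnd; apply: (integrableS _ _ _ iG) => //.
  by move=> x /=; rewrite !in_itv /= => /andP[x0 ->]; rewrite (le_trans nt0)// ltW.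
rewrite -(@Rintegral_itvB _ _ _ _ 0 iG) ?bnd_simp ?(ltW t0)//.
by rewrite subrK.
Qed.

Section slice_subst.
Variables (t : R) (f g : R * R -> R).
Hypothesis t0 : 0 < t.
Hypothesis cf : forall p, cdisc t p -> {for p, continuous f}.
Hypothesis cg : forall p, cdisc t p -> {for p, continuous g}.
Hypothesis dg : forall p, cdisc t p -> is_derive p.1 (1 : R) (fun x => g (x, p.2)) (f p).

Let s (y : R) : R := Num.sqrt (t ^+ 2 - y ^+ 2).

Let s2 y : - t <= y <= t -> s y ^+ 2 = t ^+ 2 - y ^+ 2.
Proof.
rewrite -ler_norml => yt; rewrite sqr_sqrtr// subr_ge0.
by rewrite -[y ^+ 2]real_normK ?num_real// ler_pXn2r// nnegrE// ltW.
Qed.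

Let cs : continuous s.
Proof.
move=> y; apply: (@continuous_comp _ _ _ (fun y : R => t ^+ 2 - y ^+ 2) Num.sqrt).
  by apply: cvgB; [exact: cvg_cst|under eq_fun do rewrite expr2; apply: cvgM; exact: cvg_id].
exact: sqrt_continuous.
Qed.

Let G (y : R) : R := g (s y, y) - g (- s y, y).

Let cG y : - t <= y <= t -> {for y, continuous G}.
Proof.
move=> yt; apply: continuousB; apply: continuous_comp2 => //=; (try exact: cs).
- by apply: cg; rewrite /cdisc /= s2// subrK.
- by apply: (@continuousN _ _ _ s); exact: cs.
- by apply: cg; rewrite /cdisc /= sqrrN s2// subrK.
Qed.

Let cGG y : 0 <= y <= t -> {for y, continuous (fun y => G y + G (- y))}.
Proof.
move=> /andP[y0 yt]; have ty : - t <= y by rewrite (le_trans _ y0)// oppr_le0 ltW.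
apply: continuousD; first by apply: cG; rewrite ty.
by apply: continuous_comp; [exact: continuousN|apply: cG; rewrite lerN2 lerNl yt].
Qed.

Let pi2 : 0 < pi / 2 :> R. Proof. by rewrite divr_gt0// pi_gt0. Qed.

Lemma Rintegral_slice_sin :
  \int[mu]_y \int[mu]_x (f \_ (odisc t)) (x, y) =
  \int[mu]_(a in `[0, pi / 2])
    ((g (t * cos a, t * sin a) - g (- (t * cos a), t * sin a) +
      (g (t * cos a, - (t * sin a)) - g (- (t * cos a), - (t * sin a)))) * (t * cos a)).
Proof.
rewrite (Rintegral_slice t0 cf cg dg) Rintegral_symm// (Rintegral_sin_subst t0)//.
apply: eq_Rintegral => a; rewrite inE /= in_itv /= => /andP[a0 api].
have sa : s (t * sin a) = t * cos a.
  rewrite /s exprMn -[t ^+ 2 in X in X - _]mulr1 -(cos2Dsin2 a) mulrDr addrK -exprMn sqrtr_sqr ger0_norm//.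
  by rewrite mulr_ge0 ?(ltW t0)// cos_ge0_pihalf//; lra.
by rewrite sqrrN -/(s _) sa.
Qed.

(** Meant for the integral in the second coordinate: once the coordinates are exchanged, the points
    (t sin a, t cos a) become the points (t cos a, t sin a) of [Rintegral_slice_sin], and the two
    contributions add up under one integral in a. *)
Lemma Rintegral_slice_cos :
  \int[mu]_y \int[mu]_x (f \_ (odisc t)) (x, y) =
  \int[mu]_(a in `[0, pi / 2])
    ((g (t * sin a, t * cos a) - g (- (t * sin a), t * cos a) +
      (g (t * sin a, - (t * cos a)) - g (- (t * sin a), - (t * cos a)))) * (t * sin a)).
Proof.
rewrite (Rintegral_slice t0 cf cg dg) Rintegral_symm// (Rintegral_cos_subst t0)//.
apply: eq_Rintegral => a; rewrite inE /= in_itv /= => /andP[a0 api].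
have sa : s (t * cos a) = t * sin a.
  rewrite /s exprMn -[t ^+ 2 in X in X - _]mulr1 -(cos2Dsin2 a) mulrDr addrAC subrr add0r -exprMn sqrtr_sqr ger0_norm//.
  by rewrite mulr_ge0 ?(ltW t0)// sin_ge0_pi//; lra.
by rewrite sqrrN -/(s _) sa.
Qed.

End slice_subst.

(** The x-interval is half-open on the left to match the range of integration in [char_fun], and
    closed on the right for the fundamental theorem of calculus; the difference is a null set. *)
Lemma Rintegral_rect_swap (a b c d : R) (f : R * R -> R) :
  (forall x y, a <= x <= b -> c <= y <= d -> {for (x, y), continuous f}) ->
  \int[mu]_(x in `]a, b]) \int[mu]_(y in `[c, d]) f (x, y) =
  \int[mu]_(y in `[c, d]) \int[mu]_(x in `[a, b]) f (x, y).
Proof.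
move=> cf; pose A : set (R * R) := `]a, b]%classic `*` `[c, d]%classic.
have mA : measurable A by apply: measurableX; exact: measurable_itv.
have iA : mu2.-integrable A (EFin \o f).
  apply: (@compact_continuous_integrable _ _ (`[a, b]%classic `*` `[c, d]%classic)) => //.
  - by move=> [x y] [/= xab ycd]; split => //; exact: subset_itv_oc_cc xab.
  - by apply: compact_setX; exact: segment_compact.
  - by move=> [x y] [/= /[!in_itv]/= xab ycd]; exact: cf.
have [fx fy] := Rintegral_fubini mA iA.
transitivity (\int[mu2]_(p in A) f p).
  rewrite fx Rintegral_mkcond; apply: eq_Rintegral => x _; rewrite patchE.
  case: ifPn => xab.
    by rewrite Rintegral_mkcond; apply: eq_Rintegral => y _; rewrite !patchE in_setX xab.
  under [RHS]eq_Rintegral => y _ do rewrite patchE in_setX (negbTE xab) /=.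
  by rewrite Rintegral_cst// mul0r.
rewrite fy [RHS]Rintegral_mkcond; apply: eq_Rintegral => y _; rewrite patchE.
case: ifPn => ycd.
  rewrite -Rintegral_itv_obnd_cbnd; last first.
    have : mu.-integrable `[a, b] (EFin \o (fun x => f (x, y))).
      apply: continuous_itv_integrable => x xab.
      apply: continuous_comp2 => //; first exact: cvg_cst.
      by apply: cf => //; move: ycd; rewrite inE /= in_itv.
    by apply: integrableS => //; exact: subset_itv_oc_cc.
  by rewrite [RHS]Rintegral_mkcond; apply: eq_Rintegral => x _; rewrite !patchE in_setX ycd andbT.
under eq_Rintegral => x _ do rewrite patchE in_setX (negbTE ycd) andbF.
by rewrite Rintegral_cst// mul0r.
Qed.

(** By the mean value theorem the difference quotient is a value of [df], hence within [e] of
    [m]. *)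
Lemma mean_value_bound (f df : R -> R) (a d m e : R) :
  (forall c, `|c - a| < d -> is_derive c (1 : R) f (df c) /\ `|df c - m| <= e) ->
  forall b, `|b - a| < d -> `|f b - f a - m * (b - a)| <= e * `|b - a|.
Proof.
move=> Pf b bd.
have H (u v : R) : u <= v -> (forall c, u <= c <= v -> `|c - a| < d) ->
    `|f v - f u - m * (v - u)| <= e * `|v - u|.
  move=> uv uvd.
  have [||c] := @MVT_segment R f df u v uv.
  - by move=> c /[!in_itv]/= /andP[uc cv]; apply: (Pf _ _).1; apply: uvd; rewrite !ltW.
  - apply: continuous_itv_within => c /uvd /Pf [[dfc _] _].
    exact/differentiable_continuous/derivable1_diffP.
  rewrite in_itv /= => /uvd /Pf [_ dfe] ->.
  by rewrite -mulrBl normrM; apply: ler_wpM2r.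
have [ab|ba] := leP a b.
  by apply: H => // c /andP[ac cb]; move: bd; rewrite !ltr_norml => /andP[? ?]; apply/andP; split; lra.
rewrite -normrN [X in e * X]distrC.
rewrite (_ : - (f b - f a - m * (b - a)) = f a - f b - m * (a - b)); last by ring.
apply: H; first exact: ltW.
by move=> c /andP[ac cb]; move: bd; rewrite !ltr_norml => /andP[? ?]; apply/andP; split; lra.
Qed.

(** * Jensen's formula for smooth functions *)

Section Jensen.
Variables (h hx hy hxx hyy : R * R -> R) (r : R).

Definition smooth_at (p : R * R) : Prop :=
  [/\ is_derive p.1 (1 : R) (fun x => h (x, p.2)) (hx p),
     is_derive p.2 (1 : R) (fun y => h (p.1, y)) (hy p),
     is_derive p.1 (1 : R) (fun x => hx (x, p.2)) (hxx p) &
     is_derive p.2 (1 : R) (fun y => hy (p.1, y)) (hyy p)] /\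
  [/\ {for p, continuous h}, {for p, continuous hx}, {for p, continuous hy},
     {for p, continuous hxx} & {for p, continuous hyy}].

Hypothesis smooth_h : forall p, cdisc r p -> \forall q \near p, smooth_at q.

Let sm p : cdisc r p -> smooth_at p.
Proof. by move=> /smooth_h /nbhs_singleton. Qed.

(** The increment is split into a step in the second coordinate followed by one in the first. On
    each leg the partial derivative stays within [e] of its value at [p], by continuity. *)
Lemma smooth_differentiable p (e : R) : cdisc r p -> 0 < e ->
  \forall q \near p, `|h q - h p - (hx p * (q.1 - p.1) + hy p * (q.2 - p.2))|
     <= e * (`|q.1 - p.1| + `|q.2 - p.2|).
Proof.
move=> rp e0.
have [[dx dy dxx dyy] [ch chx chy chxx chyy]] := sm rp.
have /cvgrPdist_le /(_ e e0) nx := chx; have /cvgrPdist_le /(_ e e0) ny := chy.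
have : \forall q \near p, [/\ smooth_at q, `|hx p - hx q| <= e & `|hy p - hy q| <= e].
  by near=> q; split; near: q; [exact: smooth_h|exact: nx|exact: ny].
move=> /nbhs_ballP[d /= d0 dP]; near=> q.
have [q1 q2] : `|q.1 - p.1| < d /\ `|q.2 - p.2| < d.
  have : ball p d q by near: q; exact: nbhsx_ballx.
  by rewrite /ball /= /prod_ball /= /ball /= distrC => -[? ]; rewrite distrC.
have P x y : `|x - p.1| < d -> `|y - p.2| < d ->
   [/\ smooth_at (x, y), `|hx p - hx (x, y)| <= e & `|hy p - hy (x, y)| <= e].
  by move=> xd yd; apply: dP; split; rewrite /ball /= distrC.
have p1d : `|p.1 - p.1| < d by rewrite subrr normr0.
have H1 : `|h (q.1, q.2) - h (p.1, q.2) - hx p * (q.1 - p.1)| <= e * `|q.1 - p.1|.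
  apply: (@mean_value_bound (fun x => h (x, q.2)) (fun x => hx (x, q.2)) _ d) => // c cd.
  by have [[[]]] := P c q.2 cd q2; rewrite distrC.
have H2 : `|h (p.1, q.2) - h (p.1, p.2) - hy p * (q.2 - p.2)| <= e * `|q.2 - p.2|.
  apply: (@mean_value_bound (fun y => h (p.1, y)) (fun y => hy (p.1, y)) _ d) => // c cd.
  by have [[[_ dyc _ _] _] _] := P p.1 c p1d cd; rewrite distrC.
rewrite [leRHS]mulrDr; apply: le_trans (lerD H1 H2); apply: le_trans (ler_normD _ _).
rewrite -!surjective_pairing le_eqVlt; apply/orP; left; apply/eqP; congr `|_|; ring.
Unshelve. all: by end_near. Qed.

Lemma smooth_derive_ray (c s t : R) : cdisc r (t * c, t * s) ->
  is_derive t (1 : R) (fun t => h (t * c, t * s))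
    (c * hx (t * c, t * s) + s * hy (t * c, t * s)).
Proof.
move=> rt; apply/is_derive_ler => e e0.
have e1 : 0 < e / (`|c| + `|s| + 1) by rewrite divr_gt0// ltr_wpDl.
have cts : {for t, continuous (fun t : R => (t * c, t * s))}.
  by apply: continuous_pair; apply: cvgM; (exact: cvg_id || exact: cvg_cst).
have := near_continuous cts (smooth_differentiable rt e1).
apply: filterS => y /=; rewrite -!mulrBl !normrM -mulrDr => H.
rewrite (_ : (y - t) *: _ = hx (t * c, t * s) * ((y - t) * c) + hy (t * c, t * s) * ((y - t) * s)); last first.
  by rewrite /GRing.scale /=; ring.
apply: le_trans H _; rewrite mulrCA [leRHS]mulrC; apply: ler_wpM2l => //.
by rewrite -mulrA ler_piMr ?(ltW e0)// mulrC ler_pdivrMr ?mul1r ?lerDl// ltr_wpDl.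
Qed.

Hypothesis r0 : 0 < r.

Let cK (k : R * R -> R) (u v : R -> R) (x : R) :
  (forall p, cdisc r p -> {for p, continuous k}) ->
  {for x, continuous u} -> {for x, continuous v} -> cdisc r (u x, v x) ->
  {for x, continuous (fun t => k (u t, v t))}.
Proof. by move=> ck cu cv ruv; apply: continuous_comp2 => //; exact: ck. Qed.

(** The signs [e1], [e2] select the quadrant, while the angle [a] stays in [0, pi / 2]. *)
Let pol (e1 e2 t a : R) : R * R := (t * (e1 * cos a), t * (e2 * sin a)).

Let pol_cdisc e1 e2 t a : e1 ^+ 2 = 1 -> e2 ^+ 2 = 1 -> 0 <= t <= r -> cdisc r (pol e1 e2 t a).
Proof.
move=> h1 h2 tr; apply: (cdiscS tr); rewrite /cdisc /= !exprMn h1 h2 !mul1r -mulrDr cos2Dsin2.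
by rewrite mulr1.
Qed.

Let radial e1 e2 t a := e1 * cos a * hx (pol e1 e2 t a) + e2 * sin a * hy (pol e1 e2 t a).

Let cont_pol e1 e2 : continuous (fun q : R * R => pol e1 e2 q.1 q.2).
Proof.
move=> q; apply: (@continuous_pair _ _ _ (fun q : R * R => q.1 * (e1 * cos q.2)) (fun q : R * R => q.1 * (e2 * sin q.2)));
  apply: continuousM; (try exact: cvg_fst); apply: continuousM;
  (try exact: cvg_cst); apply: continuous_comp; (try exact: cvg_snd).
- exact: continuous_cos.
- exact: continuous_sin.
Qed.

Let cont_radial e1 e2 (q : R * R) : e1 ^+ 2 = 1 -> e2 ^+ 2 = 1 -> 0 <= q.1 <= r ->
  {for q, continuous (fun q => radial e1 e2 q.1 q.2)}.
Proof.
move=> h1 h2 qr; apply: continuousD; apply: continuousM.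
- apply: continuousM; first exact: cvg_cst.
  by apply: continuous_comp; [exact: cvg_snd|exact: continuous_cos].
- apply: continuous_comp; first exact: cont_pol.
  by have [_ []] := sm (pol_cdisc q.2 h1 h2 qr).
- apply: continuousM; first exact: cvg_cst.
  by apply: continuous_comp; [exact: cvg_snd|exact: continuous_sin].
- apply: continuous_comp; first exact: cont_pol.
  by have [_ []] := sm (pol_cdisc q.2 h1 h2 qr).
Qed.

Let sq1 : (1 : R) ^+ 2 = 1. Proof. exact: expr1n. Qed.
Let sqN1 : (-1 : R) ^+ 2 = 1. Proof. by rewrite sqrrN expr1n. Qed.

Let radial4 t a := radial 1 1 t a + radial 1 (-1) t a + (radial (-1) 1 t a + radial (-1) (-1) t a).

Let cont_radial4 (q : R * R) : 0 <= q.1 <= r ->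
  {for q, continuous (fun q => radial4 q.1 q.2)}.
Proof.
by move=> qr; apply: continuousD; apply: continuousD; apply: cont_radial.
Qed.

(* The flux of the gradient through the circle of radius [t]. *)
Let Green t : 0 < t <= r ->
  \int[mu2]_(p in odisc t) (hxx p + hyy p) =
  t * \int[mu]_(a in `[0, pi / 2]) radial4 t a.
Proof.
move=> /andP[t0 tr].
have tr' : cdisc t `<=` cdisc r by apply: cdiscS; rewrite ltW.
have integ (k : R * R -> R) : (forall p, cdisc t p -> {for p, continuous k}) ->
    mu2.-integrable (odisc t) (EFin \o k).
  move=> ck; apply: (@compact_continuous_integrable _ _ (cdisc t)) => //.
  - by apply: open_measurable_prod; exact: open_odisc.
  - exact: odisc_cdisc.
  - exact/compact_cdisc/ltW.
have cx p : cdisc t p -> {for p, continuous hx} by move=> /tr' /sm [_ []].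
have cy p : cdisc t p -> {for p, continuous hy} by move=> /tr' /sm [_ []].
have cxx p : cdisc t p -> {for p, continuous hxx} by move=> /tr' /sm [_ []].
have cyy p : cdisc t p -> {for p, continuous hyy} by move=> /tr' /sm [_ []].
have dx p : cdisc t p -> is_derive p.1 (1 : R) (fun x => hx (x, p.2)) (hxx p) by move=> /tr' /sm [[]].
have dy p : cdisc t p -> is_derive p.2 (1 : R) (fun y => hy (p.1, y)) (hyy p) by move=> /tr' /sm [[]].
have mD : measurable (odisc t) by apply: open_measurable_prod; exact: open_odisc.
rewrite RintegralD ?integ//.
have [_ ->] := Rintegral_fubini mD (integ _ cxx).
have [-> _] := Rintegral_fubini mD (integ _ cyy).
rewrite (Rintegral_slice_sin t0 cxx cx dx).
pose sw (k : R * R -> R) := fun p : R * R => k (p.2, p.1).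
have csw k : (forall p, cdisc t p -> {for p, continuous k}) ->
    forall p, cdisc t p -> {for p, continuous (sw k)}.
  move=> ck p pt; apply: continuous_comp2; [exact: cvg_snd|exact: cvg_fst|].
  by apply: ck; rewrite /cdisc /= addrC.
have -> : \int[mu]_x \int[mu]_y (hyy \_ (odisc t)) (x, y) =
    \int[mu]_x \int[mu]_y ((sw hyy) \_ (odisc t)) (y, x).
  apply: eq_Rintegral => x _; apply: eq_Rintegral => y _; rewrite !patchE /sw /=.
  suff -> : ((x, y) \in odisc t) = ((y, x) \in odisc t) by [].
  by apply/idP/idP; rewrite !inE /odisc /= addrC.
have dsw p : cdisc t p -> is_derive p.1 (1 : R) (fun x => sw hy (x, p.2)) (sw hyy p).
  by move=> pt; apply: (dy (p.2, p.1)); rewrite /cdisc /= addrC.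
rewrite (Rintegral_slice_cos t0 (csw _ cyy) (csw _ cy) dsw).
have polE e1 e2 a : pol e1 e2 t a = (e1 * (t * cos a), e2 * (t * sin a)).
  by rewrite /pol; congr (_, _); rewrite mulrCA.
have ck e1 e2 (k : R * R -> R) : e1 ^+ 2 = 1 -> e2 ^+ 2 = 1 ->
    (forall p, cdisc t p -> {for p, continuous k}) ->
    continuous (fun a => k (e1 * (t * cos a), e2 * (t * sin a))).
  move=> h1 h2 ck a; apply: continuous_comp2.
  - by apply: continuousM; [exact: cvg_cst|apply: continuousM; [exact: cvg_cst|exact: continuous_cos]].
  - by apply: continuousM; [exact: cvg_cst|apply: continuousM; [exact: cvg_cst|exact: continuous_sin]].
  - by apply: ck; rewrite /cdisc /= !exprMn h1 h2 !mul1r -mulrDr cos2Dsin2 mulr1.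
pose X (a : R) : R := (hx (1 * (t * cos a), 1 * (t * sin a)) - hx (-1 * (t * cos a), 1 * (t * sin a)) +
      (hx (1 * (t * cos a), -1 * (t * sin a)) - hx (-1 * (t * cos a), -1 * (t * sin a)))) * (t * cos a).
pose Y (a : R) : R := (hy (1 * (t * cos a), 1 * (t * sin a)) - hy (1 * (t * cos a), -1 * (t * sin a)) +
      (hy (-1 * (t * cos a), 1 * (t * sin a)) - hy (-1 * (t * cos a), -1 * (t * sin a)))) * (t * sin a).
have cX a : {for a, continuous X}.
  rewrite /X; apply: continuousM.
    by apply: continuousD; apply: continuousB; apply: ck.
  by apply: continuousM; [exact: cvg_cst|exact: continuous_cos].
have cY a : {for a, continuous Y}.
  rewrite /Y; apply: continuousM.
    by apply: continuousD; apply: continuousB; apply: ck.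
  by apply: continuousM; [exact: cvg_cst|exact: continuous_sin].
transitivity (\int[mu]_(a in `[0, pi / 2]) X a + \int[mu]_(a in `[0, pi / 2]) Y a).
  congr (_ + _); apply: eq_Rintegral => a _; rewrite /X /Y /sw ?mul1r ?mulN1r//=.
rewrite -RintegralD//; last 2 first.
- by apply: continuous_itv_integrable => a _; exact: cX.
- by apply: continuous_itv_integrable => a _; exact: cY.
rewrite -RintegralZl//; last first.
  apply: continuous_itv_integrable => a _.
  apply: (@continuous_comp2 _ _ _ _ (fun q => radial4 q.1 q.2) (cst t) id) => //; first exact: cvg_cst.
  by apply: cont_radial4; rewrite /= tr ltW.
apply: eq_Rintegral => a _; rewrite /X /Y /radial4 /radial !polE.
by ring.
Qed.

(** The factor t^-1 cancels the factor t of the flux in [Green] and leaves the angular integral of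
    the radial derivative. After the integrals are exchanged, each ray is integrated by the
    fundamental theorem of calculus; four rays start at the centre, whence the weight 4. *)
Theorem jensen_smooth :
  \int[mu]_(t in `]0, r]) (t^-1 * \int[mu2]_(p in odisc t) (hxx p + hyy p)) =
  \int[mu]_(a in `[0, pi / 2])
    (h (r * cos a, r * sin a) + h (r * cos a, - (r * sin a)) +
     (h (- (r * cos a), r * sin a) + h (- (r * cos a), - (r * sin a))) - 4 * h (0, 0)).
Proof.
transitivity (\int[mu]_(t in `]0, r]) \int[mu]_(a in `[0, pi / 2]) radial4 t a).
  apply: eq_Rintegral => t; rewrite inE /= in_itv /= => tr.
  by rewrite Green// mulKf// gt_eqF//; case/andP: tr.
rewrite (@Rintegral_rect_swap 0 r 0 (pi / 2) (fun q => radial4 q.1 q.2)); last first.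
  by move=> x y xr _; exact: cont_radial4.
apply: eq_Rintegral => a _ /=.
pose hpol e1 e2 t := h (t * (e1 * cos a), t * (e2 * sin a)).
have FTC : \int[mu]_(x in `[0, r]) radial4 x a =
    (hpol 1 1 r + hpol 1 (-1) r + (hpol (-1) 1 r + hpol (-1) (-1) r)) -
    (hpol 1 1 0 + hpol 1 (-1) 0 + (hpol (-1) 1 0 + hpol (-1) (-1) 0)).
  apply: (@Rintegral_FTC _ (radial4 ^~ a)
    (fun t => hpol 1 1 t + hpol 1 (-1) t + (hpol (-1) 1 t + hpol (-1) (-1) t)) 0 r).
  - exact: ltW.
  - move=> t tr; apply: (@continuous_comp2 _ _ _ _ (fun q => radial4 q.1 q.2) id (cst a)) => //; first exact: cvg_cst.
    exact: cont_radial4.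
  - move=> t tr; have dh e1 e2 : e1 ^+ 2 = 1 -> e2 ^+ 2 = 1 -> is_derive t (1 : R) (hpol e1 e2) (radial e1 e2 t a).
      by move=> h1 h2; apply: smooth_derive_ray; exact: pol_cdisc.
    have d11 := dh _ _ sq1 sq1; have dNN := dh _ _ sqN1 sqN1.
    have d1N := dh _ _ sq1 sqN1; have dN1 := dh _ _ sqN1 sq1.
    exact: is_deriveD.
by rewrite FTC /hpol !mul0r !mul1r !mulN1r !mulrN; ring.
Qed.

End Jensen.

End Green.

(** * Complex differentiable functions *)

Section RealNorm.
Context {R : realType}.
Local Notation C := (cplx R).
Local Notation Re := complex.Re.
Local Notation Im := complex.Im.

(** Norms of spaces over [R[i]] take values in [R[i]], whose order is partial; [nm] is the same norm
    with real values, so that real arithmetic applies. *)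
Definition nm {V : normedModType R[i]} (x : V) : R := Re `|x|.

Section nm_theory.
Variable V : normedModType R[i].
Implicit Types x y : V.

Lemma nmE x : `|x| = (nm x)%:C.
Proof.
have : `|x| \is Num.real by rewrite ger0_real.
by move=> /RRe_real <-.
Qed.

Lemma nm_ge0 x : 0 <= nm x.
Proof. by rewrite -ler0c -nmE. Qed.

Lemma nm0 : nm (0 : V) = 0. Proof. by rewrite /nm normr0. Qed.

Lemma nm_eq0 x : (nm x == 0) = (x == 0).
Proof. by rewrite -[RHS]normr_eq0 nmE fmorph_eq0. Qed.

Lemma nm_gt0 x : (0 < nm x) = (x != 0).
Proof. by rewrite lt_def nm_ge0 andbT nm_eq0. Qed.

Lemma nmD x y : nm (x + y) <= nm x + nm y.
Proof. by have := ler_normD x y; rewrite !nmE -rmorphD lecR. Qed.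

Lemma nmN x : nm (- x) = nm x. Proof. by rewrite /nm normrN. Qed.

Lemma nmB x y : nm (x - y) = nm (y - x). Proof. by rewrite /nm distrC. Qed.

Lemma nmBD x y : nm (x - y) <= nm x + nm y.
Proof. by rewrite -(nmN y) nmD. Qed.

Lemma nm_triangle x y z : nm (x - z) <= nm (x - y) + nm (y - z).
Proof. by rewrite -(subrKA y) nmD. Qed.

Lemma nm_sub_le x y : nm x - nm y <= nm (x - y).
Proof. by rewrite lerBlDr -{1}(subrK y x) nmD. Qed.

End nm_theory.

Lemma nmZ (V : normedModType R[i]) (a : C) (x : V) : nm (a *: x) = nm a * nm x.
Proof. by apply: complexI; rewrite rmorphM /= -!nmE normrZ. Qed.

Lemma nmCE (a : R[i]) : `|a| = (nm (a : C))%:C.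
Proof. exact: (nmE (a : C)). Qed.

Lemma nmM (a b : C) : nm (a * b : C) = nm a * nm b.
Proof. exact: (@nmZ C a b). Qed.

Lemma nm1 : nm (1 : C) = 1. Proof. by rewrite /nm normr1. Qed.

Lemma nmV (a : C) : nm (a^-1 : C) = (nm a)^-1.
Proof.
have [->|a0] := eqVneq a 0; first by rewrite invr0 nm0 invr0.
have na0 : nm a != 0 by rewrite nm_eq0.
by apply: (mulfI na0); rewrite -nmM !divff// nm1.
Qed.

Lemma nmX (a : C) n : nm (a ^+ n : C) = nm a ^+ n.
Proof. by elim: n => [|n IH]; rewrite ?expr0 ?nm1// !exprS nmM IH. Qed.

Lemma nm_conj (a : C) : nm (a^* : C) = nm a.
Proof. by rewrite /nm normcJ. Qed.

Lemma nm_real (x : R) : nm (x%:C : C) = `|x|.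
Proof. by rewrite /nm normc_def /= expr0n addr0 sqrtr_sqr. Qed.

Lemma nm_i : nm ('i : C) = 1.
Proof. by rewrite /nm normc_def /= expr0n add0r expr1n sqrtr1. Qed.

Lemma nm_sqr (a : C) : nm a ^+ 2 = Re a ^+ 2 + Im a ^+ 2.
Proof. by rewrite /nm normc_def /= sqr_sqrtr// addr_ge0// sqr_ge0. Qed.

Lemma nm_sqrC (a : C) : ((nm a) ^+ 2)%:C = a * conjc a.
Proof. by rewrite -sqr_normc nmCE rmorphXn. Qed.

Lemma nm_Re (a : C) : `|Re a| <= nm a.
Proof. by have := normc_ge_Re a; rewrite nmCE lecR. Qed.

Lemma nm_Im (a : C) : `|Im a| <= nm a.
Proof. by have := nm_Re (a * 'i); rewrite ReiNIm normrN nmM nm_i mulr1. Qed.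

Lemma nm_le_ReIm (a : C) : nm a <= `|Re a| + `|Im a|.
Proof.
rewrite {1}(complexE a); apply: le_trans (nmD _ _) _.
by rewrite nmM nm_i mul1r !nm_real.
Qed.

Lemma ltC0 (e : R[i]) : 0 < e -> exists2 e' : R, 0 < e' & e = e'%:C.
Proof.
move=> e0; exists (Re e); last by rewrite RRe_real// gtr0_real.
by rewrite -ltcR RRe_real// gtr0_real.
Qed.

Lemma near_nm (V : normedModType R[i]) (x : V) (P : set V) :
  (\forall y \near x, P y) <-> exists2 d : R, 0 < d & forall y, nm (y - x) < d -> P y.
Proof.
split=> [/nbhs_normP[e /= /ltC0[d d0 ->] dP]|[d d0 dP]].
  by exists d => // y yd; apply: dP; rewrite /= distrC nmE ltcR.
apply/nbhs_normP; exists d%:C; first by rewrite /= ltcR.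
by move=> y /=; rewrite distrC nmE ltcR => /dP.
Qed.

Lemma cvg_nm (V : normedModType R[i]) (T : Type) (F : set_system T) (FF : Filter F) (f : T -> V) (l : V) :
  (f @ F --> l) <-> forall e : R, 0 < e -> \forall t \near F, nm (f t - l) < e.
Proof.
split=> [/cvgrPdist_lt fl e e0|fl].
  have e0' : 0 < e%:C by rewrite ltcR.
  by apply: filterS (fl _ e0') => t; rewrite distrC nmE ltcR.
by apply/cvgrPdist_lt => e /ltC0[d d0 ->]; apply: filterS (fl _ d0) => t; rewrite distrC nmE ltcR.
Qed.

Lemma is_derive_nm (V : normedModType R[i]) (f : C -> V) (x : C) (d : V) :
  is_derive x (1 : C) f d <->
  forall e : R, 0 < e -> \forall y \near x, nm (f y - f x - (y - x) *: d) <= e * nm (y - x).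
Proof.
rewrite is_derive_ler; split=> [H e e0|H e /ltC0[e' e0 ->]].
  have e0' : 0 < e%:C by rewrite ltcR.
  by apply: filterS (H _ e0') => y; rewrite !nmE -rmorphM lecR.
by apply: filterS (H _ e0) => y; rewrite !nmE -rmorphM lecR.
Qed.

Lemma is_derive_continuous (V : normedModType R[i]) (f : C -> V) (x : C) (d : V) :
  is_derive x (1 : C) f d -> {for x, continuous f}.
Proof. by move=> df; apply/differentiable_continuous/derivable1_diffP. Qed.

Lemma continuous_Re : continuous (@Re R : C -> R).
Proof.
move=> z; apply/(@cvgrPdist_lt _ _ _ (nbhs z) (nbhs_filter z)) => e e0; apply: (near_nm (z : C) _).2; exists e => // y yz.
by rewrite distrC -raddfB; apply: le_lt_trans yz; exact: nm_Re.
Qed.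

Lemma continuous_Im : continuous (@Im R : C -> R).
Proof.
move=> z; apply/(@cvgrPdist_lt _ _ _ (nbhs z) (nbhs_filter z)) => e e0; apply: (near_nm (z : C) _).2; exists e => // y yz.
by rewrite distrC -raddfB; apply: le_lt_trans yz; exact: nm_Im.
Qed.

Lemma continuous_conj : continuous ((fun z => z^*) : C -> C).
Proof.
move=> z; apply/(@cvg_nm _ _ (nbhs z) (nbhs_filter z)) => e e0; apply: (near_nm (z : C) _).2; exists e => // y yz.
by rewrite -rmorphB nm_conj.
Qed.

Lemma continuous_complex (U : topologicalType) (u v : U -> R) (x : U) :
  {for x, continuous u} -> {for x, continuous v} ->
  {for x, continuous (fun t => (u t +i* v t) : C)}.
Proof.
move=> cu cv; apply/cvg_nm => e e0; have e2 : 0 < e / 2 by rewrite divr_gt0.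
have /cvgrPdist_lt/(_ _ e2) nu := cu; have /cvgrPdist_lt/(_ _ e2) nv := cv.
near=> t; apply: le_lt_trans (nm_le_ReIm _) _; rewrite /= (splitr e); apply: ltrD.
  by rewrite distrC; near: t.
by rewrite distrC; near: t.
Unshelve. all: by end_near. Qed.

Lemma continuous_nm (V : normedModType R[i]) : continuous (@nm V).
Proof.
move=> z; apply/(@cvgrPdist_lt _ _ _ (nbhs z) (nbhs_filter z)) => e e0; apply: (near_nm (z : V) _).2; exists e => // y yz.
rewrite distrC; apply: le_lt_trans yz; rewrite ler_norml nm_sub_le andbT.
by rewrite lerNl opprB nmB nm_sub_le.
Qed.

Lemma continuous_ofR : continuous ((fun t => t%:C) : R -> C).
Proof. by move=> t; apply: continuous_complex; [exact: cvg_id|exact: cvg_cst]. Qed.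

End RealNorm.

(** * Goursat's theorem on rectangles *)

Section Goursat.
Context {R : realType}.
Local Notation mu := (@lebesgue_measure R).
Implicit Types (P Q : R * R -> R) (p q : R * R).

Lemma Rintegral_split (f : R -> R) (a m b : R) : a <= m <= b ->
  (forall x, a <= x <= b -> {for x, continuous f}) ->
  \int[mu]_(x in `[a, b]) f x = \int[mu]_(x in `[a, m]) f x + \int[mu]_(x in `[m, b]) f x.
Proof.
move=> /andP[am mb] cf; have iF := continuous_itv_integrable cf.
have <- : \int[mu]_(x in `]m, b]) f x = \int[mu]_(x in `[m, b]) f x.
  apply: Rintegral_itv_obnd_cbnd; apply: (integrableS _ _ _ iF) => //.
  by move=> x /=; rewrite !in_itv /= => /andP[x0 ->]; rewrite (le_trans am)// ltW.
rewrite -(@Rintegral_itvB _ _ _ _ m iF) ?bnd_simp//.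
by rewrite addrC subrK.
Qed.

Lemma Rintegral_near_cst (f : R -> R) (a b k e : R) : a <= b ->
  (forall x, a <= x <= b -> {for x, continuous f}) ->
  (forall x, a <= x <= b -> `|f x - k| <= e) ->
  `|\int[mu]_(x in `[a, b]) f x - (b - a) * k| <= (b - a) * e.
Proof.
move=> ab cf fk; have iF := continuous_itv_integrable cf.
have E c : \int[mu]_(x in `[a, b]) c = (b - a) * c.
  rewrite Rintegral_cst//= lebesgue_measure_itv/=; case: ifPn; first by rewrite mulrC.
  by rewrite lte_fin -leNgt => ba; rewrite (le_anti (_ : a <= b <= a)) ?ab// subrr mul0r mulr0.
have iC c : mu.-integrable `[a, b] (EFin \o (fun=> c)).
  by apply: continuous_itv_integrable => x _; exact: cvg_cst.
rewrite -!E -RintegralB//.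
apply: le_trans (le_normr_Rintegral _ _) _ => //.
  by apply: continuous_itv_integrable => x xab; apply: continuousB; [exact: cf|exact: cvg_cst].
apply: le_Rintegral => //.
- apply: continuous_itv_integrable => x xab.
  apply: (@continuous_comp _ _ _ (fun x => f x - k) Num.norm); last exact: norm_continuous.
  by apply: continuousB; [exact: cf|exact: cvg_cst].
Qed.

(** Total differentiability at the single point [p] with gradient (a, b); continuity of the partial
    derivatives is not part of it, as is usual for Goursat's argument. *)
Definition rdiff2 P p (a b : R) : Prop := forall e : R, 0 < e ->
  \forall q \near p, `|P q - P p - ((q.1 - p.1) * a + (q.2 - p.2) * b)|
    <= e * (`|q.1 - p.1| + `|q.2 - p.2|).

Lemma near_prod p (A : set (R * R)) : (\forall q \near p, A q) ->
  exists2 d : R, 0 < d & forall q, `|q.1 - p.1| < d -> `|q.2 - p.2| < d -> A q.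
Proof.
move=> /nbhs_ballP[d /= d0 dA]; exists d => // q q1 q2; apply: dA.
by split; rewrite /ball /= distrC.
Qed.

Lemma prod_near p (A : set (R * R)) (d : R) : 0 < d ->
  (forall q, `|q.1 - p.1| < d -> `|q.2 - p.2| < d -> A q) -> \forall q \near p, A q.
Proof.
move=> d0 dA; apply/nbhs_ballP; exists d => // q [q1 q2].
by apply: dA; rewrite distrC.
Qed.

Lemma rdiff2_continuous P p a b : rdiff2 P p a b -> {for p, continuous P}.
Proof.
move=> dP; apply/(@cvgrPdist_lt _ _ _ (nbhs p) (nbhs_filter p)) => e e0.
have [d d0 H] := near_prod (dP 1 ltr01).
pose M := 2 + `|a| + `|b|.
have M0 : 0 < M by rewrite /M !ltr_wpDr.
apply: (@prod_near _ _ (Num.min d (e / (2 * M)))).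
  by rewrite lt_min d0 divr_gt0// mulr_gt0.
move=> q; rewrite !lt_min => /andP[q1 q1e] /andP[q2 q2e].
have := H q q1 q2; move: q1e q2e; set u := q.1 - p.1; set v := q.2 - p.2 => q1e q2e Huv.
rewrite distrC; have -> : P q - P p = (P q - P p - (u * a + v * b)) + (u * a + v * b) by ring.
apply: le_lt_trans (ler_normD _ _) _.
have uM : `|u| * M < e / 2 by rewrite -ltr_pdivlMr// -mulrA -invfM.
have vM : `|v| * M < e / 2 by rewrite -ltr_pdivlMr// -mulrA -invfM.
have := ler_normD (u * a) (v * b); rewrite !normrM => Hab.
have := mulr_ge0 (normr_ge0 u) (normr_ge0 b); have := mulr_ge0 (normr_ge0 v) (normr_ge0 a).
have := normr_ge0 u; have := normr_ge0 v.
move: uM vM Huv Hab; rewrite /M !mulrDr mul1r; lra.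
Qed.

(** The integral of P dx + Q dy along the boundary of the rectangle, counterclockwise. *)
Definition circ P Q (a b c d : R) : R :=
  \int[mu]_(x in `[a, b]) (P (x, c) - P (x, d)) +
  \int[mu]_(y in `[c, d]) (Q (b, y) - Q (a, y)).

(** The shared [k] says that P dx + Q dy is closed at each point. If the integral were nonzero,
    repeated quartering would give nested rectangles, the n-th with an integral of size at least M /
    4^n, shrinking to a point. There the linear parts of P and Q contribute nothing, and the
    remainder is of smaller order than the area. *)
Lemma goursat P Q (a b c d : R) : a <= b -> c <= d ->
  (forall x y, a <= x <= b -> c <= y <= d -> exists a1 k b2,
     rdiff2 P (x, y) a1 k /\ rdiff2 Q (x, y) k b2) ->
  circ P Q a b c d = 0.
Proof.
move=> ab cd dPQ.
have cP x y : a <= x <= b -> c <= y <= d -> {for (x, y), continuous P}.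
  by move=> xab ycd; have [? [? [? [/rdiff2_continuous]]]] := dPQ x y xab ycd.
have cQ x y : a <= x <= b -> c <= y <= d -> {for (x, y), continuous Q}.
  by move=> xab ycd; have [? [? [? [_ /rdiff2_continuous]]]] := dPQ x y xab ycd.
have cPx x y y' : a <= x <= b -> c <= y <= d -> c <= y' <= d ->
    {for x, continuous (fun x => P (x, y) - P (x, y'))}.
  by move=> xab ycd y'cd; apply: continuousB; apply: continuous_comp2 => //;
    by [exact: cvg_cst|exact: cP].
have cQy x x' y : a <= x <= b -> a <= x' <= b -> c <= y <= d ->
    {for y, continuous (fun y => Q (x, y) - Q (x', y))}.
  by move=> xab x'ab ycd; apply: continuousB; apply: continuous_comp2 => //;
    by [exact: cvg_cst|exact: cQ].
have splitx x m x' y y' : a <= x -> x <= m <= x' -> x' <= b -> c <= y -> y <= y' -> y' <= d ->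
    circ P Q x x' y y' = circ P Q x m y y' + circ P Q m x' y y'.
  move=> ax /andP[xm mx'] x'b cy yy' y'd; rewrite /circ (@Rintegral_split _ x m x'); first last.
  - by move=> t /andP[xt tx']; apply: cPx; apply/andP; split; lra.
  - by rewrite xm.
  have -> : \int[mu]_(y in `[y, y']) (Q (x', y) - Q (x, y)) =
     \int[mu]_(y in `[y, y']) (Q (m, y) - Q (x, y)) + \int[mu]_(y in `[y, y']) (Q (x', y) - Q (m, y)).
    rewrite -RintegralD//; first (by apply: eq_Rintegral => t _; ring);
      by apply: continuous_itv_integrable => t /andP[yt ty']; apply: cQy; apply/andP; split; lra.
  by ring.
have splity x x' y m y' : a <= x -> x <= x' -> x' <= b -> c <= y -> y <= m <= y' -> y' <= d ->
    circ P Q x x' y y' = circ P Q x x' y m + circ P Q x x' m y'.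
  move=> ax xx' x'b cy /andP[ym my'] y'd; rewrite /circ (@Rintegral_split (fun y => Q (x', y) - Q (x, y)) y m y'); first last.
  - by move=> t /andP[xt tx']; apply: cQy; apply/andP; split; lra.
  - by rewrite ym.
  have -> : \int[mu]_(t in `[x, x']) (P (t, y) - P (t, y')) =
     \int[mu]_(t in `[x, x']) (P (t, y) - P (t, m)) + \int[mu]_(t in `[x, x']) (P (t, m) - P (t, y')).
    rewrite -RintegralD//; first (by apply: eq_Rintegral => t _; ring);
      by apply: continuous_itv_integrable => t /andP[yt ty']; apply: cPx; apply/andP; split; lra.
  by ring.
pose w n : R := (b - a) / 2 ^+ n; pose h n : R := (d - c) / 2 ^+ n.
have w2 n : w n = w n.+1 + w n.+1 by rewrite /w exprS; field.
have h2 n : h n = h n.+1 + h n.+1 by rewrite /h exprS; field.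
have w0 n : 0 <= w n by rewrite divr_ge0// subr_ge0.
have h0 n : 0 <= h n by rewrite divr_ge0// subr_ge0.
have wE n : w n * 2 ^+ n = b - a by rewrite mulfVK// expf_neq0.
have hE n : h n * 2 ^+ n = d - c by rewrite mulfVK// expf_neq0.
have w00 : w 0%N = b - a by rewrite /w expr0 divr1.
have h00 : h 0%N = d - c by rewrite /h expr0 divr1.
clearbody w h.
apply/eqP; rewrite -normr_eq0; apply: contraT => M0.
have [M ME] : exists M : R, M = `|circ P Q a b c d| by eexists.
rewrite -ME in M0; have {}M0 : 0 < M by rewrite lt_def M0 ME normr_ge0.
pose ok n p := [/\ a <= p.1, p.1 + w n <= b, c <= p.2, p.2 + h n <= d &
  M <= 4 ^+ n * `|circ P Q p.1 (p.1 + w n) p.2 (p.2 + h n)|].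
pose nxt n p q := [/\ p.1 <= q.1, q.1 + w n.+1 <= p.1 + w n, p.2 <= q.2, q.2 + h n.+1 <= p.2 + h n & ok n.+1 q].
have step n p : ok n p -> exists q, nxt n p q.
  case: p => x y; rewrite /nxt /ok /=; move: (w2 n) (h2 n) (w0 n.+1) (h0 n.+1).
  move: (w n) (h n) (w n.+1) (h n.+1) => _ _ w' h' -> -> w'0 h'0; rewrite !addrA => -[ax xb cy yd Mp].
  have xw : a <= x + w' by clear - ax w'0; lra.
  have xw1 : x + w' <= b by clear - xb w'0; lra.
  have yh : c <= y + h' by clear - cy h'0; lra.
  have yh1 : y + h' <= d by clear - yd h'0; lra.
  have E : circ P Q x (x + w' + w') y (y + h' + h') =
     circ P Q x (x + w') y (y + h') + circ P Q x (x + w') (y + h') (y + h' + h') +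
     (circ P Q (x + w') (x + w' + w') y (y + h') + circ P Q (x + w') (x + w' + w') (y + h') (y + h' + h')).
    rewrite (splitx x (x + w'))// ?lerDl ?w'0 ?h'0//; last by rewrite -addrA lerDl addr_ge0.
    by congr (_ + _); apply: splity; rewrite ?lerDl ?w'0 ?h'0.
  move: Mp; rewrite E.
  set A1 := circ P Q x _ y _; set A2 := circ P Q x _ (y + h') _.
  set A3 := circ P Q (x + w') _ y _; set A4 := circ P Q _ _ _ _ => Mp.
  have Mle : M <= 4 ^+ n * `|A1| + 4 ^+ n * `|A2| + (4 ^+ n * `|A3| + 4 ^+ n * `|A4|).
    rewrite -!mulrDr; apply: le_trans Mp _; rewrite ler_wpM2l ?exprn_ge0//.
    apply: le_trans (ler_normD _ _) _; apply: lerD; exact: ler_normD.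
  have [H1|H1] := leP M (4 * (4 ^+ n * `|A1|)).
    by exists (x, y); rewrite /= exprS -mulrA; (split; last split) => //; rewrite ?lexx ?lerDl.
  have [H2|H2] := leP M (4 * (4 ^+ n * `|A2|)).
    by exists (x, y + h'); rewrite /= exprS -mulrA; (split; last split) => //; rewrite ?lexx ?lerDl.
  have [H3|H3] := leP M (4 * (4 ^+ n * `|A3|)).
    by exists (x + w', y); rewrite /= exprS -mulrA; (split; last split) => //; rewrite ?lexx ?lerDl.
  have [H4|H4] := leP M (4 * (4 ^+ n * `|A4|)).
    by exists (x + w', y + h'); rewrite /= exprS -mulrA; (split; last split) => //; rewrite ?lexx ?lerDl.
  by exfalso; move: Mle H1 H2 H3 H4; clear; lra.
(* The successor is chosen for every [p], subject to the proviso [ok n p], so that the sequence can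
   be defined by plain recursion. *)
have stepE n p : {q | ok n p -> nxt n p q}.
  have [H|H] := pselect (ok n p); last by exists p.
  by have [q Hq] := cid (step n p H); exists q.
pose u := fix u n := if n is m.+1 then sval (stepE m (u m)) else (a, c).
have uok n : ok n (u n).
  elim: n => [|n IH].
    by rewrite /ok /= w00 h00 !subrKC !lexx expr0 mul1r ME lexx.
  by have [_ _ _ _] := svalP (stepE n (u n)) IH.
have unx n : nxt n (u n) (u n.+1) by exact: (svalP (stepE n (u n)) (uok n)).
have mono (f : R * R -> R) (v : nat -> R) : (forall n, f (u n) <= f (u n.+1)) ->
    (forall n, f (u n.+1) + v n.+1 <= f (u n) + v n) -> (forall n, 0 <= v n) ->
    exists z, forall n, f (u n) <= z <= f (u n) + v n.
  move=> f1 f2 v0; exists (sup (range (f \o u))) => n.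
  have f1' k m : f (u k) <= f (u (k + m)%N).
    by elim: m => [|m IH]; rewrite ?addn0// addnS (le_trans IH).
  have f2' k m : f (u (k + m)%N) + v (k + m)%N <= f (u k) + v k.
    by elim: m => [|m IH]; rewrite ?addn0// addnS (le_trans _ IH).
  have ub k : f (u k) <= f (u n) + v n.
    have [kn|/ltnW nk] := leqP k n.
      by have := f1' k (n - k)%N; rewrite subnKC// => /le_trans; apply; rewrite lerDl.
    by have := f2' n (k - n)%N; rewrite subnKC//; apply: le_trans; rewrite lerDl.
  apply/andP; split; first by apply: ub_le_sup; [by exists (f (u n) + v n) => _ [k _ <-]; exact: ub|by exists n].
  by apply: ge_sup; [by exists (f (u 0)); exists 0%N|by move=> _ [k _ <-]; exact: ub].
have [x xu] : exists x, forall n, (u n).1 <= x <= (u n).1 + w n.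
  by apply: mono => // n; have [] := unx n.
have [y yu] : exists y, forall n, (u n).2 <= y <= (u n).2 + h n.
  by apply: mono => // n; have [] := unx n.
have [|| a1 [k [b2 [dP dQ]]]] := dPQ x y.
  by move: (xu 0%N); rewrite /= w00 subrKC.
  by move: (yu 0%N); rewrite /= h00 subrKC.
pose L := b - a + (d - c); have L0 : 0 <= L by rewrite addr_ge0// subr_ge0.
(* The remainder on the n-th rectangle is at most 2 e L^2 / 4^n, where L / 2^n is the sum of its
   sides. This choice gives 2 e L^2 < M; the added 1 covers L = 0. *)
pose e := M / (4 * (L + 1) ^+ 2).
have e0 : 0 < e by rewrite divr_gt0// mulr_gt0// exprn_gt0// ltr_wpDl.
have [dl dl0 H] := near_prod (filterI (dP e e0) (dQ e e0)).
(* From this [n] on the rectangle lies within distance [dl] of the limit point. *)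
have [n nd] : exists n, L < dl * 2 ^+ n.
  have [n Ln] : exists n : nat, L / dl < n%:R.
    by exists (Num.truncn (L / dl)).+1; rewrite truncnS_gt.
  exists n; rewrite mulrC -ltr_pdivrMr//; apply: lt_trans Ln _.
  by rewrite -natrX ltr_nat ltn_expl.
have wd : w n + h n < dl.
  by rewrite -(ltr_pM2r (_ : 0 < 2 ^+ n))// mulrDl wE hE.
have [au ub cu ud] := uok n; have := xu n; have := yu n; have := w0 n; have := h0 n.
move: (u n) wd au ub cu ud (wE n) (hE n) => [X Y] /=; move: (w n) (h n) => w' h' wd au ub cu ud w'E h'E h'0 w'0 /andP[Yy yY] /andP[Xx xX].
rewrite leNgt => /negP N; exfalso; apply: N.
have Xab : a <= X <= b by rewrite au (le_trans _ ub)// lerDl.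
have Xab' : a <= X + w' <= b by rewrite ub (le_trans au)// lerDl.
have Ycd : c <= Y <= d by rewrite cu (le_trans _ ud)// lerDl.
have Ycd' : c <= Y + h' <= d by rewrite ud (le_trans cu)// lerDl.
have est x' y' : X <= x' <= X + w' -> Y <= y' <= Y + h' ->
    `|P (x', y') - P (x, y) - ((x' - x) * a1 + (y' - y) * k)| <= e * (w' + h') /\
    `|Q (x', y') - Q (x, y) - ((x' - x) * k + (y' - y) * b2)| <= e * (w' + h').
  move=> /andP[Xx' x'X] /andP[Yy' y'Y].
  have x'x : `|x' - x| <= w' by rewrite ler_norml; clear - Xx' x'X Xx xX; apply/andP; split; lra.
  have y'y : `|y' - y| <= h' by rewrite ler_norml; clear - Yy' y'Y Yy yY; apply/andP; split; lra.
  have [] := H (x', y').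
  - by rewrite /=; apply: le_lt_trans x'x _; apply: le_lt_trans wd; rewrite lerDl.
  - by rewrite /=; apply: le_lt_trans y'y _; apply: le_lt_trans wd; rewrite lerDr.
  move=> /= HP HQ; have E : e * (`|x' - x| + `|y' - y|) <= e * (w' + h').
    by apply: ler_wpM2l; [exact: ltW|exact: lerD].
  by split; [exact: le_trans HP E|exact: le_trans HQ E].
have IP : `|\int[mu]_(t in `[X, X + w']) (P (t, Y) - P (t, Y + h')) - (X + w' - X) * (- (h' * k))| <=
    (X + w' - X) * (2 * (e * (w' + h'))).
  apply: Rintegral_near_cst; first by rewrite lerDl.
    by move=> t /andP[t1 t2]; apply: cPx => //; rewrite (le_trans au t1) (le_trans t2 ub).
  move=> t tX; have [||+ _] := est t Y => //; first by rewrite lexx lerDl h'0.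
  have [||+ _] := est t (Y + h') => //; first by rewrite lexx lerDl h'0.
  rewrite !ler_norml; clear; lra.
have IQ : `|\int[mu]_(t in `[Y, Y + h']) (Q (X + w', t) - Q (X, t)) - (Y + h' - Y) * (w' * k)| <=
    (Y + h' - Y) * (2 * (e * (w' + h'))).
  apply: Rintegral_near_cst; first by rewrite lerDl.
    by move=> t /andP[t1 t2]; apply: cQy => //; rewrite (le_trans cu t1) (le_trans t2 ud).
  move=> t tY; have [||_ +] := est X t => //; first by rewrite lexx lerDl w'0.
  have [||_ +] := est (X + w') t => //; first by rewrite lexx lerDl w'0.
  rewrite !ler_norml; clear; lra.
have : `|circ P Q X (X + w') Y (Y + h')| <= 2 * e * (w' + h') ^+ 2.
  rewrite /circ; move: IP IQ; set I1 := Rintegral _ _ _; set I2 := Rintegral _ _ _.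
  have -> : X + w' - X = w' by ring.
  have -> : Y + h' - Y = h' by ring.
  (* The two main terms -w' h' k and h' w' k cancel: here the derivative of P in y has to equal that
     of Q in x. *)
  move=> H1 H2; have -> : I1 + I2 = (I1 - w' * - (h' * k)) + (I2 - h' * (w' * k)) by ring.
  apply: le_trans (ler_normD _ _) _; apply: le_trans (lerD H1 H2) _.
  by rewrite le_eqVlt; apply/orP; left; apply/eqP; clear; ring.
move=> /(ler_wpM2l (exprn_ge0 n (ler0n _ 4))) /le_lt_trans; apply.
have -> : 4 ^+ n * (2 * e * (w' + h') ^+ 2) = 2 * e * L ^+ 2.
  rewrite /L -w'E -h'E -mulrDl exprMn -exprM mulnC exprM (_ : 2 ^+ 2 = 4); last by ring.
  by ring.
have LL : L ^+ 2 <= (L + 1) ^+ 2 by clear - L0; move: L L0 => {}L L0; nra.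
have L10 : 0 < (L + 1) ^+ 2 by clear - L0; rewrite exprn_gt0// ltr_wpDl.
rewrite /e mulrA mulrAC ltr_pdivrMr ?mulr_gt0// ?ltr_wpDl//.
have := ler_wpM2l (ltW M0) LL; have := mulr_gt0 M0 L10.
by clear; move: ((L + 1) ^+ 2) (L ^+ 2) => A B; lra.
Qed.

End Goursat.

(** * Cauchy's formula and the second complex derivative *)

Section Cauchy.
Context {R : realType}.
Local Notation mu := (@lebesgue_measure R).
Local Notation C := (cplx R).
Local Notation Re := complex.Re.
Local Notation Im := complex.Im.

Lemma is_derive_div (f g : C -> C) (z df dg : C) : g z != 0 ->
  is_derive z (1 : C) f df -> is_derive z (1 : C) g dg ->
  is_derive z (1 : C) ((fun z => f z / g z) : C -> C) ((df * g z - f z * dg) / g z ^+ 2).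
Proof.
move=> gz [df1 df2] [dg1 dg2].
have dV : derivable ((fun z => (g z)^-1) : C -> C) z 1 by exact: derivableV.
have dM := @derivableM R[i] C f (fun z => (g z)^-1) z 1 df1 dV.
have := @deriveM R[i] C f (fun z => (g z)^-1) z 1 df1 dV.
rewrite (deriveV gz dg1) df2 dg2 => E.
by apply: (DeriveDef dM); rewrite E /GRing.scale /=; field.
Qed.

Lemma ReZ (x : R) (z : C) : Re (x%:C * z) = x * Re z.
Proof. by case: z => a b /=; rewrite mul0r subr0. Qed.

Lemma ImZ (x : R) (z : C) : Im (x%:C * z) = x * Im z.
Proof. by case: z => a b /=; rewrite mul0r addr0. Qed.

Lemma ReB (z w : C) : Re (z - w) = Re z - Re w. Proof. exact: raddfB. Qed.
Lemma ImB (z w : C) : Im (z - w) = Im z - Im w. Proof. exact: raddfB. Qed.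
Lemma ReD (z w : C) : Re (z + w) = Re z + Re w. Proof. exact: raddfD. Qed.
Lemma ImD (z w : C) : Im (z + w) = Im z + Im w. Proof. exact: raddfD. Qed.

Definition cdiff2 (F : R * R -> C) (p : R * R) (A B : C) : Prop := forall e : R, 0 < e ->
  \forall q \near p, nm (F q - F p - ((q.1 - p.1)%:C * A + (q.2 - p.2)%:C * B) : C)
    <= e * (`|q.1 - p.1| + `|q.2 - p.2|).

Lemma cdiff2_Re F p A B : cdiff2 F p A B -> rdiff2 (fun q => Re (F q)) p (Re A) (Re B).
Proof.
move=> dF e e0; apply: filterS (dF e e0) => q; apply: le_trans.
by apply: le_trans (nm_Re _); rewrite !ReB ReD !ReZ.
Qed.

Lemma cdiff2_Im F p A B : cdiff2 F p A B -> rdiff2 (fun q => Im (F q)) p (Im A) (Im B).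
Proof.
move=> dF e e0; apply: filterS (dF e e0) => q; apply: le_trans.
by apply: le_trans (nm_Im _); rewrite !ImB ImD !ImZ.
Qed.

Lemma cdiff2D F G p A B A' B' : cdiff2 F p A B -> cdiff2 G p A' B' ->
  cdiff2 (fun q => F q + G q) p (A + A') (B + B').
Proof.
move=> dF dG e e0; have e2 : 0 < e / 2 by rewrite divr_gt0.
apply: filterS2 (dF _ e2) (dG _ e2) => q H1 H2; rewrite (splitr e) mulrDl.
apply: le_trans (lerD H1 H2); apply: le_trans (nmD _ _).
by rewrite le_eqVlt; apply/orP; left; apply/eqP; congr nm; ring.
Qed.

Lemma cdiff2_comp (g : C -> C) F p A B d : cdiff2 F p A B -> is_derive (F p) (1 : C) g d ->
  cdiff2 (fun q => g (F q)) p (d * A) (d * B).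
Proof.
move=> dF /is_derive_nm dg e e0.
pose K := nm A + nm B + 1; have K0 : 0 < K by rewrite ltr_wpDl// addr_ge0// nm_ge0.
have e1 : 0 < e / 2 / K by rewrite !divr_gt0.
have d1 : 0 < nm d + 1 by rewrite ltr_wpDl// nm_ge0.
have e2 : 0 < e / 2 / (nm d + 1) by rewrite !divr_gt0.
have /near_nm[t t0 tg] := dg _ e1.
have u0 : 0 < t / K / 2 by rewrite !divr_gt0.
have N1 : \forall q \near p, `|q.1 - p.1| < t / K / 2 /\ `|q.2 - p.2| < t / K / 2.
  by apply: (prod_near u0) => q.
have := dF _ ltr01; have := dF _ e2; move: N1; apply: filterS3 => q [q1 q2] H2 H1.
set D : R := `|q.1 - p.1| + `|q.2 - p.2| in H1 H2 *.
have D0 : 0 <= D by rewrite addr_ge0.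
have DK : D < t / K by rewrite (splitr (t / K)) ltrD.
have FK : nm (F q - F p) <= K * D.
  rewrite -(subrK ((q.1 - p.1)%:C * A + (q.2 - p.2)%:C * B) (F q - F p)).
  apply: le_trans (nmD _ _) _; apply: le_trans (lerD H1 (nmD _ _)) _.
  rewrite !nmM !nm_real /K mulrDl mul1r [leRHS]addrC; apply: lerD => //.
  rewrite mulrDl; apply: lerD; rewrite mulrC ler_wpM2l ?nm_ge0// /D ?lerDl ?lerDr//.
have Ft : nm (F q - F p) < t.
  by apply: le_lt_trans FK _; rewrite mulrC -ltr_pdivlMr.
have H3 := tg _ Ft.
have -> : g (F q) - g (F p) - ((q.1 - p.1)%:C * (d * A) + (q.2 - p.2)%:C * (d * B)) =
  (g (F q) - g (F p) - (F q - F p) * d) + (F q - F p - ((q.1 - p.1)%:C * A + (q.2 - p.2)%:C * B)) * d by ring.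
apply: le_trans (nmD _ _) _; have -> : e * D = e / 2 * D + e / 2 * D by rewrite -mulrDl -splitr.
apply: lerD.
  apply: le_trans H3 _; rewrite -[X in X <= _]mulrA; apply: (@le_trans _ _ (e / 2 * (K^-1 * (K * D)))).
    by apply: ler_wpM2l; [rewrite divr_ge0// ltW|apply: ler_wpM2l => //; rewrite invr_ge0 ltW].
  by rewrite mulKf// gt_eqF.
rewrite nmM; apply: le_trans (ler_wpM2r (nm_ge0 _) H2) _.
rewrite mulrAC; apply: ler_wpM2r => //; rewrite -[X in X <= _]mulrA ler_piMr ?divr_ge0 ?(ltW e0)//.
by rewrite mulrC ler_pdivrMr// mul1r lerDl.
Qed.

(** The identity F G = ((F + G)^2 - (F - G)^2) / 4 reduces the product to sums and to compositions
    with polynomials, both already available. *)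
Lemma cdiff2M F G p A B A' B' : cdiff2 F p A B -> cdiff2 G p A' B' ->
  cdiff2 (fun q => F q * G q) p (A * G p + F p * A') (B * G p + F p * B').
Proof.
move=> dF dG.
have dN (z : C) : is_derive z (1 : C) (fun z => - z) (-1) by exact: is_deriveNid.
have d4 (z : C) : is_derive z (1 : C) (fun z => z * z / 4) (z / 2).
  by apply: is_derive_eq; rewrite /GRing.scale /=; field.
have d4' (z : C) : is_derive z (1 : C) (fun z => - (z * z / 4)) (- (z / 2)).
  by apply: is_derive_eq; rewrite /GRing.scale /=; field.
have H1 := cdiff2_comp (cdiff2D dF dG) (d4 (F p + G p)).
have H2 := cdiff2_comp (cdiff2D dF (cdiff2_comp dG (dN (G p)))) (d4' (F p - G p)).
have := cdiff2D H1 H2.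
rewrite (_ : (fun q => _) = (fun q => F q * G q)); last by apply/funext => q; field.
by congr cdiff2; field.
Qed.

Definition cderiv1 (f : R -> C) (x : R) (d : C) : Prop := forall e : R, 0 < e ->
  \forall y \near x, nm (f y - f x - (y - x)%:C * d : C) <= e * `|y - x|.

Lemma cderiv1_complex (u v : R -> R) (x du dv : R) :
  is_derive x (1 : R) u du -> is_derive x (1 : R) v dv ->
  cderiv1 (fun t => u t +i* v t) x (du +i* dv).
Proof.
move=> /is_derive_ler hu /is_derive_ler hv e e0; have e2 : 0 < e / 2 by rewrite divr_gt0.
apply: filterS2 (hu _ e2) (hv _ e2) => y H1 H2; apply: le_trans (nm_le_ReIm _) _.
rewrite (_ : e * `|y - x| = e / 2 * `|y - x| + e / 2 * `|y - x|); last by rewrite -mulrDl -splitr.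
by apply: lerD; [rewrite ReB ReB ReZ|rewrite ImB ImB ImZ].
Qed.

Lemma cdiff2_fst f p d : cderiv1 f p.1 d -> cdiff2 (fun q => f q.1) p d 0.
Proof.
move=> df e e0; have c : {for p, continuous (fst : R * R -> R)} by exact: cvg_fst.
apply: filterS (near_continuous c (df e e0)) => q H.
by rewrite mulr0 addr0; apply: le_trans H _; apply: ler_wpM2l; rewrite ?lerDl// ltW.
Qed.

Lemma cdiff2_snd f p d : cderiv1 f p.2 d -> cdiff2 (fun q => f q.2) p 0 d.
Proof.
move=> df e e0; have c : {for p, continuous (snd : R * R -> R)} by exact: cvg_snd.
apply: filterS (near_continuous c (df e e0)) => q H.
by rewrite mulr0 add0r; apply: le_trans H _; apply: ler_wpM2l; rewrite ?lerDr// ltW.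
Qed.

Definition expi (t : R) : C := cos t +i* sin t.

Lemma nm_expi t : nm (expi t) = 1.
Proof.
apply/eqP; rewrite -(@pexpr_eq1 _ _ 2) ?nm_ge0//.
by rewrite nm_sqr /= cos2Dsin2.
Qed.

Lemma expi_neq0 t : expi t != 0.
Proof. by rewrite -nm_eq0 nm_expi oner_eq0. Qed.

Lemma continuous_expi : continuous expi.
Proof. by move=> t; apply: continuous_complex; [exact: continuous_cos|exact: continuous_sin]. Qed.

Lemma continuous_expn (f : R -> C) m : continuous f -> continuous (fun t => f t ^+ m).
Proof.
move=> cf t; elim: m => [|m IH]; first exact: cvg_cst.
under eq_fun do rewrite exprS.
by apply: cvgM; [exact: cf|exact: IH].
Qed.

Lemma cderiv1_expi t : cderiv1 expi t ('i * expi t).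
Proof.
rewrite (_ : 'i * expi t = (- sin t) +i* cos t).
  by apply: cderiv1_complex.
by rewrite /expi; simpc.
Qed.

Lemma expi_2pi : expi (pi *+ 2) = expi 0.
Proof. by rewrite /expi cos2pi sin2pi cos0 sin0. Qed.

Definition cint (f : R -> C) : C :=
  (\int[mu]_(t in `[0, pi *+ 2]) Re (f t)) +i* (\int[mu]_(t in `[0, pi *+ 2]) Im (f t)).

Lemma continuous_ReC (f : R -> C) : continuous f -> continuous (fun t => Re (f t)).
Proof. by move=> cf t; apply: continuous_comp; [exact: cf|exact: continuous_Re]. Qed.

Lemma continuous_ImC (f : R -> C) : continuous f -> continuous (fun t => Im (f t)).
Proof. by move=> cf t; apply: continuous_comp; [exact: cf|exact: continuous_Im]. Qed.

Lemma complex_inj (z w : C) : Re z = Re w -> Im z = Im w -> z = w.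
Proof. by case: z w => [a b] [c d] /= -> ->. Qed.

Lemma cintB f g : continuous f -> continuous g ->
  cint (fun t => f t - g t) = cint f - cint g.
Proof.
move=> cf cg.
have cfR := continuous_ReC cf; have cfI := continuous_ImC cf.
have cgR := continuous_ReC cg; have cgI := continuous_ImC cg.
have int (h : R -> R) : continuous h -> mu.-integrable `[0, pi *+ 2] (EFin \o h).
  by move=> ch; apply: continuous_itv_integrable => x _; exact: ch.
apply: complex_inj; rewrite ?ReB ?ImB /cint /= -RintegralB ?int//.
  by apply: eq_Rintegral => t _; rewrite ReB.
by apply: eq_Rintegral => t _; rewrite ImB.
Qed.

Lemma cintZ (c : C) f : continuous f -> cint (fun t => c * f t) = c * cint f.
Proof.
move=> cf.
have cR := continuous_ReC cf; have cI := continuous_ImC cf.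
have int (h : R -> R) : continuous h -> mu.-integrable `[0, pi *+ 2] (EFin \o h).
  by move=> ch; apply: continuous_itv_integrable => x _; exact: ch.
have cZ (a : R) (h : R -> R) : continuous h -> continuous (fun t => a * h t).
  by move=> ch x; apply: continuousM; [exact: cvg_cst|exact: ch].
have RM (z w : C) : Re (z * w) = Re z * Re w - Im z * Im w by case: z w => [? ?] [? ?].
have IM (z w : C) : Im (z * w) = Re z * Im w + Im z * Re w by case: z w => [? ?] [? ?].
apply: complex_inj; rewrite ?RM ?IM /cint /=.
  rewrite -RintegralZl ?int// -RintegralZl ?int// -RintegralB ?int//; try exact: cZ.
  by apply: eq_Rintegral => t _; rewrite RM.
rewrite -RintegralZl ?int// -RintegralZl ?int// -RintegralD ?int//; try exact: cZ.
by apply: eq_Rintegral => t _; rewrite IM.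
Qed.

(** The constant is 4 pi instead of 2 pi because real and imaginary parts are estimated
    separately. *)
Lemma nm_cint_le f (M : R) : continuous f -> (forall t, 0 <= t <= pi *+ 2 -> nm (f t) <= M) ->
  nm (cint f) <= 4 * pi * M.
Proof.
move=> cf fM; apply: le_trans (nm_le_ReIm _) _; rewrite /cint /=.
have pi20 : 0 <= pi *+ 2 :> R by rewrite mulrn_wge0// pi_ge0.
have H (h : R -> R) : continuous h -> (forall t, 0 <= t <= pi *+ 2 -> `|h t| <= M) ->
    `|\int[mu]_(t in `[0, pi *+ 2]) h t| <= pi *+ 2 * M.
  move=> ch hM; have := @Rintegral_near_cst _ h 0 (pi *+ 2) 0 M pi20.
  by rewrite mulr0 !subr0; apply => [x _|x xp]; [exact: ch|rewrite subr0; exact: hM].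
have -> : 4 * pi * M = pi *+ 2 * M + pi *+ 2 * M by rewrite -mulrDl -mulrnDr mulr_natl.
apply: lerD; apply: H.
- exact: continuous_ReC.
- by move=> t /fM; apply: le_trans (nm_Re _).
- exact: continuous_ImC.
- by move=> t /fM; apply: le_trans (nm_Im _).
Qed.

Lemma bounded_circle (f : R -> C) : continuous f ->
  exists2 M : R, 0 < M & forall t, 0 <= t <= pi *+ 2 -> nm (f t) <= M.
Proof.
move=> cf; have cn : {within `[0, pi *+ 2]%classic, continuous (fun t => nm (f t))}.
  by apply: continuous_itv_within => t _; apply: continuous_comp; [exact: cf|exact: continuous_nm].
have [M [_ Mb]] := compact_bounded (continuous_compact cn (@segment_compact _ _ _)).
exists (`|M| + 1); first by rewrite ltr_wpDl.
move=> t t2; have /(Mb _) : M < `|M| + 1 by rewrite (le_lt_trans (ler_norm M))// ltrDl.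
move=> /(_ (nm (f t))) /=; rewrite ger0_norm ?nm_ge0//; apply.
by exists t => //=; rewrite in_itv.
Qed.

(** A quadratic remainder, uniform in t, takes the place of dominated convergence in this
    differentiation under the integral sign. *)
Lemma cint_is_derive (K K1 : C -> R -> C) (w : C) (d M : R) : 0 < d -> 0 < M ->
  (forall y, nm (y - w) < d -> continuous (K y)) -> continuous (K1 w) ->
  (forall y t, nm (y - w) < d -> 0 <= t <= pi *+ 2 ->
     nm (K y t - K w t - (y - w) * K1 w t) <= M * nm (y - w) ^+ 2) ->
  is_derive w (1 : C) (fun y => cint (K y)) (cint (K1 w)).
Proof.
move=> d0 M0 cK cK1 HK; apply/is_derive_nm => e e0; apply/near_nm.
have pM : 0 < 4 * pi * M by rewrite mulr_gt0// mulr_gt0// pi_gt0.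
exists (Num.min d (e / (4 * pi * M))); first by rewrite lt_min d0 divr_gt0.
move=> y; rewrite lt_min => /andP[yd ye].
have cKw : continuous (K w) by apply: cK; rewrite subrr nm0.
have cy := cK _ yd.
have c1 : continuous (fun t => K y t - K w t) by move=> t; apply: cvgB; [exact: cy|exact: cKw].
have c2 : continuous (fun t => (y - w) * K1 w t).
  by move=> t; apply: cvgM; [exact: cvg_cst|exact: cK1].
have E := cintB c1 c2; rewrite (cintB cy cKw) (cintZ _ cK1) in E.
apply: (@le_trans _ _ (4 * pi * (M * nm (y - w) ^+ 2))).
  rewrite -[X in nm X]/(cint (K y) - cint (K w) - (y - w) * cint (K1 w)) -E.
  apply: nm_cint_le => [t|t t2]; last exact: HK.
  by apply: cvgB; [exact: c1|exact: c2].
rewrite mulrA expr2 mulrA; apply: ler_wpM2r; first exact: nm_ge0.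
by rewrite mulrC -ler_pdivlMr// ltW.
Qed.

Section formula.
Variables (g g' : C -> C) (a : C) (rho r : R).
Hypothesis dg : forall z, nm (z - a) < rho -> is_derive z (1 : C) g (g' z).
Hypotheses (r0 : 0 < r) (rrho : r < rho).

Definition circ_pt (t : R) : C := a + r%:C * expi t.

(* [dz / (i (z - w)) = kern w t dt] along the circle. *)
Definition kern (w : C) (t : R) : C := r%:C * expi t / (circ_pt t - w).

Lemma nm_rexpi t : nm (r%:C * expi t : C) = r.
Proof. by rewrite nmM nm_real nm_expi mulr1 gtr0_norm. Qed.

Lemma circ_pt_sub w t : r - nm (w - a) <= nm (circ_pt t - w).
Proof.
rewrite -{1}(nm_rexpi t); apply: le_trans (nm_sub_le _ _) _.
by rewrite le_eqVlt; apply/orP; left; apply/eqP; congr nm; rewrite /circ_pt; ring.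
Qed.

Lemma circ_pt_neq w t : nm (w - a) < r -> circ_pt t - w != 0.
Proof. by move=> wr; rewrite -nm_gt0; apply: lt_le_trans (circ_pt_sub w t); rewrite subr_gt0. Qed.

Lemma continuous_circ_pt : continuous circ_pt.
Proof.
move=> t; apply: cvgD; first exact: cvg_cst.
by apply: cvgM; [exact: cvg_cst|exact: continuous_expi].
Qed.

Lemma continuous_kern w : nm (w - a) < r -> continuous (kern w).
Proof.
move=> wr t; apply: cvgM.
  by apply: cvgM; [exact: cvg_cst|exact: continuous_expi].
apply: cvgV; first exact: circ_pt_neq.
by apply: cvgB; [exact: continuous_circ_pt|exact: cvg_cst].
Qed.

(** The circle contracted towards [w] by the factor e^s. In the coordinates (s, t) the form g(z) dz
    / (i (z - w)) reads -i g ds + g [kern] dt, which are the [P] and [Q] of the next lemma. *)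
Let ray w (s t : R) : C := w + (expR s)%:C * (circ_pt t - w).

Let ray_in w s t : nm (w - a) < r -> s <= 0 -> nm (ray w s t - a) < rho.
Proof.
move=> wr s0; have e1 : expR s <= 1 by rewrite -expR0 ler_expR.
have -> : ray w s t - a = (1 - expR s)%:C * (w - a) + (expR s)%:C * (r%:C * expi t).
  by rewrite /ray /circ_pt rmorphB /=; ring.
apply: le_lt_trans (nmD _ _) _; rewrite (nmM _ (w - a)) (nmM _ (r%:C * expi t)) nm_rexpi !nm_real.
rewrite ger0_norm ?subr_ge0// ger0_norm ?expR_ge0//.
have := ler_wpM2l (_ : 0 <= 1 - expR s) (ltW wr); rewrite subr_ge0 => /(_ e1).
by move: rrho; rewrite mulrBl mul1r; lra.
Qed.

Let continuous_ray w s : continuous (ray w s).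
Proof.
move=> t; apply: cvgD; first exact: cvg_cst.
by apply: cvgM; [exact: cvg_cst|apply: cvgB; [exact: continuous_circ_pt|exact: cvg_cst]].
Qed.

Let continuous_g_ray w s : nm (w - a) < r -> s <= 0 -> continuous (fun t => g (ray w s t)).
Proof.
move=> wr s0 t; apply: (@continuous_comp _ _ _ (ray w s) g); first exact: continuous_ray.
by apply: is_derive_continuous (dg (ray_in t wr s0)).
Qed.

(** Goursat's theorem on the rectangle [-N, 0] x [0, 2 pi] in the coordinates of [ray]: the sides t
    = 0 and t = 2 pi cancel by periodicity, and the sides s = 0 and s = -N carry the two
    integrals. *)
Lemma cauchy_ray w N : nm (w - a) < r -> 0 <= N ->
  cint (fun t => g (circ_pt t) * kern w t) =
  cint (fun t => g (ray w (- N) t) * kern w t).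
Proof.
move=> wr N0.
pose G (q : R * R) : C := g (ray w q.1 q.2).
pose P (q : R * R) : C := - 'i * G q; pose Q (q : R * R) : C := G q * kern w q.2.
have dPQ s t : - N <= s <= 0 -> exists A K B, cdiff2 P (s, t) A K /\ cdiff2 Q (s, t) K B.
  move=> /andP[_ s0].
  have dS : cdiff2 (fun q => (expR q.1)%:C) (s, t) (expR s)%:C 0.
    by apply: (@cdiff2_fst (fun x => (expR x)%:C)); apply: cderiv1_complex.
  have dE : cdiff2 (fun q => expi q.2) (s, t) 0 ('i * expi t).
    by apply: cdiff2_snd; exact: cderiv1_expi.
  have dz (z : C) : is_derive z (1 : C) (fun z => a + r%:C * z - w) r%:C.
    by apply: is_derive_eq; rewrite /GRing.scale /=; ring.
  have dk (z : C) : a + r%:C * z - w != 0 ->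
      exists d, is_derive z (1 : C) ((fun z => r%:C * z / (a + r%:C * z - w)) : C -> C) d.
    move=> z0; have dn : is_derive z (1 : C) ((fun z => r%:C * z) : C -> C) r%:C.
      by apply: is_derive_eq; rewrite /GRing.scale /=; ring.
    by eexists; exact: (@is_derive_div (fun z => r%:C * z) (fun z => a + r%:C * z - w) z _ _ z0 dn (dz z)).
  have dw (z : C) : is_derive z (1 : C) (fun z => w + z) 1.
    by apply: is_derive_eq; rewrite add0r.
  have dmi (z : C) : is_derive z (1 : C) (fun z => - 'i * z) (- 'i).
    by apply: is_derive_eq; rewrite /GRing.scale /=; ring.
  have dG := cdiff2_comp (cdiff2_comp (cdiff2M dS (cdiff2_comp dE (dz _))) (dw _)) (dg (ray_in t wr s0)).
  have dP := cdiff2_comp dG (dmi _).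
  have [dkv dkE] := dk (expi t) (circ_pt_neq t wr).
  have dQ := cdiff2M dG (cdiff2_comp dE dkE).
  have fin A K1 K2 B : cdiff2 P (s, t) A K1 -> cdiff2 Q (s, t) K2 B -> K2 = K1 ->
      exists A K B, cdiff2 P (s, t) A K /\ cdiff2 Q (s, t) K B.
    by move=> HP HQ E; exists A, K1, B; rewrite -{2}E.
  apply: fin dP dQ _; have := circ_pt_neq t wr; rewrite /circ_pt /=.
  move: (g' _) (expi t) (expR s)%:C => d E S nz.
  have i2 : 'i * 'i = -1 :> C by rewrite -expr2 sqr_i.
  transitivity (d * S * (r%:C * E)); first by field.
  transitivity (- ('i * 'i) * (d * S * (r%:C * E))); first by rewrite i2; ring.
  by ring.
have N00 : - N <= 0 by rewrite oppr_le0.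
have pi20 : 0 <= pi *+ 2 :> R by rewrite mulrn_wge0// pi_ge0.
have per s : P (s, 0) = P (s, pi *+ 2) by rewrite /P /G /ray /circ_pt expi_2pi.
have zero (f : R -> R) : (forall x, f x = 0) -> \int[mu]_(x in `[- N, 0]) f x = 0.
  by move=> f0; under eq_Rintegral do rewrite f0; rewrite Rintegral_cst// mul0r.
have contQ s : - N <= s <= 0 -> continuous (fun t => Q (s, t)).
  move=> sN t; apply: cvgM; last exact: continuous_kern.
  by apply: continuous_g_ray => //; case/andP: sN.
have c0 : continuous (fun t => Q (0, t)) by apply: contQ; rewrite lexx N00.
have cN : continuous (fun t => Q (- N, t)) by apply: contQ; rewrite lexx N00.
have Q0 t : Q (0, t) = g (circ_pt t) * kern w t.
  by rewrite /Q /G /ray /= expR0 mul1r addrC subrK.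
have gRe : circ (fun q => Re (P q)) (fun q => Re (Q q)) (- N) 0 0 (pi *+ 2) = 0.
  apply: goursat => // s t sN _; have [A [K [B [HP HQ]]]] := dPQ s t sN.
  by exists (Re A), (Re K), (Re B); split; exact: cdiff2_Re.
have gIm : circ (fun q => Im (P q)) (fun q => Im (Q q)) (- N) 0 0 (pi *+ 2) = 0.
  apply: goursat => // s t sN _; have [A [K [B [HP HQ]]]] := dPQ s t sN.
  by exists (Im A), (Im K), (Im B); split; exact: cdiff2_Im.
transitivity (cint (fun t => Q (0, t))); first by congr cint; apply/funext => t; rewrite Q0.
apply/eqP; rewrite -subr_eq0; apply/eqP; rewrite -[X in _ - X]/(cint (fun t => Q (- N, t))).
move: gRe gIm; rewrite /circ !zero; try (by move=> s; rewrite per subrr).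
rewrite !add0r => E1 E2; rewrite -(cintB c0 cN); apply: complex_inj; rewrite /cint /=.
  by rewrite -[RHS]E1; apply: eq_Rintegral => t _; rewrite ReB.
by rewrite -[RHS]E2; apply: eq_Rintegral => t _; rewrite ImB.
Qed.

(** For large N the contracted circle is close to [w], where g is close to g(w) by continuity. The
    factor [cint (kern w)], which is 2 pi, is left unevaluated: it will only be divided by, near the
    centre. *)
Lemma cauchy_formula w : nm (w - a) < r ->
  cint (fun t => g (circ_pt t) * kern w t) = g w * cint (kern w).
Proof.
move=> wr; have ck := continuous_kern wr.
have wrho : nm (w - a) < rho by apply: lt_trans rrho.
have d0 : 0 < r - nm (w - a) by rewrite subr_gt0.
pose M : R := r / (r - nm (w - a)).
have M0 : 0 < M by rewrite divr_gt0.
have kM t : nm (kern w t) <= M.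
  rewrite /kern nmM nm_rexpi nmV /M ler_pM2l// lef_pV2 ?posrE//; first exact: circ_pt_sub.
  by apply: lt_le_trans (circ_pt_sub w t).
apply/eqP; rewrite -subr_eq0 -nm_eq0; apply/eqP/le_anti; rewrite nm_ge0 andbT.
apply/ler_addgt0Pl => e e0; rewrite addr0.
have cg : {for w, continuous g} := is_derive_continuous (dg wrho).
clearbody M; have pM : 0 < 4 * pi * M by rewrite mulr_gt0// mulr_gt0// pi_gt0.
have e1 : 0 < e / (4 * pi * M) by rewrite divr_gt0.
have [d dd0 gd] := (near_nm w _).1 ((cvg_nm _ _ _).1 cg _ e1).
have [N N0 Nd] : exists2 N : R, 0 <= N & forall t, nm (ray w (- N) t - w) < d.
  (* With this N the contraction factor e^-N is at most d / (2 r), while every point of the circle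
     is at distance less than 2 r from [w]. *)
  exists (`|ln (d / (2 * r))|) => // t.
  have -> : ray w (- `|ln (d / (2 * r))|) t - w = (expR (- `|ln (d / (2 * r))|))%:C * (circ_pt t - w).
    by rewrite /ray; ring.
  rewrite nmM nm_real ger0_norm ?expR_ge0//.
  have H1 : nm (circ_pt t - w) < 2 * r.
    have -> : circ_pt t - w = r%:C * expi t - (w - a) by rewrite /circ_pt; ring.
    by apply: le_lt_trans (nmBD _ _) _; rewrite nm_rexpi mulr2n mulrDl mul1r ltrD2l.
  have r2 : 0 < 2 * r by rewrite mulr_gt0.
  have H2 : expR (- `|ln (d / (2 * r))|) <= d / (2 * r).
    rewrite -[leRHS]lnK ?posrE ?divr_gt0// ler_expR lerNl.
    by rewrite -normrN ler_norm.
  apply: le_lt_trans (ler_wpM2r (nm_ge0 _) H2) _.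
  by rewrite mulrAC ltr_pdivrMr// ltr_pM2l.
rewrite (cauchy_ray wr N0) -cintZ// -cintB; first last.
- by move=> t; apply: cvgM; [exact: cvg_cst|exact: ck].
- move=> t; apply: cvgM; last exact: ck.
  by apply: continuous_g_ray => //; rewrite oppr_le0.
have -> : e = 4 * pi * (e / (4 * pi * M) * M).
  by rewrite mulrA mulrAC mulrC divfK// gt_eqF.
apply: nm_cint_le => [t|t _].
  apply: cvgB; apply: cvgM; try exact: ck; try exact: cvg_cst.
  by apply: continuous_g_ray; rewrite ?oppr_le0.
rewrite -mulrBl nmM; apply: ler_pM; rewrite ?nm_ge0 ?kM//.
by apply: ltW; apply: gd; exact: Nd.
Qed.

Section transform.
Variable phi : R -> C.
Hypothesis cphi : continuous phi.

(** Cauchy transforms of the density [phi] on the circle; differentiation in [w] raises the exponent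
    [m]. *)
Definition ctrans (m : nat) (w : C) : C := cint (fun t => phi t / (circ_pt t - w) ^+ m).

Let cont_ker m w : nm (w - a) < r -> continuous (fun t => phi t / (circ_pt t - w) ^+ m).
Proof.
move=> wr t; apply: cvgM; first exact: cphi.
apply: cvgV; first by rewrite expf_neq0// circ_pt_neq.
apply: (@continuous_expn (fun t => circ_pt t - w)) => {}t.
by apply: cvgB; [exact: continuous_circ_pt|exact: cvg_cst].
Qed.

Let bound w : nm (w - a) < r -> exists2 U : R, 0 < U &
  exists2 d : R, 0 < d & forall y, nm (y - w) < d -> nm (y - a) < r /\
    forall t, nm ((circ_pt t - y)^-1) <= U.
Proof.
move=> wr; have d0 : 0 < (r - nm (w - a)) / 2 by rewrite divr_gt0// subr_gt0.
exists ((r - nm (w - a)) / 2)^-1; first by rewrite invr_gt0.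
exists ((r - nm (w - a)) / 2) => // y yw.
have ya : nm (y - a) <= r - (r - nm (w - a)) / 2.
  by apply: le_trans (nm_triangle _ w _) _; move: yw; lra.
have yr : nm (y - a) < r by apply: le_lt_trans ya _; rewrite ltrBlDr ltrDl.
split=> // t; rewrite nmV lef_pV2 ?posrE//.
  by apply: le_trans (circ_pt_sub y t); move: ya; lra.
by apply: lt_le_trans (circ_pt_sub y t); rewrite subr_gt0.
Qed.

Lemma is_derive_ctrans1 w : nm (w - a) < r ->
  is_derive w (1 : C) (ctrans 1) (ctrans 2 w).
Proof.
move=> wr; have [B B0 phiB] := bounded_circle cphi; have [U U0 [d d0 HU]] := bound wr.
apply: (@cint_is_derive (fun w t => phi t / (circ_pt t - w) ^+ 1)
  (fun w t => phi t / (circ_pt t - w) ^+ 2) w d (B * U ^+ 3) d0 (mulr_gt0 B0 (exprn_gt0 3 U0))).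
- by move=> y /HU[yr _]; exact: cont_ker.
- exact: cont_ker.
move=> y t yd t2; have [yr yU] := HU _ yd.
have ww : nm (w - w) < d by rewrite subrr nm0.
have [_ wU] := HU _ ww.
have -> : phi t / (circ_pt t - y) ^+ 1 - phi t / (circ_pt t - w) ^+ 1 -
    (y - w) * (phi t / (circ_pt t - w) ^+ 2) =
    phi t * ((circ_pt t - w)^-1 ^+ 2 * (circ_pt t - y)^-1) * (y - w) ^+ 2.
  by have := circ_pt_neq t yr; have := circ_pt_neq t wr => nw ny; field; rewrite nw ny.
rewrite (nmM _ ((y - w) ^+ 2)) (nmX (y - w)); apply: ler_wpM2r; first by rewrite exprn_ge0// nm_ge0.
rewrite nmM; apply: ler_pM; rewrite ?nm_ge0 ?phiB// (nmM (_ ^+ 2)) nmX (exprSr U 2).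
apply: ler_pM; rewrite ?exprn_ge0 ?nm_ge0//.
by rewrite ler_pXn2r// nnegrE ?nm_ge0// ltW.
Qed.

Lemma is_derive_ctrans2 w : nm (w - a) < r ->
  is_derive w (1 : C) (ctrans 2) (2 * ctrans 3 w).
Proof.
move=> wr; have [B B0 phiB] := bounded_circle cphi; have [U U0 [d d0 HU]] := bound wr.
rewrite -cintZ; last exact: cont_ker.
apply: (@cint_is_derive (fun w t => phi t / (circ_pt t - w) ^+ 2)
  (fun w t => 2 * (phi t / (circ_pt t - w) ^+ 3)) w d (B * (3 * U ^+ 4)) d0 (mulr_gt0 B0 (mulr_gt0 (ltr0Sn R 2) (exprn_gt0 4 U0)))).
- by move=> y /HU[yr _]; exact: cont_ker.
- by move=> t; apply: cvgM; [exact: cvg_cst|exact: cont_ker].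
move=> y t yd t2; have [yr yU] := HU _ yd.
have ww : nm (w - w) < d by rewrite subrr nm0.
have [_ wU] := HU _ ww.
have -> : phi t / (circ_pt t - y) ^+ 2 - phi t / (circ_pt t - w) ^+ 2 -
    (y - w) * (2 * (phi t / (circ_pt t - w) ^+ 3)) =
    phi t * ((circ_pt t - w)^-1 ^+ 2 * (circ_pt t - y)^-1 *
      ((circ_pt t - y)^-1 + 2 * (circ_pt t - w)^-1)) * (y - w) ^+ 2.
  by have := circ_pt_neq t yr; have := circ_pt_neq t wr => nw ny; field; rewrite nw ny.
rewrite (nmM _ ((y - w) ^+ 2)) (nmX (y - w)); apply: ler_wpM2r; first by rewrite exprn_ge0// nm_ge0.
rewrite nmM; apply: ler_pM; rewrite ?nm_ge0 ?phiB// nmM.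
have -> : 3 * U ^+ 4 = U ^+ 2 * U * (3 * U) by ring.
apply: ler_pM; rewrite ?nm_ge0//.
  rewrite (nmM (_ ^+ 2)) nmX; apply: ler_pM; rewrite ?exprn_ge0 ?nm_ge0//.
  by rewrite ler_pXn2r// nnegrE ?nm_ge0// ltW.
apply: le_trans (nmD _ _) _; rewrite nmM.
have -> : nm (2 : C) = 2 by have := nm_real (2 : R); rewrite rmorph_nat normr_nat.
by have := yU t; have := wU t; lra.
Qed.

End transform.

Lemma cint_kern_center : cint (kern a) != 0.
Proof.
have -> : kern a = fun=> 1.
  apply/funext => t; rewrite /kern /circ_pt addrAC subrr add0r divff// mulf_neq0 ?expi_neq0//.
  by rewrite fmorph_eq0 gt_eqF.
rewrite eq_complex /= negb_and; apply/orP; left.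
rewrite Rintegral_cst//= lebesgue_measure_itv/= lte_fin mulrn_wgt0 ?pi_gt0//=.
by rewrite oppr0 addr0 mul1r gt_eqF// mulrn_wgt0 ?pi_gt0.
Qed.

(** By [cauchy_formula], g is near the centre the quotient of the Cauchy transforms of the densities
    [psi] and [phi], that is of g dz and dz up to the factor i. Both transforms can be
    differentiated twice, and the denominator does not vanish at the centre. *)
Lemma holo_derivable2_at : derivable ('D_(1 : C) g : C -> C) a 1.
Proof.
pose phi t : C := r%:C * expi t; pose psi t : C := g (circ_pt t) * phi t.
have cphi : continuous phi by move=> t; apply: cvgM; [exact: cvg_cst|exact: continuous_expi].
have cpsi : continuous psi.
  move=> t; apply: cvgM; last exact: cphi.
  apply: (@continuous_comp _ _ _ circ_pt g); first exact: continuous_circ_pt.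
  apply: is_derive_continuous; apply: dg.
  by rewrite /circ_pt addrAC subrr add0r nm_rexpi.
have cE w : ctrans phi 1 w = cint (kern w) by [].
have pE w : ctrans psi 1 w = cint (fun t => g (circ_pt t) * kern w t).
  by congr cint; apply/funext => t; rewrite /kern mulrA.
have ar : nm (a - a) < r by rewrite subrr nm0.
have nz : \forall w \near a, nm (w - a) < r /\ ctrans phi 1 w != 0.
  have c1 : {for a, continuous (ctrans phi 1)} := is_derive_continuous (is_derive_ctrans1 cphi ar).
  have n1 : \forall w \near a, nm (w - a) < r by apply/near_nm; exists r.
  have c2 : {for a, continuous (fun w => nm (ctrans phi 1 w))}.
    by apply: continuous_comp; [exact: c1|exact: continuous_nm].
  have : 0 < nm (ctrans phi 1 a) by rewrite nm_gt0 cE cint_kern_center.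
  move=> /(cvgr_gt _ c2); move: n1; apply: filterS2 => w wr; by rewrite nm_gt0.
have near_in (P : set C) : (\forall w \near a, P w) -> \forall w \near a, \forall y \near w, P y.
  by move=> /nbhs_interior.
pose D w := (ctrans psi 2 w * ctrans phi 1 w - ctrans psi 1 w * ctrans phi 2 w) / ctrans phi 1 w ^+ 2.
have gE : \forall w \near a, g w = ctrans psi 1 w / ctrans phi 1 w.
  by apply: filterS nz => w [wr w0]; rewrite pE cauchy_formula// cE mulfK.
have DE : \forall w \near a, D w = 'D_(1 : C) g w.
  have := near_in _ gE; apply: filterS2 nz => w [wr w0] gw.
  have dq : is_derive w (1 : C) ((fun w => ctrans psi 1 w / ctrans phi 1 w) : C -> C) (D w).
    exact: (is_derive_div w0 (is_derive_ctrans1 cpsi wr) (is_derive_ctrans1 cphi wr)).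
  rewrite -(@derive_val _ _ _ _ _ _ _ dq); apply: near_eq_derive => //.
  by apply: filterS gw.
have [_ w0] := nbhs_singleton nz.
apply: near_eq_derivable DE _.
have dn : is_derive a (1 : C) ((fun w => ctrans psi 2 w * ctrans phi 1 w - ctrans psi 1 w * ctrans phi 2 w) : C -> C)
    (2 * ctrans psi 3 a * ctrans phi 1 a - ctrans psi 1 a * (2 * ctrans phi 3 a)).
  have d1 := is_derive_ctrans1 cpsi ar; have d2 := is_derive_ctrans2 cpsi ar.
  have e1 := is_derive_ctrans1 cphi ar; have e2 := is_derive_ctrans2 cphi ar.
  have dd := is_deriveB (is_deriveM d2 e1) (is_deriveM d1 e2).
  by apply: (is_derive_eq dd); rewrite /GRing.scale /=; ring.
have de : is_derive a (1 : C) ((fun w => ctrans phi 1 w ^+ 2) : C -> C) _ :=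
  is_deriveM (is_derive_ctrans1 cphi ar) (is_derive_ctrans1 cphi ar).
have w02 : ctrans phi 1 a ^+ 2 != 0 by rewrite expf_neq0.
by case: (@is_derive_div _ (fun w => ctrans phi 1 w ^+ 2) a _ _ w02 dn de).
Qed.

End formula.

Theorem holo_derivable2 (g : C -> C) (U : set C) : open U ->
  (forall z, U z -> derivable g z 1) -> forall z, U z -> derivable ('D_(1 : C) g : C -> C) z 1.
Proof.
move=> oU dg z Uz.
have [rho rho0 Urho] := (near_nm z U).1 (open_nbhs_nbhs (conj oU Uz)).
apply: (@holo_derivable2_at g ('D_(1 : C) g) z rho (rho / 2)).
- by move=> y /Urho /dg /derivableP.
- by rewrite divr_gt0.
- by rewrite ltr_pdivrMr// mulr2n mulrDr mulr1 ltrDl.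
Qed.

End Cauchy.

(** * Hilbert spaces and the fibres of E *)

Section Hilbert.
Context {R : realType} {H : completeNormedModType R[i]}.
Local Notation C := (cplx R).
Local Notation Re := complex.Re.
Local Notation Im := complex.Im.
Variable ip : {dot H for (@conjc R)}.
Hypothesis ip_norm : forall x : H, ip x x = `|x| ^+ 2.

Lemma ipDl x y z : ip (x + y) z = ip x z + ip y z.
Proof. exact: linearDl. Qed.

Lemma ipZl (a : C) x z : ip (a *: x) z = a * ip x z.
Proof. exact: linearZl_LR. Qed.

Lemma ipDr x y z : ip z (x + y) = ip z x + ip z y.
Proof. exact: linearDr. Qed.

Lemma ipC x y : ip x y = (ip y x)^*.
Proof. by rewrite hermC expr0 mul1r. Qed.

Lemma ipZr (a : C) x z : ip z (a *: x) = conjc a * ip z x.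
Proof. by rewrite ipC ipZl rmorphM /= -ipC. Qed.

Lemma ip0l z : ip 0 z = 0. Proof. exact: linear0l. Qed.
Lemma ip0r z : ip z 0 = 0. Proof. by rewrite ipC ip0l rmorph0. Qed.
Lemma ipNl x z : ip (- x) z = - ip x z. Proof. exact: linearNl. Qed.
Lemma ipNr x z : ip z (- x) = - ip z x. Proof. by rewrite ipC ipNl rmorphN /= -ipC. Qed.
Lemma ipBl x y z : ip (x - y) z = ip x z - ip y z. Proof. by rewrite ipDl ipNl. Qed.
Lemma ipBr x y z : ip z (x - y) = ip z x - ip z y. Proof. by rewrite ipDr ipNr. Qed.

Lemma ip_nm x : ip x x = (nm x ^+ 2)%:C.
Proof. by rewrite ip_norm nmE rmorphXn. Qed.

Lemma ip_Re x : Re (ip x x) = nm x ^+ 2. Proof. by rewrite ip_nm. Qed.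

Lemma nmD_sqr x y : nm (x + y) ^+ 2 = nm x ^+ 2 + nm y ^+ 2 + 2 * Re (ip x y).
Proof.
rewrite -!ip_Re ipDl !ipDr !ReD (ipC y x).
by case: (ip x y) => a b /=; ring.
Qed.

Lemma nmB_sqr x y : nm (x - y) ^+ 2 = nm x ^+ 2 + nm y ^+ 2 - 2 * Re (ip x y).
Proof. by rewrite nmD_sqr nmN ipNr raddfN /= mulrN. Qed.

Lemma cauchy_schwarz x y : nm (ip x y : C) <= nm x * nm y.
Proof.
have [->|y0] := eqVneq y 0; first by rewrite ip0r !nm0 mulr0.
have ny : 0 < nm y by rewrite nm_gt0.
have := sqr_ge0 (nm (((nm y) ^+ 2)%:C *: x - ip x y *: y)).
rewrite nmB_sqr ipZl ipZr !nmZ nm_real.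
have -> : Re (((nm y ^+ 2)%:C) * (conjc (ip x y) * ip x y)) = nm y ^+ 2 * nm (ip x y : C) ^+ 2.
  by rewrite mulrC [conjc _ * _]mulrC -nm_sqrC -rmorphM /= mulrC.
rewrite ger0_norm ?sqr_ge0// => h.
rewrite -(ler_pXn2r (n := 2)) ?nnegrE ?nm_ge0 ?mulr_ge0 ?nm_ge0//.
rewrite -(ler_pM2l (exprn_gt0 2 ny)); move: h; rewrite !exprMn; lra.
Qed.

Lemma nm_complete (u : nat -> H) :
  (forall e : R, 0 < e -> exists N, forall m n, (N <= m)%N -> (N <= n)%N -> nm (u m - u n) < e) ->
  exists l, forall e : R, 0 < e -> exists N, forall n, (N <= n)%N -> nm (u n - l) < e.
Proof.
move=> cu; have : cvg (u @ \oo).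
  apply/cauchy_cvgP/cauchy_ballP => e' /ltC0[e e0 ->].
  have [N HN] := cu e e0; rewrite near_map2; exists ([set n | (N <= n)%N], [set n | (N <= n)%N]).
    by split; exists N.
  by move=> [m n] [/= Nm Nn]; rewrite -ball_normE /= nmE ltcR; exact: HN.
move=> /cvg_ex[l /= ul]; exists l => e e0.
have [N _ HN] := (cvg_nm _ _ _).1 ul e e0.
by exists N => n; exact: HN.
Qed.

Lemma closed_nm (M : set H) (x : H) : closed M ->
  (forall e : R, 0 < e -> exists2 y, M y & nm (y - x) < e) -> M x.
Proof.
move=> cM Mx; apply: cM => B /near_nm[e e0 eB].
by have [y My /eB By] := Mx e e0; exists y.
Qed.

Lemma closed_nm2 (G : set (H * H)) (x y : H) : closed G ->
  (forall e : R, 0 < e -> exists2 p, G p & nm (p.1 - x) < e /\ nm (p.2 - y) < e) -> G (x, y).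
Proof.
move=> cG Gxy; apply: cG => B [[/= U V] [/near_nm[d d0 dU] /near_nm[d' d'0 d'V]] UVB].
have dd : 0 < Num.min d d' by rewrite lt_min d0.
have [p Gp []] := Gxy _ dd; rewrite !lt_min => /andP[p1 _] /andP[_ p2].
by exists p; split => //; apply: UVB; split; [exact: dU|exact: d'V].
Qed.

Lemma nm_closedP (M : set H) :
  (forall x, (forall e : R, 0 < e -> exists2 y, M y & nm (y - x) < e) -> M x) -> closed M.
Proof.
move=> cM x clx; apply: cM => e e0.
have [|y [My ye]] := clx [set y | nm (y - x) < e]; first by apply/near_nm; exists e.
by exists y.
Qed.

Lemma subspace_sub (M : set H) x y : Defs.subspace M -> M x -> M y -> M (x - y).
Proof. by move=> [_ sM] Mx My; rewrite addrC -scaleN1r; exact: sM. Qed.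

Lemma subspaceZ (M : set H) (a : C) x : Defs.subspace M -> M x -> M (a *: x).
Proof. by move=> [M0 sM] Mx; rewrite -[_ *: _]addr0; exact: sM. Qed.

Lemma subspaceD (M : set H) x y : Defs.subspace M -> M x -> M y -> M (x + y).
Proof. by move=> [M0 sM] Mx My; rewrite -[x]scale1r; exact: sM. Qed.

Lemma small_inv (e : R) : 0 < e -> exists N, forall n, (N <= n)%N -> n.+1%:R^-1 < e.
Proof.
move=> e0; exists (Num.truncn e^-1).+1 => n Nn.
rewrite invf_plt ?posrE ?ltr0n//; apply: lt_le_trans (truncnS_gt _) _.
by rewrite ler_nat ltnW.
Qed.

Lemma nm2 : nm (2 : C) = 2.
Proof. by have := nm_real (2 : R); rewrite rmorph_nat normr_nat. Qed.

(* The representing vector minimises [|m|^2 - 2 Re (phi m)]. *)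
Lemma riesz (M : set H) (phi : H -> C) (K : R) : Defs.subspace M -> closed M ->
  (forall (a : C) x y, M x -> M y -> phi (a *: x + y) = a * phi x + phi y) ->
  (forall x, M x -> nm (phi x) <= K * nm x) ->
  exists2 w, M w & forall m, M m -> phi m = ip m w.
Proof.
move=> sM cM lin bd; have M0 := sM.1.
pose J m : R := nm m ^+ 2 - 2 * Re (phi m).
have phiD x y : M x -> M y -> phi (x + y) = phi x + phi y.
  by move=> Mx My; rewrite -{1}[x]scale1r lin// mul1r.
have phi0 : phi 0 = 0 by apply: (addrI (phi 0)); rewrite -phiD// !addr0.
have phiZ (a : C) x : M x -> phi (a *: x) = a * phi x.
  by move=> Mx; rewrite -[a *: x]addr0 lin// phi0 addr0.
have Jlb : lbound [set J m | m in M] (- K ^+ 2).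
  move=> _ [m Mm <-]; rewrite /J; have := bd m Mm; have := nm_Re (phi m).
  have := sqr_ge0 (nm m - K); have := ler_norm (Re (phi m)); rewrite sqrrB; lra.
pose j := inf [set J m | m in M].
have hasinf : has_inf [set J m | m in M] by split; [exists (J 0); exists 0|exists (- K ^+ 2)].
have jle m : M m -> j <= J m by move=> Mm; apply: ge_inf; [exists (- K ^+ 2)|exists m].
have minseq n : exists m, M m /\ J m < j + n.+1%:R^-1.
  have := inf_adherent (_ : 0 < n.+1%:R^-1 :> R) hasinf; rewrite invr_gt0 ltr0n => /(_ isT).
  by move=> [_ [m Mm <-] Jm]; exists m.
have [u Hu] := choice minseq.
have uM n : M (u n) by have [] := Hu n.
(* Parallelogram law: J at the midpoint is at least the infimum [j], while J at [u m] and [u n] is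
   almost [j]; the linear part of J drops out. *)
have dist m n : nm (u m - u n) ^+ 2 <= 2 * (m.+1%:R^-1 + n.+1%:R^-1).
  have Mmid : M ((2^-1 : C) *: (u m + u n)) by apply: subspaceZ => //; exact: subspaceD.
  have := jle _ Mmid; have [_] := Hu m; have [_] := Hu n; rewrite /J nmZ nmV nm2.
  rewrite phiZ; last exact: subspaceD.
  rewrite phiD// exprMn nmD_sqr nmB_sqr.
  have -> : Re ((2^-1 : C) * (phi (u m) + phi (u n))) = 2^-1 * (Re (phi (u m)) + Re (phi (u n))).
    by rewrite -ReD -ReZ fmorphV rmorph_nat.
  have -> : (2^-1 : R) ^+ 2 = 4^-1 by field.
  move: (n.+1%:R^-1) (m.+1%:R^-1) => a b; lra.
have [w uw] : exists w, forall e : R, 0 < e -> exists N, forall n, (N <= n)%N -> nm (u n - w) < e.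
  apply: nm_complete => e e0; have e4 : 0 < e ^+ 2 / 4 by rewrite divr_gt0// exprn_gt0.
  have [N HN] := small_inv e4.
  exists N => m n Nm Nn; rewrite -(ltr_pXn2r (n := 2)) ?nnegrE ?nm_ge0 ?(ltW e0)//.
  apply: le_lt_trans (dist m n) _; have := HN m Nm; have := HN n Nn.
  by move: (n.+1%:R^-1) (m.+1%:R^-1) => a b; lra.
have Mw : M w.
  apply: closed_nm => // e e0; have [N HN] := uw e e0.
  by exists (u N); [exact: uM|exact: HN].
exists w => // h Mh.
have reh h' : M h' -> Re (ip h' w) = Re (phi h').
  move=> {}Mh'; apply/eqP; rewrite -subr_eq0 -normr_eq0; apply/eqP/le_anti; rewrite normr_ge0 andbT.
  apply/ler_addgt0Pl => e e0; rewrite addr0.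
  have hp : 0 < nm h' + 1 by rewrite ltr_wpDl ?nm_ge0.
  have e1 : 0 < e / 2 / (nm h' + 1) by rewrite !divr_gt0.
  have [N1 HN1] := uw _ e1; have [N2 HN2] := small_inv (exprn_gt0 2 e1).
  pose n := maxn N1 N2.
  have := HN1 n (leq_maxl _ _); have := HN2 n (leq_maxr _ _) => n2 n1.
  set d : R := Re (ip h' (u n)) - Re (phi h').
  have quad : d ^+ 2 <= (nm h' + 1) ^+ 2 * n.+1%:R^-1.
    have key t : 0 <= n.+1%:R^-1 + t ^+ 2 * nm h' ^+ 2 + 2 * t * d.
      have Mt : M (t%:C *: h' + u n) by apply: sM.2.
      have := jle _ Mt; have [_] := Hu n; rewrite /J nmD_sqr nmZ nm_real exprMn real_normK ?num_real//.
      by rewrite ipZl lin// ReD !ReZ /d; move: (n.+1%:R^-1) => a; lra.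
    (* Nearly the minimiser in t of the quadratic expression in [key]; the added 1 keeps the
       denominator nonzero when [h'] is 0. *)
    have := key (- d / (nm h' + 1) ^+ 2).
    set p2 := (nm h' + 1) ^+ 2; have p2p : 0 < p2 by rewrite exprn_gt0.
    have hq : nm h' ^+ 2 <= p2 by rewrite ler_pXn2r ?nnegrE ?nm_ge0 ?(ltW hp)// lerDl.
    rewrite exprMn sqrrN exprVn.
    have E : (p2 ^+ 2)^-1 * nm h' ^+ 2 <= p2^-1.
      by rewrite mulrC ler_pdivrMr ?exprn_gt0// expr2 mulKf ?gt_eqF.
    have E2 := ler_wpM2l (sqr_ge0 d) E; rewrite -mulrA mulrA in E2 *.
    have -> : 2 * (- d / p2) * d = - 2 * (d ^+ 2 / p2) by ring.
    move=> k; rewrite mulrC -ler_pdivrMr//; move: k E2; rewrite !mulrA; move: (n.+1%:R^-1) => a; lra.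
  have ld : `|d| < e / 2.
    rewrite -(ltr_pXn2r (n := 2)) ?nnegrE ?divr_ge0 ?(ltW e0)// real_normK ?num_real//.
    apply: le_lt_trans quad _; rewrite mulrC -ltr_pdivlMr ?exprn_gt0//.
    by rewrite -expr_div_n.
  have lw : `|Re (ip h' w) - Re (ip h' (u n))| < e / 2.
    rewrite -ReB -ipBr; apply: le_lt_trans (nm_Re _) _.
    apply: le_lt_trans (cauchy_schwarz _ _) _; rewrite nmB.
    move: n1; rewrite ltr_pdivlMr// => n1; apply: le_lt_trans n1.
    by rewrite mulrC ler_wpM2l ?nm_ge0// lerDl.
  apply/ltW; rewrite -(subrKA (Re (ip h' (u n)))); apply: le_lt_trans (ler_normD _ _) _.
  by rewrite (splitr e); apply: ltrD.
apply: complex_inj; first by rewrite reh.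
(* The imaginary parts are the real parts at i h, up to sign. *)
have := reh _ (subspaceZ 'i sM Mh); rewrite ipZl phiZ// !['i * _]mulrC !ReiNIm.
by move=> /oppr_inj ->.
Qed.

(** The vector representing (., x) on [M] is the orthogonal projection of [x]; subtracting it from
    an [x] outside [M] leaves the vector sought. *)
Lemma proper_ortho (M : set H) : Defs.subspace M -> closed M -> M <> setT ->
  exists2 z : H, z != 0 & forall m, M m -> ip m z = 0.
Proof.
move=> sM cM MT; have [x Mx] : exists x, ~ M x.
  by apply: contra_notP MT => h; apply/seteqP; split=> // x _; apply: contra_notP h => ?; exists x.
have [w Mw wE] : exists2 w, M w & forall m, M m -> ip m x = ip m w.
  apply: (@riesz M (fun m => ip m x) (nm x)) => // [a y z _ _|y _]; first by rewrite ipDl ipZl.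
  by rewrite mulrC cauchy_schwarz.
exists (x - w); first by rewrite subr_eq0; apply/eqP => xw; apply: Mx; rewrite xw.
by move=> m Mm; rewrite ipBr wE// subrr.
Qed.

(** The lower bound makes the preimages of a convergent sequence a Cauchy sequence, and closedness
    of the graph puts their limit over the limit of the sequence. *)
Lemma closed_graph_range (G : set (H * H)) (c : R) :
  (forall x y, (forall e : R, 0 < e -> exists2 p, G p & nm (p.1 - x) < e /\ nm (p.2 - y) < e) ->
    G (x, y)) -> 0 < c ->
  (forall p q, G p -> G q -> c * nm (p.1 - q.1) <= nm (p.2 - q.2)) ->
  closed [set y | exists x, G (x, y)].
Proof.
move=> cG c0 bG; apply: nm_closedP => y yG.
have seqG n : exists p, G p /\ nm (p.2 - y) < n.+1%:R^-1.
  have n0 : 0 < n.+1%:R^-1 :> R by rewrite invr_gt0 ltr0n.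
  by have [y' [x' Gx'] ?] := yG _ n0; exists (x', y').
have [u Hu] := choice seqG.
have [x xu] : exists x, forall e : R, 0 < e -> exists N, forall n, (N <= n)%N -> nm ((u n).1 - x) < e.
  apply: nm_complete => e e0; have ce : 0 < c * e / 2 by rewrite divr_gt0// mulr_gt0.
  have [N HN] := small_inv ce.
  exists N => m n Nm Nn; rewrite -(ltr_pM2l c0).
  have [Gm um] := Hu m; have [Gn un] := Hu n; apply: le_lt_trans (bG _ _ Gm Gn) _.
  apply: le_lt_trans (nm_triangle _ y _) _; rewrite (nmB y).
  have := HN m Nm; have := HN n Nn; move: um un.
  by move: (n.+1%:R^-1) (m.+1%:R^-1) => a b; lra.
exists x; apply: cG => e e0.
have [N1 HN1] := xu e e0; have [N2 HN2] := small_inv e0.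
have [Gn un] := Hu (maxn N1 N2); exists (u (maxn N1 N2)) => //.
by split; [apply: HN1; exact: leq_maxl|apply: lt_trans un _; apply: HN2; exact: leq_maxr].
Qed.

End Hilbert.

(** * Defect spaces of an entire operator *)

Lemma scaler_comb2 (K : comNzRingType) (V : lmodType K) (k k' a a' b b' : K) (x y u v : V) :
  k *: x - k' *: y - ((k * a - k' * a') *: u + (k * b - k' * b') *: v) =
  k *: (x - (a *: u + b *: v)) - k' *: (y - (a' *: u + b' *: v)).
Proof.
rewrite !scalerBl !scalerBr !scalerDr !scalerA.
rewrite [X in _ - X]addrACA -opprD.
set P := (k * a) *: u + _; set Q := (k' * a') *: u + _.
by rewrite !opprB [Q - P]addrC [Q - _]addrC addrACA.
Qed.

Section Defect.
Context {R : realType} {H : completeNormedModType R[i]}.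
Local Notation C := (cplx R).
Local Notation Re := complex.Re.
Local Notation Im := complex.Im.
Variable ip : {dot H for (@conjc R)}.
Hypothesis ip_norm : forall x : H, ip x x = `|x| ^+ 2.
Variable T : linear_operator H.
Hypothesis T_entire : entire_class ip T.

Let ipDl := ipDl ip. Let ipDr := ipDr ip. Let ipZl := ipZl ip. Let ipZr := ipZr ip.
Let ipBl := ipBl ip. Let ipBr := ipBr ip. Let ipNl := ipNl ip. Let ipNr := ipNr ip.
Let ipC := ipC ip. Let ip0l := ip0l ip. Let ip0r := ip0r ip.
Let ip_nm := ip_nm ip_norm. Let cauchy_schwarz := cauchy_schwarz ip_norm.

Let T_sym : symmetric_op ip T. Proof. by have [] := T_entire. Qed.
Let T_closed : closed_op T. Proof. by have [] := T_entire. Qed.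

Lemma domZ {a : C} {x} : dom T x -> dom T (a *: x).
Proof. exact: subspaceZ (dom_subspace T). Qed.
Lemma domB x y : dom T x -> dom T y -> dom T (x - y).
Proof. exact: subspace_sub (dom_subspace T). Qed.

Lemma opD x y : dom T x -> dom T y -> T (x + y) = T x + T y.
Proof. by move=> Tx Ty; rewrite -{1}[x]scale1r op_linear// scale1r. Qed.
Lemma op0 : T 0 = 0.
Proof. have T0 := (dom_subspace T).1; by apply: (addrI (T 0)); rewrite -opD// !addr0. Qed.
Lemma opZ (a : C) x : dom T x -> T (a *: x) = a *: T x.
Proof. by move=> Tx; rewrite -[a *: x]addr0 op_linear// ?op0 ?addr0//; exact: (dom_subspace T).1. Qed.
Lemma opB x y : dom T x -> dom T y -> T (x - y) = T x - T y.
Proof. by move=> Tx Ty; rewrite -(scaleN1r y) addrC op_linear// scaleN1r addrC. Qed.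

Lemma entire_bound (l : C) : exists2 c : R, 0 < c &
  forall x, dom T x -> c * nm x <= nm (T x - l *: x).
Proof.
have [_ _ _ _ /(_ l)[c c0 cT]] := T_entire; exists c => // x Dx.
by have := cT x Dx; rewrite !nmE -rmorphM lecR.
Qed.

Lemma entire_eigen (l : C) x : dom T x -> T x = l *: x -> x = 0.
Proof.
have [c c0 cT] := entire_bound l => Dx Tx; have := cT x Dx; rewrite Tx subrr nm0.
by rewrite pmulr_rle0// => h; apply/eqP; rewrite -nm_eq0 eq_le h nm_ge0.
Qed.

(** The fibre is thus the classical defect space, the orthogonal complement of the range of T - conj
    l. *)
Lemma EfibP (l : C) x : Efib ip T l x <-> forall u, dom T u -> ip x (T u - conjc l *: u) = 0.
Proof.
have E u : cform ip (x, l *: x) (u, T u) = - ip x (T u - conjc l *: u).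
  rewrite /cform /= ipZl ipBr opprB; congr (_ - _); rewrite ipZr; congr (_ * _).
  by rewrite conjcK.
split=> [Ex u Du|Ex [u y] [/= Du ->]]; last by rewrite E Ex ?oppr0.
by apply: oppr_inj; rewrite -E oppr0 Ex.
Qed.

Lemma Efib_subspace l : Defs.subspace (Efib ip T l).
Proof.
split=> [|a x y /EfibP Ex /EfibP Ey]; apply/EfibP => u Du; first by rewrite ip0l.
by rewrite ipDl ipZl Ex// Ey// mulr0 addr0.
Qed.

Lemma cformC x y : cform ip x y = - conjc (cform ip y x).
Proof. by rewrite /cform rmorphB /= -!ipC opprB. Qed.

Lemma cformDl x y z : cform ip (x + y) z = cform ip x z + cform ip y z.
Proof. by rewrite /cform /= !ipDl; ring. Qed.

Lemma cformZl (a : C) x z : cform ip (a *: x) z = a * cform ip x z.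
Proof. by rewrite /cform /= !ipZl; ring. Qed.

Lemma cformDr x y z : cform ip z (x + y) = cform ip z x + cform ip z y.
Proof. by rewrite cformC cformDl rmorphD opprD -!cformC. Qed.

Lemma cformZr (a : C) x z : cform ip z (a *: x) = conjc a * cform ip z x.
Proof. by rewrite cformC cformZl rmorphM /= -mulrN -cformC. Qed.

Lemma graph_lin (k k' : C) p q : graph T p -> graph T q -> graph T (k *: p - k' *: q).
Proof.
case: p q => [x _] [y _] [/= Dx ->] [/= Dy ->]; split=> /=; first by apply: domB; exact: domZ.
by rewrite opB ?opZ//; exact: domZ.
Qed.

Lemma graph_sperp p : graph T p -> sperp ip (graph T) p.
Proof.
by case: p => x _ [/= Dx ->] [y _] [/= Dy ->]; rewrite /cform /= T_sym// subrr.
Qed.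

(** On vectors (x, l x) the Hermitian form has the sign of Im l; this is the link between the fibres
    and the two deficiency indices. *)
Lemma cform_diag (l : C) x : - 'i%C * cform ip (x, l *: x) (x, l *: x) = (2 * Im l * nm x ^+ 2)%:C.
Proof.
rewrite /cform /= ipZl ipZr ip_nm; case: l => a b.
by apply: complex_inj; rewrite /=; ring.
Qed.

(** Indices (1,1) leave one positive vector [u] and one negative vector [v] modulo the graph. The
    graph pairs to zero with its symplectic complement, so the form depends only on the two
    coordinates. *)
Lemma signature_decomp : exists u v : H * H, [/\ sperp ip (graph T) u /\ sperp ip (graph T) v,
  0 < Re (- 'i%C * cform ip u u), Re (- 'i%C * cform ip v v) < 0,
  forall x, sperp ip (graph T) x -> exists a b : C, graph T (x - (a *: u + b *: v)) &
  forall x (a b : C), sperp ip (graph T) x -> graph T (x - (a *: u + b *: v)) ->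
    Re (- 'i%C * cform ip x x) = nm a ^+ 2 * Re (- 'i%C * cform ip u u) +
                            nm b ^+ 2 * Re (- 'i%C * cform ip v v)].
Proof.
have [_ _ _ [u [v [[Vu Vv] dec [up vn] _ uv]]] _] := T_entire.
exists (u ord0), (v ord0); split=> //.
- by have := up ord0; rewrite ltcE /= => /andP[].
- by have := vn ord0; rewrite ltcE /= => /andP[].
- by move=> x Vx; have [a [b]] := dec x Vx; rewrite !big_ord1; exists (a ord0), (b ord0).
move=> x a b Vx Nx.
have uv0 : cform ip (u ord0) (v ord0) = 0.
  have i0 : - 'i%C != 0 :> R[i] by rewrite oppr_eq0 eq_complex /= oner_eq0 andbF.
  by apply: (mulfI i0); rewrite uv mulr0.
have vu0 : cform ip (v ord0) (u ord0) = 0 by rewrite cformC uv0 rmorph0 oppr0.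
have Vxn n : graph T n -> cform ip x n = 0 by exact: Vx.
have [n Nn xE] : exists2 n : H * H, graph T n & x = n + (a *: u ord0 + b *: v ord0).
  by exists (x - (a *: u ord0 + b *: v ord0)); rewrite ?subrK.
have nV y : sperp ip (graph T) y -> cform ip n y = 0.
  by move=> Vy; rewrite cformC Vy// rmorph0 oppr0.
rewrite {2}xE cformDr Vxn// add0r cformDr !cformZr xE !cformDl !cformZl !nV// uv0 vu0.
by rewrite -!ReZ -ReD !nm_sqrC; congr Re; ring.
Qed.

(* For [Im l >= 0] the component along the positive vector [u] already determines
   an element of the fibre, for [Im l <= 0] the one along [v]. *)
Lemma Efib_coord (l : C) : exists phi : H -> C -> Prop,
  [/\ forall x, Efib ip T l x -> exists a, phi x a,
      forall x a y b (k k' : C), phi x a -> phi y b -> phi (k *: x - k' *: y) (k * a - k' * b) &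
      forall x, Efib ip T l x -> phi x 0 -> x = 0].
Proof.
have [u [v [[Vu Vv] up vn dec decE]]] := signature_decomp.
pose P (x : H) (a b : C) := graph T ((x, l *: x) - (a *: u + b *: v)).
have Plin x a b y a' b' (k k' : C) : P x a b -> P y a' b' ->
    P (k *: x - k' *: y) (k * a - k' * a') (k * b - k' * b').
  rewrite /P => G1 G2.
  have -> : (k *: x - k' *: y, l *: (k *: x - k' *: y)) = k *: (x, l *: x) - k' *: (y, l *: y).
    by congr pair; rewrite /= scalerBr !scalerA ![_ * l]mulrC.
  have -> : k *: (x, l *: x) - k' *: (y, l *: y) -
      ((k * a - k' * a') *: u + (k * b - k' * b') *: v) =
      k *: ((x, l *: x) - (a *: u + b *: v)) - k' *: ((y, l *: y) - (a' *: u + b' *: v)).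
    exact: scaler_comb2.
  exact: graph_lin.
have P0 x : Efib ip T l x -> P x 0 0 -> x = 0.
  by rewrite /P !scale0r addr0 subr0 => _ [/= Dx /esym]; exact: entire_eigen.
have PE x a b : Efib ip T l x -> P x a b -> 2 * Im l * nm x ^+ 2 =
    nm a ^+ 2 * Re (- 'i%C * cform ip u u) + nm b ^+ 2 * Re (- 'i%C * cform ip v v).
  by move=> Ex Pab; rewrite -(decE _ _ _ Ex Pab) cform_diag.
have nm_sqr0 (b : C) (r s : R) : nm b ^+ 2 * r = s -> 0 < r -> s <= 0 -> b = 0.
  move=> E r0 s0; apply/eqP; rewrite -nm_eq0 -sqrf_eq0 eq_le sqr_ge0 andbT.
  by rewrite -(pmulr_lle0 _ r0) E.
have [Il|Il] := leP 0 (Im l).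
  exists (fun x a => exists b, P x a b); split.
  - by move=> x Ex; have [a [b Pab]] := dec _ Ex; exists a, b.
  - by move=> x a y b k k' [a' Pa] [b' Pb]; exists (k * a' - k' * b'); exact: Plin.
  (* With a = 0 the left side of [PE] is nonnegative and its right side a nonpositive multiple of
     |b|^2, so b = 0; then (x, l x) lies in the graph, and T has no eigenvectors. *)
  - move=> x Ex [b Pb]; apply: P0 => //; suff b0 : b = 0 by rewrite b0 in Pb.
    have := PE _ _ _ Ex Pb; rewrite nm0 expr0n mul0r add0r => h.
    apply: (nm_sqr0 _ (- Re (- 'i%C * cform ip v v)) (- (2 * Im l * nm x ^+ 2))); first by rewrite h mulrN.
      by rewrite oppr_gt0.
    by rewrite oppr_le0 mulr_ge0 ?sqr_ge0 ?mulr_ge0.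
exists (fun x b => exists a, P x a b); split.
- by move=> x Ex; have [a [b Pab]] := dec _ Ex; exists b, a.
- by move=> x a y b k k' [a' Pa] [b' Pb]; exists (k * a' - k' * b'); exact: Plin.
- move=> x Ex [a Pa]; apply: P0 => //; suff a0 : a = 0 by rewrite a0 in Pa.
  have := PE _ _ _ Ex Pa; rewrite nm0 expr0n mul0r addr0 => /esym h.
  apply: (nm_sqr0 _ _ _ h) => //.
  by rewrite mulr_le0_ge0 ?sqr_ge0// mulr_ge0_le0// ltW.
Qed.

Lemma Efib_dim1 (l : C) x y : Efib ip T l x -> x != 0 -> Efib ip T l y -> exists a : C, y = a *: x.
Proof.
move=> Ex x0 Ey; have [phi [dec lin inj]] := Efib_coord l.
have [a Pa] := dec x Ex; have [b Pb] := dec y Ey.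
have a0 : a != 0 by apply: contraNneq x0 => a0; rewrite a0 in Pa; rewrite (inj x).
exists (b / a); apply/esym/eqP; rewrite -subr_eq0; apply/eqP; rewrite -[y]scale1r; apply: inj.
  by apply: subspace_sub (Efib_subspace l) _ _; apply: subspaceZ (Efib_subspace l) _.
have -> : 0 = b / a * a - 1 * b :> C by rewrite divfK// mul1r subrr.
exact: lin.
Qed.

Definition opran (l : C) : set H := [set y | exists x, dom T x /\ y = T x - l *: x].

Lemma opran_subspace l : Defs.subspace (opran l).
Proof.
split; first by exists 0; split; [exact: (dom_subspace T).1|rewrite op0 scaler0 subr0].
move=> a _ _ [x [Dx ->]] [y [Dy ->]]; exists (a *: x + y); split; first exact: (dom_subspace T).2.
by rewrite op_linear// scalerBr scalerDr !scalerA [a * l]mulrC opprD addrACA.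
Qed.

Lemma closed_opran l : closed (opran l).
Proof.
have [c c0 bT] := entire_bound l.
have -> : opran l = [set y | exists x, [set p | dom T p.1 /\ p.2 = T p.1 - l *: p.1] (x, y)] by [].
apply: (closed_graph_range (c := c)) => //=; last first.
  move=> [x y] [x' y'] [/= Dx ->] [/= Dx' ->].
  have -> : T x - l *: x - (T x' - l *: x') = T (x - x') - l *: (x - x').
    by rewrite opB// scalerBr !opprB [l *: x' - T x']addrC [l *: x' - _]addrC addrACA.
  by apply: bT; exact: domB.
move=> x y xy; suff [Dx E] : graph T (x, y + l *: x) by split=> //; rewrite -[T x]E /= addrK.
apply: closed_nm2 => // e e0; have n0 : 0 < 2 + nm l by rewrite ltr_wpDr ?nm_ge0.
have [[u _] [/= Du ->] [ux uy]] := xy (e / (2 + nm l)) (divr_gt0 e0 n0).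
exists (u, T u) => //=; split.
  by apply: lt_le_trans ux _; rewrite ler_piMr ?(ltW e0)// invf_le1//; have := nm_ge0 l; lra.
have -> : T u - (y + l *: x) = T u - l *: u - y + l *: (u - x).
  by rewrite scalerBr addrACA subrK opprD [- y + _]addrC addrA.
apply: le_lt_trans (nmD _ _) _; rewrite nmZ.
have lux : nm l * nm (u - x) <= nm l * (e / (2 + nm l)) by rewrite ler_wpM2l ?nm_ge0 ?(ltW ux).
have : (2 + nm l) * (e / (2 + nm l)) = e by rewrite mulrC divfK// gt_eqF.
have := divr_gt0 e0 n0; lra.
Qed.

(** If T - l were onto, every vector of the symplectic complement would be congruent modulo the
    graph to some (x, l x), where the form has the sign of Im l. That rules out either the positive
    vector [u] or the negative vector [v]. *)
Lemma opran_proper l : opran l <> setT.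
Proof.
move=> full; have [u [v [[Vu Vv] up vn _ _]]] := signature_decomp.
have red p : sperp ip (graph T) p -> exists x : H, - 'i%C * cform ip p p = (2 * Im l * nm x ^+ 2)%:C.
  move=> Vp; have [d [Dd dE]] : opran l (p.2 - l *: p.1) by rewrite full.
  pose n := (d, T d); have Gn : graph T n by [].
  exists (p.1 - d); rewrite -cform_diag; congr (_ * _).
  have pE : p = n + (p.1 - d, l *: (p.1 - d)).
    case: p dE {Vp} => p1 p2 /= /eqP; rewrite subr_eq => /eqP ->; congr pair; first by rewrite /= addrC subrK.
    by rewrite /= scalerBr -!addrA [- _ + _]addrC.
  have Vq : sperp ip (graph T) (p.1 - d, l *: (p.1 - d)).
    move=> y Gy; have := Vp y Gy; rewrite {1}pE cformDl => <-.
    by rewrite (graph_sperp Gn Gy) add0r.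
  move: pE Vq; set q := (p.1 - d, _) => pE Vq.
  by rewrite {1}pE cformDl cformC Vp// rmorph0 oppr0 add0r pE cformDr Vq// add0r.
have [x xE] := red _ Vu; have [y yE] := red _ Vv.
move: up vn; rewrite xE yE /= => up vn.
have [Il|Il] := leP 0 (Im l).
  by move: vn; rewrite ltNge mulr_ge0 ?sqr_ge0// mulr_ge0.
by move: up; rewrite ltNge mulr_le0_ge0 ?sqr_ge0// mulr_ge0_le0// ltW.
Qed.

Lemma Efib_neq0 l : exists2 e, e != 0 & Efib ip T l e.
Proof.
have [e e0 He] := proper_ortho ip_norm (opran_subspace (conjc l)) (@closed_opran _) (@opran_proper (conjc l)).
exists e => //; apply/EfibP => u Du; rewrite ipC He ?rmorph0//.
by exists u.
Qed.

(* [A] inverts [T - conj l0] in the weak sense, modulo the fibre over [l0]. *)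
Lemma inverse_op (l0 : C) (c : R) : 0 < c ->
  (forall u, dom T u -> c * nm u <= nm (T u - conjc l0 *: u)) ->
  exists A : H -> H, [/\ forall (a : C) x y, A (a *: x + y) = a *: A x + A y,
    forall y, nm (A y) <= nm y / c,
    forall y e, Efib ip T l0 e -> ip (A y) e = 0 &
    forall y u, dom T u -> ip (A y) (T u - conjc l0 *: u) = ip y u].
Proof.
move=> c0 bT; set M := opran (conjc l0).
have [g Hg] : exists g : H -> H, forall m, M m -> dom T (g m) /\ m = T (g m) - conjc l0 *: g m.
  suff /choice[g Hg] : forall m, exists x, M m -> dom T x /\ m = T x - conjc l0 *: x by exists g.
  by move=> m; have [[x Hx]|nMm] := pselect (M m); [exists x|exists 0].
have gE u : dom T u -> g (T u - conjc l0 *: u) = u.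
  move=> Du; have Mu : M (T u - conjc l0 *: u) by exists u.
  have [Dg E] := Hg _ Mu; apply/eqP; rewrite -subr_eq0 -nm_eq0 eq_le nm_ge0 andbT.
  rewrite -(pmulr_rle0 _ c0); apply: le_trans (bT _ (domB Dg Du)) _.
  rewrite opB// scalerBr opprB [conjc l0 *: u - _]addrC addrACA -E [- _ + _]addrC.
  by rewrite -[X in _ + X]opprB subrr nm0.
have glin (a : C) x y : M x -> M y -> g (a *: x + y) = a *: g x + g y.
  move=> Mx My; have [Dx Ex] := Hg _ Mx; have [Dy Ey] := Hg _ My.
  rewrite -[RHS]gE; last exact: (dom_subspace T).2.
  rewrite op_linear//; congr g; rewrite {1}Ex {1}Ey.
  by rewrite scalerBr scalerDr !scalerA [a * _]mulrC opprD addrACA.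
have gbd m : M m -> nm (g m) <= nm m / c.
  by move=> Mm; have [Dg E] := Hg _ Mm; rewrite ler_pdivlMr// mulrC {2}E; exact: bT.
(* [g] is the inverse of T - conj l0 on its range [M], and A is to be the adjoint of [g]: (g m, y) =
   (m, A y) with A y in [M]. The vector exists by [riesz], since [M] is closed and [g] bounded. *)
have exA y : exists w, M w /\ forall u, dom T u -> ip u y = ip (T u - conjc l0 *: u) w.
  have [w Mw Hw] : exists2 w, M w & forall m, M m -> ip (g m) y = ip m w.
    apply: (@riesz _ _ _ ip_norm M (fun m => ip (g m) y) (nm y / c) (opran_subspace _) (@closed_opran _)).
      by move=> a x x' Mx Mx'; rewrite glin// ipDl ipZl.
    move=> x Mx; apply: le_trans (cauchy_schwarz _ _) _; rewrite mulrC -mulrA ler_wpM2l ?nm_ge0//.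
    by rewrite mulrC gbd.
  by exists w; split=> // u Du; rewrite -Hw ?gE//; exists u.
have [A HA] := choice exA; have AM y : M (A y) by have [] := HA y.
have AE y u : dom T u -> ip (A y) (T u - conjc l0 *: u) = ip y u.
  by move=> Du; rewrite ipC -(HA y).2// -ipC.
exists A; split=> //.
- move=> a x y; apply/eqP; rewrite -subr_eq0; set z := _ - _.
  have [u [Du zE]] : M z.
    apply: subspace_sub (opran_subspace _) (AM _) _.
    exact: (opran_subspace _).2 (AM _) (AM _).
  have : ip z z = 0 by rewrite {2}zE /z ipBl ipDl ipZl !AE// ipDl ipZl subrr.
  by move=> h; have := ip_Re ip_norm z; rewrite h => /esym/eqP; rewrite sqrf_eq0 nm_eq0.
- move=> y; have [->|Ay0] := eqVneq (A y) 0; first by rewrite nm0 divr_ge0 ?nm_ge0 ?ltW.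
  have [u [Du E]] := AM y; have Ap : 0 < nm (A y) by rewrite nm_gt0.
  rewrite -(ler_pM2r Ap) -expr2 -(ip_Re ip_norm) {2}E AE//.
  apply: le_trans (ler_norm _) _; apply: le_trans (nm_Re _) _; apply: le_trans (cauchy_schwarz _ _) _.
  by rewrite -mulrA ler_wpM2l ?nm_ge0// mulrC ler_pdivlMr// {1}E mulrC bT.
- by move=> y e /EfibP Ee; have [u [Du ->]] := AM y; rewrite ipC Ee// rmorph0.
Qed.

End Defect.

(** * Resolvents of a bounded operator *)

Section Resolvent.
Context {R : realType} {H : completeNormedModType R[i]}.
Local Notation C := (cplx R).
Local Notation Re := complex.Re.
Local Notation Im := complex.Im.
Variable ip : {dot H for (@conjc R)}.
Hypothesis ip_norm : forall x : H, ip x x = `|x| ^+ 2.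
Variables (A : H -> H) (c : R).
Hypothesis c0 : 0 < c.
Hypothesis A_lin : forall (a : C) x y, A (a *: x + y) = a *: A x + A y.
Hypothesis A_le : forall y, nm (A y) <= nm y / c.

Let L (k : C) x : H := x - k *: A x.

Lemma ALD x y : A (x + y) = A x + A y.
Proof. by rewrite -{1}[x]scale1r A_lin scale1r. Qed.
Lemma AL0 : A 0 = 0.
Proof. by apply: (addrI (A 0)); rewrite -ALD !addr0. Qed.
Lemma ALZ (a : C) x : A (a *: x) = a *: A x.
Proof. by rewrite -[a *: x]addr0 A_lin AL0 addr0. Qed.
Lemma ALB x y : A (x - y) = A x - A y.
Proof. by rewrite -[- y]scaleN1r ALD ALZ scaleN1r. Qed.

Let L_lin k (a : C) x y : L k (a *: x + y) = a *: L k x + L k y.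
Proof. by rewrite /L A_lin scalerBr scalerDr !scalerA [a * k]mulrC opprD addrACA. Qed.

Let LB k x y : L k (x - y) = L k x - L k y.
Proof. by rewrite -scaleN1r addrC L_lin scaleN1r addrC. Qed.

(** The radius c / 2 is chosen to make k A a contraction with factor 1/2. *)
Let kA_le (k : C) x : nm k <= c / 2 -> nm (k *: A x) <= nm x / 2.
Proof.
move=> kc; rewrite nmZ; apply: le_trans (ler_pM (nm_ge0 _) (nm_ge0 _) kc (A_le x)) _.
by rewrite [leLHS](_ : _ = nm x / 2)//; field; rewrite gt_eqF.
Qed.

Let L_ge (k : C) x : nm k <= c / 2 -> nm x / 2 <= nm (L k x).
Proof. by move=> kc; have := nm_sub_le x (k *: A x); have := kA_le x kc; rewrite /L; lra. Qed.

Let L_inj (k : C) x y : nm k <= c / 2 -> L k x = L k y -> x = y.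
Proof.
move=> kc E; apply/eqP; rewrite -subr_eq0 -nm_eq0 eq_le nm_ge0 andbT.
by have := L_ge (x - y) kc; rewrite LB E subrr nm0; lra.
Qed.

(** The range of L is closed, as L is bounded below by 1/2. A vector z orthogonal to it satisfies
    |z|^2 = (k A z, z) <= |z|^2 / 2, hence vanishes. *)
Let L_surj (k : C) y : nm k <= c / 2 -> exists x, L k x = y.
Proof.
move=> kc; have -> : (exists x, L k x = y) = [set z | exists x, [set p | p.2 = L k p.1] (x, z)] y.
  by apply/propext; split=> [[x <-]|[x /= ->]]; exists x.
suff -> : [set z | exists x, [set p | p.2 = L k p.1] (x, z)] = setT by [].
apply: contrapT => nT; have [||z z0 Hz] := proper_ortho ip_norm _ _ nT.
- split; first by exists 0; rewrite /= /L AL0 scaler0 subr0.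
  by move=> a _ _ [x /= ->] [x' /= ->]; exists (a *: x + x'); rewrite /= L_lin.
- apply: (closed_graph_range (c := 2^-1)); rewrite ?invr_gt0//.
    move=> x z xz; apply/eqP; rewrite -subr_eq0 -nm_eq0 eq_le nm_ge0 andbT.
    suff B (e : R) : 0 < e -> nm (z - L k x) <= e.
      by apply/ler_addgt0Pl => e e0; rewrite addr0; exact: B.
    move=> e0; have e4 : 0 < e / 4 by rewrite divr_gt0.
    have [[u _] /= -> [ux uz]] := xz _ e4.
    have := nm_triangle z (L k u) (L k x); rewrite -LB => /le_trans; apply; rewrite [nm (z - L k u)]nmB.
    have := nmBD (u - x) (k *: A (u - x)); have := kA_le (u - x) kc; rewrite -/(L k _).
    move: ux uz; lra.
  by move=> [x _] [x' _] /= -> ->; rewrite -LB mulrC; exact: L_ge.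
have E : ip z z = ip (k *: A z) z.
  by apply/eqP; rewrite -subr_eq0 -(ipBl ip); apply/eqP; apply: Hz; exists z.
have := nm_Re (ip (k *: A z) z); rewrite -{1}E (ip_Re ip_norm) ger0_norm ?sqr_ge0// => h.
have := le_trans h (cauchy_schwarz ip_norm _ _).
have zp : 0 < nm z by rewrite nm_gt0.
by rewrite expr2 ler_pM2r//; have := kA_le z kc; lra.
Qed.

Lemma resolvent : exists Rs : C -> H -> H,
  forall k, nm k <= c / 2 -> forall y, Rs k y - k *: A (Rs k y) = y.
Proof.
have /choice[f Hf] : forall p : C * H, exists x, nm p.1 <= c / 2 -> L p.1 x = p.2.
  move=> [k y]; have [kc|] := boolP (nm k <= c / 2); last by exists 0.
  by have [x Lx] := L_surj y kc; exists x.
by exists (fun k y => f (k, y)) => k kc y; exact: (Hf (k, y)).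
Qed.

Variable Rs : C -> H -> H.
Hypothesis RsE : forall k, nm k <= c / 2 -> forall y, Rs k y - k *: A (Rs k y) = y.

Lemma RsZ (k : C) (a : C) x : nm k <= c / 2 -> Rs k (a *: x) = a *: Rs k x.
Proof. by move=> kc; apply: (L_inj kc); rewrite -[a *: Rs k x]addr0 L_lin /L !RsE// AL0 scaler0 subr0 addr0. Qed.

Lemma RsB (k : C) x y : nm k <= c / 2 -> Rs k (x - y) = Rs k x - Rs k y.
Proof. by move=> kc; apply: (L_inj kc); rewrite LB /L !RsE. Qed.

Lemma Rs_le (k : C) y : nm k <= c / 2 -> nm (Rs k y) <= 2 * nm y.
Proof. by move=> kc; have := L_ge (Rs k y) kc; rewrite /L RsE//; lra. Qed.

(** The first resolvent identity, from which differentiability in k follows without expanding in a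
    power series. *)
Lemma resolvent_id (k k' : C) y : nm k <= c / 2 -> nm k' <= c / 2 ->
  Rs k' y - Rs k y = (k' - k) *: Rs k' (A (Rs k y)).
Proof.
move=> kc kc'; rewrite -RsZ//; apply: (L_inj kc'); rewrite LB /L !RsE//.
by rewrite -{1}(RsE kc y) scalerBl opprB addrC addrA subrK.
Qed.

Lemma is_derive_Rs (y : C -> H) (k : C) dy : nm k < c / 2 -> is_derive k (1 : C) y dy ->
  is_derive k (1 : C) (fun k => Rs k (y k)) (Rs k dy + Rs k (A (Rs k (y k)))).
Proof.
move=> kc dY; apply/is_derive_nm => e e0; have kc' := ltW kc.
(* The factor 4 / c bounds [Rs k'] composed with A and [Rs k]: each resolvent has norm at most 2 and
   A at most 1 / c. *)
set x := A (Rs k (y k)); pose K := 4 / c * (nm dy + nm x).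
have K0 : 0 <= K by rewrite mulr_ge0 ?addr_ge0 ?nm_ge0// divr_ge0// ltW.
have e4 : 0 < e / 4 by rewrite divr_gt0.
have K1 : 0 < e / 2 / (K + 1) by rewrite !divr_gt0// ltr_wpDl.
have nk : \forall k' \near k, nm k' < c / 2.
  apply/near_nm; exists (c / 2 - nm k); first by rewrite subr_gt0.
  by move=> k' h; rewrite -(subrK k k'); apply: le_lt_trans (nmD _ _) _; rewrite -ltrBrDr.
have nd : \forall k' \near k, nm (k' - k) < e / 2 / (K + 1) by apply/near_nm; exists (e / 2 / (K + 1)).
have := (is_derive_nm _ _ _).1 dY _ e4; apply: filterS3 nk nd => k' /ltW k'c dk yk.
have -> : Rs k' (y k') - Rs k (y k) - (k' - k) *: (Rs k dy + Rs k x) =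
  Rs k' (y k' - y k - (k' - k) *: dy) + ((k' - k) *: (Rs k' dy - Rs k dy) +
    (k' - k) *: (Rs k' x - Rs k x)).
  rewrite !RsB// RsZ//.
  have -> : Rs k' (y k) = (k' - k) *: Rs k' x + Rs k (y k) by rewrite -resolvent_id// subrK.
  rewrite !scalerBr scalerDr; set a := Rs k' _; set g := Rs k _; set p := _ *: Rs k' dy.
  set q := _ *: Rs k dy; set s := _ *: Rs k' x; set t := _ *: Rs k x.
  have -> : a - (s + g) - p = a - g - (p + s).
    by rewrite -[in LHS]addrA -opprD -[s + g + p]addrA [s + _]addrC -addrA opprD addrA.
  by rewrite [p - q + _]addrACA -opprD subrKA.
rewrite !resolvent_id// -!scalerDr.
apply: le_trans (nmD _ _) _; rewrite !nmZ.
have B z : nm (Rs k' (A (Rs k z))) <= 4 / c * nm z.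
  apply: le_trans (Rs_le _ k'c) _; have := A_le (Rs k z).
  have : nm (Rs k z) / c <= 2 * nm z / c by rewrite ler_pM2r ?invr_gt0// Rs_le.
  have -> : 4 / c * nm z = 2 * (2 * nm z / c) by ring.
  lra.
have h1 := Rs_le (y k' - y k - (k' - k) *: dy) k'c.
have h2 : nm (Rs k' (A (Rs k dy)) + Rs k' (A (Rs k x))) <= K.
  by apply: le_trans (nmD _ _) _; rewrite /K mulrDr lerD.
have h3 : nm (k' - k) * K <= e / 2.
  move: dk; rewrite ltr_pdivlMr ?ltr_wpDl// mulrDr mulr1 => dk; apply: le_trans (ltW dk).
  by rewrite lerDl nm_ge0.
have h4 : nm (k' - k) * (nm (k' - k) * nm (Rs k' (A (Rs k dy)) + Rs k' (A (Rs k x)))) <= nm (k' - k) * (e / 2).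
  apply: ler_wpM2l (nm_ge0 _) _ _ _; apply: le_trans h3; exact: ler_wpM2l (nm_ge0 _) _ _ h2.
rewrite (_ : e * _ = 2 * (e / 4 * nm (k' - k)) + nm (k' - k) * (e / 2)); last by field.
by apply: lerD h4; apply: le_trans h1 _; rewrite ler_pM2l.
Qed.

Lemma is_derive_bounded (y : C -> H) (k : C) dy : is_derive k (1 : C) y dy ->
  is_derive k (1 : C) (fun k => A (y k)) (A dy).
Proof.
move=> dY; apply/is_derive_nm => e e0.
have := (is_derive_nm _ _ _).1 dY _ (mulr_gt0 e0 c0); apply: filterS => k' yk.
rewrite -ALB -ALZ -ALB; apply: le_trans (A_le _) _.
by rewrite ler_pdivrMr// mulrAC.
Qed.

End Resolvent.

Lemma is_derive_shift (R : realType) (V : normedModType R[i]) (y : cplx R -> V) (l k : cplx R) dy :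
  is_derive (l - k : cplx R) (1 : cplx R) y dy -> is_derive l (1 : cplx R) (fun l => y (l - k)) dy.
Proof.
move=> dY; apply/is_derive_nm => e e0; have /near_nm[d d0 H] := (is_derive_nm _ _ _).1 dY _ e0.
apply/near_nm; exists d => // l' ll'.
have E : l' - k - (l - k) = l' - l by rewrite opprB addrA subrK.
by have := H (l' - k); rewrite E; apply.
Qed.

(** * A local holomorphic frame of E *)

Section Frame.
Context {R : realType} {H : completeNormedModType R[i]}.
Local Notation C := (cplx R).
Variable ip : {dot H for (@conjc R)}.
Hypothesis ip_norm : forall x : H, ip x x = `|x| ^+ 2.
Variable T : linear_operator H.
Hypothesis T_entire : entire_class ip T.

(* [w m l = A^m w_0(l)], where [w_0(l) = (1 - (l - l0) A)^-1 e]. *)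
Lemma local_frame (l0 : C) : exists (d K : R) (e : H) (w : nat -> C -> H) (v1 v2 : C -> H),
  [/\ 0 < d, e != 0 /\ w 0%N l0 = e,
    forall l, nm (l - l0) < d -> Efib ip T l (w 0%N l) /\ ip (w 0%N l) e = ((nm e) ^+ 2)%:C,
    forall m l, nm (l - l0) < d -> [/\ w m l = w m l0 + (l - l0) *: w m.+1 l,
      nm (l - l0) ^+ m * nm (w m l) <= 2^-1 ^+ m * K & exists dw, is_derive l (1 : C) (w m) dw] &
    forall l, nm (l - l0) < d -> [/\ is_derive l (1 : C) (w 0%N) (v1 l),
      is_derive l (1 : C) v1 (v2 l) & {for l, continuous v2}]].
Proof.
have [c c0 bT] := entire_bound T_entire (conjc l0).
have [A [A_lin A_le A_perp A_E]] := inverse_op ip_norm T_entire c0 bT.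
have [Rs RsE] := resolvent ip_norm c0 A_lin A_le.
have [e e0 Ee] := Efib_neq0 ip_norm T_entire l0.
have c2 : 0 < c / 2 by rewrite divr_gt0.
pose v l := Rs (l - l0) e.
have RE l (kc : nm (l - l0) < c / 2) := RsE (l - l0) (ltW kc).
exists (c / 2), (2 * nm e), e, (fun m l => iter m A (v l)), (fun l => Rs (l - l0) (A (v l))),
  (fun l => Rs (l - l0) (A (Rs (l - l0) (A (v l)))) + Rs (l - l0) (A (Rs (l - l0) (A (v l))))).
have v0 : v l0 = e by have := RE l0; rewrite /v subrr nm0 => /(_ c2 e); rewrite scale0r subr0.
split=> //.
- move=> l kc; have vE : v l = e + (l - l0) *: A (v l) by rewrite /v -{2}(RE l kc e) subrK.
  (* A maps into the orthogonal complement of the fibre over l0, so the product with [e] is the same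
     for all l; in particular the frame has no zero. *)
  split; last by rewrite /= vE (ipDl ip) (ipZl ip) A_perp// mulr0 addr0 (ip_nm ip_norm).
  (* Since (A v, (T - conj l0) u) = (v, u), the product (v, (T - conj l) u) equals ((1 - (l - l0) A)
     v, (T - conj l0) u) = (e, (T - conj l0) u), and [e] lies in the fibre over l0. *)
  apply/(EfibP ip T) => u Du /=.
  have -> : T u - conjc l *: u = (T u - conjc l0 *: u) - conjc (l - l0) *: u.
    have {1}-> : conjc l = conjc l0 + conjc (l - l0) by rewrite -rmorphD addrC subrK.
    by rewrite scalerDl opprD addrA.
  rewrite (ipBr ip) (ipZr ip) conjcK -[ip (v l) u](A_E (v l) u Du) -(ipZl ip) -(ipBl ip) RE//.
  exact: ((EfibP ip T _ _).1 Ee).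
- move=> m l kc; have vE : v l = e + (l - l0) *: A (v l) by rewrite /v -{2}(RE l kc e) subrK.
  have AD := ALD A_lin; have AZ := ALZ A_lin.
  split.
  - rewrite v0; elim: m => [|m IH]; [exact: vE|by rewrite iterS {1}IH AD AZ].
  - elim: m => [|m IH]; first by rewrite !expr0 !mul1r; exact: (Rs_le c0 A_le RsE _ (ltW kc)).
    have AL : nm (iter m.+1 A (v l)) <= nm (iter m A (v l)) / c by exact: A_le.
    have h : nm (l - l0) * nm (iter m.+1 A (v l)) <= 2^-1 * nm (iter m A (v l)).
      apply: le_trans (ler_pM (nm_ge0 _) (nm_ge0 _) (ltW kc) AL) _.
      by rewrite [leLHS](_ : _ = 2^-1 * nm (iter m A (v l)))//; field; rewrite gt_eqF.
    rewrite exprS [nm _ * _]mulrC -mulrA; apply: le_trans (ler_wpM2l (exprn_ge0 _ (nm_ge0 _)) h) _.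
    by rewrite mulrCA exprS -[2^-1 * _ * _]mulrA ler_pM2l ?invr_gt0.
  - suff dv : is_derive l (1 : C) v (Rs (l - l0) (A (v l))).
      elim: m => [|m [dw IH]]; first by exists (Rs (l - l0) (A (v l))).
      by exists (A dw); apply: (is_derive_bounded c0 A_lin A_le IH).
    have := is_derive_Rs c0 A_lin A_le RsE kc (is_derive_cst e (l - l0 : C) (1 : C)).
    have -> : Rs (l - l0) 0 = 0 by have := RsZ c0 A_lin A_le RsE 0 0 (ltW kc); rewrite !scale0r.
    by rewrite add0r => /is_derive_shift.
- move=> l kc; have dv : is_derive (l - l0 : C) (1 : C) (fun k => Rs k e) (Rs (l - l0) (A (v l))).
    have := is_derive_Rs c0 A_lin A_le RsE kc (is_derive_cst e (l - l0 : C) (1 : C)).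
    have -> : Rs (l - l0) 0 = 0 by have := RsZ c0 A_lin A_le RsE 0 0 (ltW kc); rewrite !scale0r.
    by rewrite add0r.
  have dRA (y : C -> H) k dy : nm k < c / 2 -> is_derive k (1 : C) y dy ->
      is_derive k (1 : C) (fun k => Rs k (A (y k))) (Rs k (A dy) + Rs k (A (Rs k (A (y k))))).
    move=> nk dy'; have := is_derive_bounded c0 A_lin A_le dy'.
    by move=> /(is_derive_Rs c0 A_lin A_le RsE nk).
  have d1 := dRA _ _ _ kc dv; have d2 := dRA _ _ _ kc d1.
  split; [exact: (is_derive_shift dv)|exact: (is_derive_shift d1)|].
  have /is_derive_continuous cf := is_derive_shift d2.
  exact: (cvgD cf cf).
Qed.

End Frame.

(** * Laplacians and curvature *)

Section Laplacian.
Context {R : realType}.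
Implicit Types (h g L : R * R -> R) (p q : R * R).

(** The partial derivatives are existentially quantified and everything is required on a
    neighbourhood, so the notion is local: [h] and [L] may be changed away from [p], and sums need
    no common choice of derivatives. *)
Definition has_lap h L p : Prop := exists hx hy hxx hyy, \forall q \near p,
  smooth_at h hx hy hxx hyy q /\ hxx q + hyy q = L q.

Lemma near_fst (P : set (R * R)) p : (\forall q \near p, P q) -> \forall t \near p.1, P (t, p.2).
Proof.
case: p => a b; apply: (near_continuous (u := fun t => (t, b))).
by apply: continuous_pair; [exact: cvg_id|exact: cvg_cst].
Qed.

Lemma near_snd (P : set (R * R)) p : (\forall q \near p, P q) -> \forall t \near p.2, P (p.1, t).
Proof.
case: p => a b; apply: (near_continuous (u := fun t => (a, t))).
by apply: continuous_pair; [exact: cvg_cst|exact: cvg_id].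
Qed.

Lemma is_derive_near_eq (K : numFieldType) (V : normedModType K) (f g : K^o -> V) (x : K^o) (d : V) :
  (\forall y \near x, f y = g y) -> is_derive x (1 : K^o) f d -> is_derive x (1 : K^o) g d.
Proof.
move=> fg /is_derive_ler df; apply/is_derive_ler => e e0; have fgx := nbhs_singleton fg.
by apply: filterS2 fg (df e e0) => y <-; rewrite fgx.
Qed.

Lemma continuous_near_eq (U V : topologicalType) (f g : U -> V) (x : U) :
  (\forall y \near x, f y = g y) -> {for x, continuous f} -> {for x, continuous g}.
Proof.
move=> fg cf; suff : g @ x --> g x by []; have <- := nbhs_singleton fg.
by apply: cvg_trans cf; apply: near_eq_cvg; apply: filterS fg => y ->.
Qed.

Lemma smooth_at_eq h hx hy hxx hyy g gx gy gxx gyy p :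
  (\forall q \near p, [/\ h q = g q, hx q = gx q, hy q = gy q, hxx q = gxx q & hyy q = gyy q]) ->
  smooth_at h hx hy hxx hyy p -> smooth_at g gx gy gxx gyy p.
Proof.
move=> E [[d1 d2 d3 d4] [c1 c2 c3 c4 c5]].
have [e1 e2 e3 e4 e5] := nbhs_singleton E.
split; split.
- by rewrite -e2; apply: is_derive_near_eq d1; apply: filterS (near_fst E) => t [].
- by rewrite -e3; apply: is_derive_near_eq d2; apply: filterS (near_snd E) => t [].
- by rewrite -e4; apply: is_derive_near_eq d3; apply: filterS (near_fst E) => t [].
- by rewrite -e5; apply: is_derive_near_eq d4; apply: filterS (near_snd E) => t [].
- by apply: continuous_near_eq c1; apply: filterS E => q [].
- by apply: continuous_near_eq c2; apply: filterS E => q [].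
- by apply: continuous_near_eq c3; apply: filterS E => q [].
- by apply: continuous_near_eq c4; apply: filterS E => q [].
- by apply: continuous_near_eq c5; apply: filterS E => q [].
Qed.

Lemma near_all (U : topologicalType) (P : set U) (p : U) : (forall q : U, P q) -> \forall q \near p, P q.
Proof. exact: nearW. Qed.

Lemma near_near (U : topologicalType) (P : set U) (p : U) :
  (\forall q \near p, P q) -> \forall q \near p, \forall t \near q, P t.
Proof. by move=> /nbhs_interior. Qed.

Lemma has_lap_eq h g L M p : (\forall q \near p, h q = g q) -> (\forall q \near p, L q = M q) ->
  has_lap h L p -> has_lap g M p.
Proof.
move=> hg LM [hx [hy [hxx [hyy sm]]]]; exists hx, hy, hxx, hyy.
apply: filterS3 (near_near hg) LM sm => q hgq <- [sm E]; split=> //.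
by apply: smooth_at_eq sm; apply: filterS hgq.
Qed.

Lemma has_lapD h g L M p : has_lap h L p -> has_lap g M p ->
  has_lap (fun q => h q + g q) (fun q => L q + M q) p.
Proof.
move=> [hx [hy [hxx [hyy sh]]]] [gx [gy [gxx [gyy sg]]]].
exists (fun q => hx q + gx q), (fun q => hy q + gy q), (fun q => hxx q + gxx q), (fun q => hyy q + gyy q).
apply: filterS2 sh sg => q [[[d1 d2 d3 d4] [c1 c2 c3 c4 c5]] <-] [[[d1' d2' d3' d4'] [c1' c2' c3' c4' c5']] <-].
split; last by rewrite addrACA.
split; first by split; exact: is_deriveD.
by split; [exact: (cvgD c1 c1')|exact: (cvgD c2 c2')|exact: (cvgD c3 c3')|exact: (cvgD c4 c4')|exact: (cvgD c5 c5')].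
Qed.

Lemma has_lapZ (a : R) h L p : has_lap h L p -> has_lap (fun q => a * h q) (fun q => a * L q) p.
Proof.
move=> [hx [hy [hxx [hyy sh]]]].
exists (fun q => a * hx q), (fun q => a * hy q), (fun q => a * hxx q), (fun q => a * hyy q).
apply: filterS sh => q [[[d1 d2 d3 d4] [c1 c2 c3 c4 c5]] <-].
split; last by rewrite mulrDr.
split; first by split; exact: is_deriveZ.
have ca : {for q, continuous (fun=> a)} by exact: cvg_cst.
by split; [exact: (cvgM ca c1)|exact: (cvgM ca c2)|exact: (cvgM ca c3)|exact: (cvgM ca c4)|exact: (cvgM ca c5)].
Qed.

Lemma has_lap_cst (a : R) p : has_lap (fun=> a) (fun=> 0) p.
Proof.
exists (fun=> 0), (fun=> 0), (fun=> 0), (fun=> 0); apply: near_all => q; split; last by rewrite addr0.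
by split; split; try exact: is_derive_cst; exact: cvg_cst.
Qed.

Lemma has_lap_sum (I : Type) (s : seq I) (P : pred I) (h : I -> R * R -> R) p :
  (forall i, P i -> has_lap (h i) (fun=> 0) p) ->
  has_lap (fun q => \sum_(i <- s | P i) h i q) (fun=> 0) p.
Proof.
move=> hi; elim: s => [|i s IH].
  by apply: has_lap_eq (has_lap_cst 0 p); apply: near_all => q; rewrite ?big_nil.
have [Pi|nPi] := boolP (P i).
  by apply: has_lap_eq (has_lapD (hi i Pi) IH); apply: near_all => q; rewrite ?big_cons ?Pi ?addr0.
by apply: has_lap_eq IH; apply: near_all => q; rewrite ?big_cons ?(negbTE nPi).
Qed.

(** Globally defined partial derivatives: [has_lap] supplies witnesses point by point, whereas
    [jensen_smooth] takes one family of functions for the whole disc. *)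
Definition px h p : R := derive1 (fun t => h (t, p.2)) p.1.
Definition py h p : R := derive1 (fun t => h (p.1, t)) p.2.

Lemma has_lap_smooth h L p : has_lap h L p ->
  \forall q \near p, smooth_at h (px h) (py h) (px (px h)) (py (py h)) q /\
    px (px h) q + py (py h) q = L q.
Proof.
move=> [hx [hy [hxx [hyy sh]]]].
have E : \forall q \near p, hx q = px h q /\ hy q = py h q.
  by apply: filterS sh => q [[[[? e1] [? e2] _ _] _] _]; rewrite /px /py !derive1E.
have E2 : \forall q \near p, hxx q = px (px h) q /\ hyy q = py (py h) q.
  apply: filterS2 (near_near E) sh => q Eq [[[_ _ d3 d4] _] _].
  rewrite /px /py !derive1E; split.
    have : is_derive q.1 1 (fun x => px h (x, q.2)) (hxx q).
      by apply: is_derive_near_eq d3; apply: filterS (near_fst Eq) => t [].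
    by case.
  have : is_derive q.2 1 (fun x => py h (q.1, x)) (hyy q).
    by apply: is_derive_near_eq d4; apply: filterS (near_snd Eq) => t [].
  by case.
apply: filterS3 (near_near E) (near_near E2) sh => q Eq E2q [sm <-].
split; last by have [-> ->] := nbhs_singleton E2q.
by apply: smooth_at_eq sm; apply: filterS2 Eq E2q => t [? ?] [? ?].
Qed.

Lemma smooth_ln N Nx Ny Nxx Nyy p : smooth_at N Nx Ny Nxx Nyy p -> 0 < N p ->
  smooth_at (fun q => ln (N q)) (fun q => Nx q / N q) (fun q => Ny q / N q)
    (fun q => (Nxx q * N q - Nx q ^+ 2) / N q ^+ 2) (fun q => (Nyy q * N q - Ny q ^+ 2) / N q ^+ 2) p.
Proof.
move=> [[d1 d2 d3 d4] [c1 c2 c3 c4 c5]] Np; have N0 : N p != 0 by rewrite gt_eqF.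
have dln (f : R -> R) (t d : R) : 0 < f t -> is_derive t 1 f d -> is_derive t 1 (fun t => ln (f t)) (d / f t).
  move=> ft df; rewrite mulrC; apply: (@is_derive1_comp _ (@ln R) f t _ d) => //; exact: is_derive1_ln.
have dq (f g : R -> R) (t df dg : R) : g t != 0 -> is_derive t 1 f df -> is_derive t 1 g dg ->
    is_derive t 1 (fun t => f t / g t) ((df * g t - f t * dg) / g t ^+ 2).
  move=> gt df' dg'; have dV := is_deriveV gt dg'.
  apply: is_derive_eq (is_deriveM df' dV) _.
  by rewrite /GRing.scale /=; field.
case: p => a b in Np N0 d1 d2 d3 d4 c1 c2 c3 c4 c5 *; rewrite /= in N0 d1 d2 d3 d4.
split; split.
- exact: dln.
- exact: dln.
- exact: dq.
- exact: dq.
- exact: (@continuous_comp _ _ _ N (@ln R) (a, b) c1 (continuous_ln Np)).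
- exact: (cvgM c2 (cvgV N0 c1)).
- exact: (cvgM c3 (cvgV N0 c1)).
- apply: (cvgM (cvgB (cvgM c4 c1) (cvgM c2 c2)) (cvgV _ (cvgM c1 c1))); exact: mulf_neq0.
- apply: (cvgM (cvgB (cvgM c5 c1) (cvgM c3 c3)) (cvgV _ (cvgM c1 c1))); exact: mulf_neq0.
Qed.

Lemma has_lap_ln N Nx Ny Nxx Nyy p : (\forall q \near p, smooth_at N Nx Ny Nxx Nyy q) -> 0 < N p ->
  has_lap (fun q => ln (N q)) (fun q => (Nxx q * N q - Nx q ^+ 2) / N q ^+ 2 +
    (Nyy q * N q - Ny q ^+ 2) / N q ^+ 2) p.
Proof.
move=> smN Np; have cN : {for p, continuous N} by have [_ []] := nbhs_singleton smN.
do 4 eexists; have Nq : \forall q \near p, 0 < N q by exact: (cvgr_gt _ cN _ Np).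
by apply: filterS2 smN Nq => q sq Nq'; split; [exact: (smooth_ln sq Nq')|].
Qed.

End Laplacian.

(** * Logarithms of norms of holomorphic maps *)

Section PathDerivative.
Context {R : realType}.
Local Notation C := (cplx R).
Local Notation Re := complex.Re.
Local Notation Im := complex.Im.

Definition toC (p : R * R) : C := p.1 +i* p.2.

Lemma continuous_toC : continuous toC.
Proof. by move=> p; apply: continuous_complex; [exact: cvg_fst|exact: cvg_snd]. Qed.

Lemma open_nm (V : normedModType R[i]) (a : V) (d : R) : open [set z : V | nm (z - a) < d].
Proof.
rewrite openE => z /= zd; apply/near_nm; exists (d - nm (z - a)); first by rewrite subr_gt0.
by move=> y yz; have := nm_triangle y z a; rewrite /=; lra.
Qed.

Lemma near_neq0 (U : topologicalType) (V : normedModType R[i]) (f : U -> V) (x : U) :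
  {for x, continuous f} -> f x != 0 -> \forall t \near x, f t != 0.
Proof.
move=> cf fx; have cn : {for x, continuous (fun t => nm (f t))}.
  by apply: (@continuous_comp _ _ _ f); [exact: cf|exact: continuous_nm].
have f0 : 0 < nm (f x) by rewrite nm_gt0.
have Nq : \forall t \near x, 0 < nm (f t) by exact: (cvgr_gt _ cn _ f0).
by apply: filterS Nq => t; rewrite nm_gt0.
Qed.

(** Differentiability in a real parameter for values in a space over [R[i]]; the real increment acts
    as a complex scalar. *)
Definition pathder {V : normedModType R[i]} (f : R -> V) (t : R) (d : V) : Prop :=
  forall e : R, 0 < e -> \forall s \near t, nm (f s - f t - ((s - t)%:C : C) *: d) <= e * `|s - t|.

(** The path is affine with unit direction [w]: this is 1 along the x-axis, and i or -i along the
    y-axis according as the argument is z or its conjugate. *)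
Lemma pathder_comp (V : normedModType R[i]) (v : C -> V) (c : R -> C) (t : R) (w : C) (dv : V) :
  (forall s, c s - c t = (s - t)%:C * w) -> nm w = 1 -> is_derive (c t) (1 : C) v dv ->
  pathder (fun s => v (c s)) t (w *: dv).
Proof.
move=> cE w1 /is_derive_nm dV e e0; have /near_nm[d d0 H] := dV e e0.
apply/(@nbhs_normP R R); exists d => // s; rewrite /= distrC => st.
have E : nm (c s - c t) = `|s - t| by rewrite cE nmM w1 mulr1 nm_real.
by have := H (c s); rewrite E scalerA -cE; apply.
Qed.

Lemma pathder_Re (f : R -> C) (t : R) (d : C) : pathder f t d ->
  is_derive t (1 : R) (fun s => Re (f s)) (Re d).
Proof.
move=> df; apply/is_derive_ler => e e0; apply: filterS (df e e0) => s; apply: le_trans.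
by rewrite [_ *: _]/GRing.scale /= -ReZ -!ReB; exact: nm_Re.
Qed.

Lemma pathder_Im (f : R -> C) (t : R) (d : C) : pathder f t d ->
  is_derive t (1 : R) (fun s => Im (f s)) (Im d).
Proof.
move=> df; apply/is_derive_ler => e e0; apply: filterS (df e e0) => s; apply: le_trans.
by rewrite [_ *: _]/GRing.scale /= -ImZ -!ImB; exact: nm_Im.
Qed.

Lemma pathder_continuous (V : normedModType R[i]) (f : R -> V) (t : R) (d : V) :
  pathder f t d -> {for t, continuous f}.
Proof.
move=> df; apply/cvg_nm => e e0.
have nd : 0 < nm d + 1 by rewrite ltr_wpDl ?nm_ge0.
have e1 : 0 < e / 2 / (nm d + 1) by rewrite !divr_gt0.
have near1 : \forall s \near t, `|s - t| < Num.min 1 (e / 2 / (nm d + 1)).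
  apply/(@nbhs_normP R R); exists (Num.min 1 (e / 2 / (nm d + 1))); first by rewrite /= lt_min ltr01.
  by move=> s; rewrite /= distrC.
apply: filterS2 near1 (df (e / 2) _) => [s|]; last by rewrite divr_gt0.
rewrite lt_min => /andP[s1 s2] h.
rewrite -(subrK ((s - t)%:C *: d) (f s - f t)); apply: le_lt_trans (nmD _ _) _.
rewrite nmZ nm_real; move: s2; rewrite ltr_pdivlMr// => s2.
have : `|s - t| * nm d <= `|s - t| * (nm d + 1) by rewrite ler_wpM2l// lerDl.
have : e / 2 * `|s - t| <= e / 2 * 1 by rewrite ler_wpM2l ?divr_ge0 ?(ltW e0)// ltW.
lra.
Qed.

Section ip_path.
Context {H : completeNormedModType R[i]}.
Variable ip : {dot H for (@conjc R)}.
Hypothesis ip_norm : forall x : H, ip x x = `|x| ^+ 2.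

Lemma continuous_ip (U : topologicalType) (u v : U -> H) (x : U) :
  {for x, continuous u} -> {for x, continuous v} -> {for x, continuous (fun t => ip (u t) (v t) : C)}.
Proof.
move=> cu cv; apply/cvg_nm => e e0; set a := nm (u x); set b := nm (v x).
have a0 : 0 <= a := nm_ge0 _; have b0 : 0 <= b := nm_ge0 _.
have k0 : 0 < a + b + 1 by rewrite ltr_wpDl// addr_ge0.
set k := a + b + 1 in k0; set d := Num.min 1 (e / k).
have d0 : 0 < d by rewrite lt_min ltr01 divr_gt0.
apply: filterS2 ((cvg_nm _ _ _).1 cu d d0) ((cvg_nm _ _ _).1 cv d d0) => t ut vt.
have -> : ip (u t) (v t) - ip (u x) (v x) = ip (u t - u x) (v t) + ip (u x) (v t - v x).
  by rewrite (ipBl ip) (ipBr ip) addrA subrK.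
apply: le_lt_trans (nmD _ _) _.
have h1 := cauchy_schwarz ip_norm (u t - u x) (v t); have h2 := cauchy_schwarz ip_norm (u x) (v t - v x).
have vb : nm (v t) <= 1 + b.
  have := nmD (v t - v x) (v x); rewrite subrK -/b; have : nm (v t - v x) <= 1 by move: vt; rewrite lt_min => /andP[/ltW].
  lra.
have h3 : nm (u t - u x) * nm (v t) <= nm (u t - u x) * (1 + b) by rewrite ler_wpM2l ?nm_ge0.
have h4 : nm (u t - u x) * (1 + b) < d * (1 + b) by rewrite ltr_pM2r// ltr_wpDr.
have h5 : a * nm (v t - v x) <= a * d by rewrite ler_wpM2l// ltW.
have h6 : d * k <= e by rewrite -ler_pdivlMr// ge_min lexx orbT.
apply: lt_le_trans h6; rewrite /k; rewrite -/a in h2; clear -h1 h2 h3 h4 h5.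
move: (nm (ip _ (v t) : C)) (nm (ip (u x) _ : C)) h1 h2 => p q h1 h2.
have -> : d * (a + b + 1) = d * (1 + b) + a * d by ring.
lra.
Qed.

Lemma pathder_ip (f g : R -> H) (t : R) df dg : pathder f t df -> pathder g t dg ->
  pathder (fun s => ip (f s) (g s) : C) t (ip df (g t) + ip (f t) dg).
Proof.
move=> dF dG e e0; set a := nm (f t); set b := nm (g t); set c := nm df.
have a0 : 0 <= a := nm_ge0 _; have b0 : 0 <= b := nm_ge0 _; have c0 : 0 <= c := nm_ge0 _.
have k0 : 0 < a + b + 1 + c by rewrite ltr_wpDr// ltr_wpDl// addr_ge0.
set k := a + b + 1 + c in k0; have d0 : 0 < e / k by rewrite divr_gt0.
have d1 : 0 < Num.min 1 (e / k) by rewrite lt_min ltr01.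
apply: filterS3 (dF _ d0) (dG _ d0) ((cvg_nm _ _ _).1 (pathder_continuous dG) _ d1) => s fs gs gc.
have -> : (ip (f s) (g s) - ip (f t) (g t) - ((s - t)%:C : C) *: (ip df (g t) + ip (f t) dg) : C) =
    ip (f s - f t - (s - t)%:C *: df) (g s) + ((s - t)%:C * ip df (g s - g t) +
    ip (f t) (g s - g t - (s - t)%:C *: dg)).
  rewrite !(ipBl ip) !(ipBr ip) (ipZl ip) (ipZr ip) conjc_real /GRing.scale /=; ring.
apply: le_trans (nmD _ _) _; apply: le_trans (lerD (lexx _) (nmD _ _)) _; rewrite nmM nm_real.
have gb : nm (g s) <= 1 + b.
  have := nmD (g s - g t) (g t); rewrite subrK -/b; have : nm (g s - g t) <= 1 by move: gc; rewrite lt_min => /andP[/ltW].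
  lra.
have gl : nm (g s - g t) <= e / k by move: gc; rewrite lt_min => /andP[_ /ltW].
set D := `|s - t| in fs gs *; have D0 : 0 <= D by exact: normr_ge0.
have h1 : nm (ip (f s - f t - (s - t)%:C *: df) (g s) : C) <= e / k * D * (1 + b).
  by apply: le_trans (cauchy_schwarz ip_norm _ _) _; apply: ler_pM; rewrite ?nm_ge0.
have h2 : D * nm (ip df (g s - g t) : C) <= D * (c * (e / k)).
  rewrite ler_wpM2l//; apply: le_trans (cauchy_schwarz ip_norm _ _) _; exact: ler_wpM2l.
have h3 : nm (ip (f t) (g s - g t - (s - t)%:C *: dg) : C) <= a * (e / k * D).
  by apply: le_trans (cauchy_schwarz ip_norm _ _) _; apply: ler_wpM2l.
have -> : e * D = e / k * D * (1 + b) + (D * (c * (e / k)) + a * (e / k * D)).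
  have E : e = e / k * k by rewrite divfK ?gt_eqF.
  rewrite {1}E; clearbody D; rewrite /k; ring.
by rewrite !lerD.
Qed.

(** The product rule for (v, v), applied twice along each axis, shows smoothness. The Laplacian
    stays unspecified, as it will be identified with the curvature and never computed. *)
Lemma has_lap_sqnorm (v v1 v2 : C -> H) (p : R * R) :
  (\forall l \near (conjc (toC p) : C), [/\ is_derive l (1 : C) v (v1 l), is_derive l (1 : C) v1 (v2 l) &
     {for l, continuous v2}]) -> v (conjc (toC p)) != 0 ->
  exists L, has_lap (fun q => ln (nm (v (conjc (toC q))) ^+ 2)) L p.
Proof.
move=> dv vp; pose c q : C := conjc (toC q).
have cc : continuous c.
  by move=> q; apply: (@continuous_comp _ _ _ toC); [exact: continuous_toC|exact: continuous_conj].
pose ii (a b : C -> H) q := Re (ip (a (c q)) (b (c q))).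
have nv : \forall q \near p, [/\ is_derive (c q) (1 : C) v (v1 (c q)),
    is_derive (c q) (1 : C) v1 (v2 (c q)) & {for c q, continuous v2}] by exact: (near_continuous (cc p) dv).
have c_x q s : c (s, q.2) - c (q.1, q.2) = (s - q.1)%:C * 1.
  by rewrite /c /toC -rmorphB mulr1; apply: complex_inj; rewrite /= ?subrr ?oppr0.
have c_y q s : c (q.1, s) - c (q.1, q.2) = (s - q.2)%:C * (- 'i).
  by rewrite /c /toC -rmorphB; apply: complex_inj; rewrite /= ?subrr; ring.
have dx q (a b : C -> H) a1 b1 : is_derive (c q) (1 : C) a a1 -> is_derive (c q) (1 : C) b b1 ->
    is_derive q.1 (1 : R) (fun x => ii a b (x, q.2)) (Re (ip a1 (b (c q)) + ip (a (c q)) b1)).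
  case: q => x y da db; have p1 := pathder_comp (c := fun s => c (s, y)) (c_x (x, y)) nm1 da.
  have p2 := pathder_comp (c := fun s => c (s, y)) (c_x (x, y)) nm1 db.
  by have := pathder_Re (pathder_ip p1 p2); rewrite !scale1r.
have ni : nm (- 'i : C) = 1 by rewrite nmN nm_i.
have dy q (a b : C -> H) a1 b1 : is_derive (c q) (1 : C) a a1 -> is_derive (c q) (1 : C) b b1 ->
    is_derive q.2 (1 : R) (fun y => ii a b (q.1, y))
      (Re (ip ((- 'i : C) *: a1) (b (c q)) + ip (a (c q)) ((- 'i : C) *: b1))).
  case: q => x y da db; have p1 := pathder_comp (c := fun s => c (x, s)) (c_y (x, y)) ni da.
  have p2 := pathder_comp (c := fun s => c (x, s)) (c_y (x, y)) ni db.
  exact: (pathder_Re (pathder_ip p1 p2)).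
pose w1 l : H := (- 'i : C) *: v1 l; pose w2 l : H := (- 'i : C) *: ((- 'i : C) *: v2 l).
pose N q := nm (v (c q)) ^+ 2.
have NE : N = ii v v by apply/funext => q; rewrite /ii (ip_Re ip_norm).
have smN : \forall q \near p, smooth_at N (fun q => ii v1 v q + ii v v1 q) (fun q => ii w1 v q + ii v w1 q)
    (fun q => ii v2 v q + ii v1 v1 q + (ii v1 v1 q + ii v v2 q))
    (fun q => ii w2 v q + ii w1 w1 q + (ii w1 w1 q + ii v w2 q)) q.
  apply: filterS nv => q [d0 d1 c2].
  have dw1 : is_derive (c q) (1 : C) w1 ((- 'i : C) *: v2 (c q)) by exact: is_deriveZ.
  have c0 := is_derive_continuous d0; have c1 := is_derive_continuous d1.
  have cw1 := is_derive_continuous dw1.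
  have cw2 : {for c q, continuous w2} by exact: (cvgZl_tmp (cvgZl_tmp c2)).
  have cii a b : {for c q, continuous a} -> {for c q, continuous b} -> {for q, continuous (ii a b)}.
    move=> ca cb; apply: (@continuous_comp _ _ _ (fun q => ip (a (c q)) (b (c q)) : C) (@Re R)).
      by apply: continuous_ip; apply: (@continuous_comp _ _ _ c); [exact: cc| |exact: cc|].
    exact: continuous_Re.
  rewrite NE; split; split.
  - by have := dx q _ _ _ _ d0 d0; rewrite ReD.
  - by have := dy q _ _ _ _ d0 d0; rewrite ReD.
  - have := is_deriveD (dx q _ _ _ _ d1 d0) (dx q _ _ _ _ d0 d1); rewrite !ReD; exact.
  - have := is_deriveD (dy q _ _ _ _ dw1 d0) (dy q _ _ _ _ d0 dw1); rewrite !ReD; exact.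
  - exact: cii.
  - exact: (cvgD (cii _ _ c1 c0) (cii _ _ c0 c1)).
  - exact: (cvgD (cii _ _ cw1 c0) (cii _ _ c0 cw1)).
  - exact: (cvgD (cvgD (cii _ _ c2 c0) (cii _ _ c1 c1)) (cvgD (cii _ _ c1 c1) (cii _ _ c0 c2))).
  - exact: (cvgD (cvgD (cii _ _ cw2 c0) (cii _ _ cw1 cw1)) (cvgD (cii _ _ cw1 cw1) (cii _ _ c0 cw2))).
have Np : 0 < N p by rewrite exprn_gt0// nm_gt0.
by eexists; exact: (has_lap_ln smN Np).
Qed.

End ip_path.

(** Put Q = g'/g. In the direction w of modulus 1 the derivative of ln |g|^2 is 2 Re (w Q), so the
    second derivatives along 1 and i are 2 Re Q' and 2 Re (i i Q'), which cancel. Continuity of Q'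
    comes from two applications of [holo_derivable2]. *)
Lemma has_lap_ln_holo (g : C -> C) (p : R * R) :
  (\forall z \near toC p, derivable g z 1) -> g (toC p) != 0 ->
  has_lap (fun q => ln (nm (g (toC q)) ^+ 2)) (fun=> 0) p.
Proof.
move=> dg gp; pose c := toC.
have nd : \forall z \near toC p, [/\ is_derive z (1 : C) g ('D_1 g z),
    is_derive z (1 : C) ('D_(1 : C) g : C -> C) ('D_1 ('D_1 g : C -> C) z),
    {for z, continuous ('D_(1 : C) ('D_(1 : C) g : C -> C) : C -> C)} & g z != 0].
  have cg : {for toC p, continuous g}.
    by have [dgp _] := derivableP (nbhs_singleton dg); apply/differentiable_continuous/derivable1_diffP.
  have n0 := near_neq0 cg gp.
  have no : \forall z \near toC p, exists2 U : set C, open U /\ U z & forall z, U z -> derivable g z 1.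
    have /near_nm[d d0 dU] := dg; apply/near_nm; exists d => // z zd.
    by exists [set z : C | nm (z - toC p) < d] => //; split=> //; exact: open_nm.
  apply: filterS2 no n0 => z [U [oU Uz] Ug] gz.
  split; [exact: (derivableP (Ug z Uz))|exact: (derivableP (holo_derivable2 oU Ug Uz))| |exact: gz].
  exact: (is_derive_continuous (derivableP (holo_derivable2 oU (holo_derivable2 oU Ug) Uz))).
have dlog (f : R -> C) t d : pathder f t d -> f t != 0 ->
    is_derive t (1 : R) (fun s => ln (nm (f s) ^+ 2)) (2 * Re (d / f t)).
  move=> df f0; pose N s := Re (f s) * Re (f s) + Im (f s) * Im (f s).
  have NE s : nm (f s) ^+ 2 = N s by rewrite nm_sqr !expr2.
  have Np : 0 < N t by rewrite -NE exprn_gt0// nm_gt0.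
  have dN : is_derive t (1 : R) N (2 * (Re (f t) * Re d + Im (f t) * Im d)).
    have da := pathder_Re df; have db := pathder_Im df.
    have dab := is_deriveD (is_deriveM da da) (is_deriveM db db).
    by apply: (is_derive_eq dab); rewrite /GRing.scale /=; ring.
  have -> : (fun s => ln (nm (f s) ^+ 2)) = (fun s => ln (N s)) by apply/funext => s; rewrite NE.
  apply: (is_derive_eq (@is_derive1_comp _ (@ln R) N t _ _ (is_derive1_ln Np) dN)).
  have : Re (f t) * Re (f t) + Im (f t) * Im (f t) != 0 by rewrite gt_eqF.
  by case: d {df dN} => d1 d2; rewrite /N; case: (f t) => a b /= ?; field; rewrite !expr2.
pose g1 : C -> C := 'D_(1 : C) g; pose g2 : C -> C := 'D_(1 : C) g1.
pose Q z : C := g1 z / g z; pose Q1 z : C := (g2 z * g z - g1 z * g1 z) / g z ^+ 2.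
have c_x q s : c (s, q.2) - c (q.1, q.2) = (s - q.1)%:C * 1.
  by rewrite /c /toC mulr1; apply: complex_inj; rewrite /= ?subrr.
have c_y q s : c (q.1, s) - c (q.1, q.2) = (s - q.2)%:C * 'i.
  by rewrite /c /toC; apply: complex_inj; rewrite /= ?subrr; ring.
exists (fun q => 2 * Re (Q (c q))), (fun q => 2 * Re ('i * Q (c q))),
  (fun q => 2 * Re (Q1 (c q))), (fun q => 2 * Re ('i * ('i * Q1 (c q)))).
have ndp : \forall q \near p, [/\ is_derive (c q) (1 : C) g (g1 (c q)),
    is_derive (c q) (1 : C) g1 (g2 (c q)), {for c q, continuous g2} & g (c q) != 0].
  exact: (near_continuous (@continuous_toC p) nd).
apply: filterS ndp => -[x y] [d1 d2 c2 g0].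
have dQ : is_derive (c (x, y)) (1 : C) Q (Q1 (c (x, y))) by exact: (is_derive_div g0 d2 d1).
have diQ : is_derive (c (x, y)) (1 : C) (fun z => ('i : C) *: Q z) (('i : C) *: Q1 (c (x, y))) by exact: is_deriveZ.
have c0 := is_derive_continuous d1; have c1 := is_derive_continuous d2; have cQ := is_derive_continuous dQ.
have cQ1 : {for c (x, y), continuous Q1}.
  apply: (cvgM (cvgB (cvgM c2 c0) (cvgM c1 c1)) (cvgV _ (cvgM c0 c0))); exact: mulf_neq0.
have cRe (F : C -> C) : {for c (x, y), continuous F} -> {for (x, y), continuous (fun q => 2 * Re (F (c q)))}.
  move=> cF; have cR : {for (x, y), continuous (fun q => Re (F (c q)))}.
    apply: (@continuous_comp _ _ _ (fun q => F (c q)) (@Re R)); last exact: continuous_Re.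
    by apply: (@continuous_comp _ _ _ c); [exact: continuous_toC|exact: cF].
  by apply: (cvgM _ cR); exact: cvg_cst.
have ci (F : C -> C) : {for c (x, y), continuous F} -> {for c (x, y), continuous (fun z => 'i * F z : C)}.
  by move=> cF; apply: (cvgM _ cF); exact: cvg_cst.
have px := pathder_comp (c := fun s => c (s, y)) (c_x (x, y)) nm1.
have py := pathder_comp (c := fun s => c (x, s)) (c_y (x, y)) nm_i.
split; last by rewrite mulrA -expr2 sqr_i mulN1r raddfN mulrN subrr.
split; split.
- by apply: (is_derive_eq (dlog _ _ _ (px _ _ _ d1) g0)); rewrite scale1r.
- apply: (is_derive_eq (dlog _ _ _ (py _ _ _ d1) g0)); congr (2 * Re _).
  by rewrite [_ *: _]/GRing.scale /= -mulrA.
- by apply: (is_deriveZ 2 (pathder_Re _)); have := px _ _ _ dQ; rewrite scale1r.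
- by apply: (is_deriveZ 2 (pathder_Re _)); exact: (py _ _ _ diQ).
- have cg2 : {for c (x, y), continuous (fun z => nm (g z))}.
    by apply: (@continuous_comp _ _ _ g); [exact: c0|exact: continuous_nm].
  have cn : {for (x, y), continuous (fun q => nm (g (c q)))}.
    by apply: (@continuous_comp _ _ _ c (fun z : C => nm (g z))); [exact: continuous_toC|exact: cg2].
  apply: (@continuous_comp _ _ _ (fun q => nm (g (c q)) ^+ 2) (@ln R)); first exact: (cvgM cn cn).
  by apply: continuous_ln; rewrite exprn_gt0// nm_gt0.
- exact: (cRe Q cQ).
- exact: (cRe (fun z => 'i * Q z) (ci Q cQ)).
- exact: (cRe Q1 cQ1).
- exact: (cRe (fun z => 'i * ('i * Q1 z)) (ci (fun z => 'i * Q1 z) (ci Q1 cQ1))).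
Qed.

End PathDerivative.

(** * Wirtinger derivatives and the Laplacian *)

Section Curvature.
Context {R : realType}.
Local Notation C := (cplx R).
Local Notation Re := complex.Re.
Local Notation Im := complex.Im.

Lemma d_z_toC (h : C -> R) hx hy hxx hyy (p : R * R) :
  smooth_at (fun q => h (toC q)) hx hy hxx hyy p ->
  d_z (fun z => (h z)%:C) (toC p) = (hx p / 2) +i* (- (hy p / 2)).
Proof.
move=> [[[_ d1] [_ d2] _ _] _].
have Px : partial_x (fun z => (h z)%:C) (toC p) = (hx p)%:C.
  by rewrite /partial_x /= derive1_cst derive1E d1.
have Py : partial_y (fun z => (h z)%:C) (toC p) = (hy p)%:C.
  by rewrite /partial_y /= derive1_cst derive1E d2.
rewrite /d_z Px Py; have -> : (2 : C)^-1 = (2^-1 : R)%:C by rewrite fmorphV rmorph_nat.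
by apply: complex_inj; rewrite /=; ring.
Qed.

(** The identity d_zbar d_z = Laplacian / 4. Only the real part is taken, since the imaginary part
    is a difference of mixed derivatives, about which [has_lap] says nothing; [c1_density] is a real
    part as well. *)
Lemma Re_d_zbar_d_z (h : C -> R) L (p : R * R) : has_lap (fun q => h (toC q)) L p ->
  Re (d_zbar (d_z (fun z => (h z)%:C)) (toC p)) = L p / 4.
Proof.
move=> [hx [hy [hxx [hyy sm]]]]; have [[[_ _ d3 d4] _] <-] := nbhs_singleton sm.
have dE : \forall q \near p, d_z (fun z => (h z)%:C) (toC q) = (hx q / 2) +i* (- (hy q / 2)).
  by apply: filterS sm => q [sq _]; exact: d_z_toC sq.
set F := d_z _ in dE *.
have X : Re (partial_x F (toC p)) = hxx p / 2.
  transitivity (derive1 (fun t => Re (F (t +i* p.2))) p.1); first by [].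
  rewrite derive1E; have d3' := is_deriveZ 2^-1 d3.
  have : is_derive p.1 1 (fun t => Re (F (t +i* p.2))) (2^-1 *: hxx p).
    apply: is_derive_near_eq d3'; apply: filterS (near_fst dE) => t E.
    by rewrite -[t +i* _]/(toC (t, p.2)) E /= mulrC.
  by case=> _ ->; rewrite mulrC.
have Y : Im (partial_y F (toC p)) = - (hyy p / 2).
  transitivity (derive1 (fun t => Im (F (p.1 +i* t))) p.2); first by [].
  rewrite derive1E; have d4' := is_deriveZ (- 2^-1) d4.
  have : is_derive p.2 1 (fun t => Im (F (p.1 +i* t))) (- 2^-1 *: hyy p).
    apply: is_derive_near_eq d4'; apply: filterS (near_snd dE) => t E.
    by rewrite -[_ +i* t]/(toC (p.1, t)) E /= mulrC; exact: mulNr.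
  by case=> _ ->; rewrite [LHS]mulNr mulrC.
rewrite /d_zbar; have -> : (2 : C)^-1 = (2^-1 : R)%:C by rewrite fmorphV rmorph_nat.
rewrite mulrC ReZ ReD X [X in _ + X](_ : _ = - Im (partial_y F (toC p))); last first.
  by rewrite mulrC ReiNIm.
rewrite Y opprK.
by field.
Qed.

End Curvature.

(** * Sections, frames and curvature of F *)

Section Bundle.
Context {R : realType} {H : completeNormedModType R[i]}.
Local Notation C := (cplx R).
Local Notation Re := complex.Re.
Local Notation Im := complex.Im.
Variable ip : {dot H for (@conjc R)}.
Hypothesis ip_norm : forall x : H, ip x x = `|x| ^+ 2.
Variable T : linear_operator H.
Hypothesis T_entire : entire_class ip T.

Lemma conjCE (z : C) : Num.conj z = conjc z. Proof. by []. Qed.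

Lemma Ffib0 (z : C) phi : Ffib ip T z phi -> phi 0 = 0.
Proof.
move=> [lin out]; have [F0|/out//] := pselect (Fdag ip T z 0).
have := lin 1 0 0 F0 F0; rewrite scaler0 addr0 conjCE rmorph1 mul1r => /eqP.
by rewrite -subr_eq0 opprD addrA subrr sub0r oppr_eq0 => /eqP.
Qed.

Lemma Fdag0 (z : C) : Fdag ip T z 0. Proof. exact: (Efib_subspace ip T _).1. Qed.

Lemma FfibZ (z : C) phi (a : C) u : Ffib ip T z phi -> Fdag ip T z u ->
  phi (a *: u) = conjc a * phi u.
Proof.
move=> Fp Fu; have [lin _] := Fp.
by rewrite -[a *: u]addr0 lin ?(Ffib0 Fp) ?addr0//; exact: Fdag0.
Qed.

Lemma Fdag_span (z : C) V w : Fdag ip T z V -> V != 0 -> Fdag ip T z w -> exists a : C, w = a *: V.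
Proof. by move=> FV V0 Fw; exact: (Efib_dim1 ip_norm T_entire FV V0 Fw). Qed.

(** The fibre is the line spanned by [V], so the supremum is attained at V / |V|. *)
Lemma dual_norm_span (z : C) phi V : Ffib ip T z phi -> Fdag ip T z V -> V != 0 ->
  dual_norm ip T z phi = nm (phi V) / nm V.
Proof.
move=> Fp FV V0; have Vp : 0 < nm V by rewrite nm_gt0.
rewrite /dual_norm; set S := (X in sup X).
have ubS : ubound S (nm (phi V) / nm V).
  move=> _ [w [/= Fw w1] <-]; have [a wE] := Fdag_span FV V0 Fw.
  have {}w1 : nm a * nm V <= 1 by rewrite -nmZ -wE; move: w1; rewrite nmE -(rmorph1 (real_complex R)) lecR.
  suff : nm (phi w : C) <= nm (phi V : C) / nm V by [].
  rewrite wE (FfibZ a Fp FV) nmM nm_conj ler_pdivlMr// mulrAC -[leRHS]mul1r.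
  by rewrite ler_wpM2r ?nm_ge0.
have Sm : S (nm (phi V) / nm V).
  have Fw : Fdag ip T z ((nm V)^-1%:C *: V) by exact: subspaceZ (Efib_subspace ip T _) FV.
  exists ((nm V)^-1%:C *: V); first split=> //.
    by rewrite nmE nmZ nm_real ger0_norm ?invr_ge0 ?nm_ge0// mulVf ?gt_eqF.
  suff : nm (phi ((nm V)^-1%:C *: V) : C) = nm (phi V : C) / nm V by [].
  rewrite (FfibZ _ Fp FV) nmM nm_conj nm_real ger0_norm ?invr_ge0 ?nm_ge0//.
  by rewrite mulrC.
apply/eqP; rewrite eq_le; apply/andP; split; first by apply: ge_sup => //; exists (nm (phi V) / nm V).
by apply: ub_le_sup => //; exists (nm (phi V) / nm V).
Qed.

(** The conjugation of the argument and the conjugate linearity in the second variable compensate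
    each other. *)
Lemma is_derive_ip_conj (v : C -> H) (x : H) (z : C) dv : is_derive (conjc z : C) (1 : C) v dv ->
  is_derive z (1 : C) (fun z => ip x (v (conjc z)) : C) (ip x dv : C).
Proof.
move=> dV; apply/is_derive_nm => e e0; have n0 : 0 < nm x + 1 by rewrite ltr_wpDl ?nm_ge0.
have /near_nm[d d0 D] := (is_derive_nm _ _ _).1 dV _ (divr_gt0 e0 n0).
apply/near_nm; exists d => // y yz.
have E : nm (conjc y - conjc z : C) = nm (y - z) by rewrite -rmorphB nm_conj.
have := D (conjc y); rewrite E => /(_ yz) h.
have -> : ip x (v (conjc y)) - ip x (v (conjc z)) - (y - z) *: (ip x dv : C) =
    ip x (v (conjc y) - v (conjc z) - (conjc y - conjc z) *: dv) :> C.
  by rewrite !(ipBr ip) (ipZr ip) -rmorphB conjcK.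
apply: le_trans (cauchy_schwarz ip_norm _ _) _.
apply: le_trans (ler_wpM2l (nm_ge0 _) h) _.
rewrite mulrA ler_wpM2r ?nm_ge0// mulrCA ger_pMr// ler_pdivrMr// mul1r lerDl.
exact: ler01.
Qed.

Lemma Ffib_hat (x : H) (z : C) : Ffib ip T z (hat ip T x z).
Proof.
split=> [a u v Fu Fv|w nFw]; last by rewrite /hat patchC// inE.
have Fuv : Fdag ip T z (a *: u + v) by exact: (Efib_subspace ip T _).2.
by rewrite /hat !patchE !mem_set// (ipDr ip) (ipZr ip).
Qed.

Lemma hatE (x : H) (z : C) w : Fdag ip T z w -> hat ip T x z w = ip x w.
Proof. by move=> Fw; rewrite /hat patchE mem_set. Qed.

Lemma Fholo_hat (U : set C) (x : H) : open U -> Fholo ip T U (hat ip T x).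
Proof.
move=> oU; split; [exact: oU|move=> l _; exact: Ffib_hat|move=> V v [oV Ev] l Ul Vl].
have [_ /derivableP dv] := Ev _ Vl.
have [dx _] : is_derive l (1 : C) (fun z => hat ip T x z (v (conjc z)) : C) (ip x ('D_1 v (conjc l)) : C).
  apply: is_derive_near_eq (is_derive_ip_conj x dv).
  have nV : \forall z \near l, V (conjc z).
    exact: (near_continuous (@continuous_conj R l) (open_nbhs_nbhs (conj oV Vl))).
  by apply: filterS nV => z Vz; rewrite hatE//; have [] := Ev _ Vz.
exact: dx.
Qed.

Lemma Fholo_mul (U : set C) (g : C -> C) sigma : Fholo ip T U sigma -> (forall z, U z -> derivable g z 1) ->
  Fholo ip T U (fun z w => g z * sigma z w).
Proof.
move=> [oU Fs ds] dg; split; [exact: oU|move=> l Ul|move=> V v Ev l Ul Vl].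
  have [lin out] := Fs l Ul; split=> [a u w Fu Fw|w /out ->]; last by rewrite mulr0.
  by rewrite lin// mulrDr mulrCA.
have dsl := ds V v Ev l Ul Vl.
exact: (@derivableM R[i] C g (fun z => sigma z (v (conjc z))) l 1 (dg l Ul) dsl).
Qed.

Definition nball (z0 : C) (d : R) : set C := [set z | nm (z - z0) < d].

(* [F x m z = (x, A^m v(conj z))], so that [F x 0] is [hat x] read in the frame. *)
Lemma bundle_frame (z0 : C) : exists (d : R) (e : H) (v : C -> H) (F : H -> nat -> C -> C) (K : H -> R),
  [/\ [/\ 0 < d, e != 0 & Eholo ip T (nball (conjc z0) d) v],
    forall z, nball z0 d z -> [/\ Fdag ip T z (v (conjc z)), v (conjc z) != 0 &
      ip e (v (conjc z)) = ((nm e) ^+ 2)%:C],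
    forall x z, F x 0%N z = ip x (v (conjc z)),
    forall x m z, nball z0 d z -> [/\ F x m z = F x m z0 + (z - z0) * F x m.+1 z,
      nm (z - z0) ^+ m * nm (F x m z) <= 2^-1 ^+ m * K x & derivable (F x m) z 1] &
    forall p, nball z0 d (toC p) -> exists L, has_lap (fun q => ln (nm (v (conjc (toC q))) ^+ 2)) L p].
Proof.
have [d [K [e [w [v1 [v2 [d0 [e0 we] wE wF dv]]]]]]] := local_frame ip_norm T_entire (conjc z0).
have cb z : nball z0 d z -> nm (conjc z - conjc z0 : C) < d by rewrite -rmorphB nm_conj.
have wn (l : C) : nm (l - conjc z0 : C) < d -> w 0%N l != 0.
  move=> /wE[_ we2]; apply: contraNneq e0 => w0; move: we2; rewrite w0 (ip0l ip) => /esym/eqP.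
  by rewrite fmorph_eq0 sqrf_eq0 nm_eq0.
exists d, e, (w 0%N), (fun x m z => ip x (w m (conjc z))), (fun x => nm x * K); split.
- split; [exact: d0|exact: e0|split; first exact: open_nm].
  by move=> l ld; have [El _] := wE l ld; split=> //; have [[dw _] _ _] := dv l ld.
- move=> z zd; have [Ez we2] := wE _ (cb z zd); split; [exact: Ez|exact: wn (cb z zd)|].
  by rewrite (ipC ip) we2 conjc_real.
- by [].
- move=> x m z zd; have [E1 E2 [dw dwE]] := wF m _ (cb z zd); split.
  + by rewrite {1}E1 (ipDr ip) (ipZr ip) -rmorphB conjcK.
  + have -> : nm (z - z0) = nm (conjc z - conjc z0 : C) by rewrite -rmorphB nm_conj.
    apply: le_trans (_ : nm x * (nm (conjc z - conjc z0 : C) ^+ m * nm (w m (conjc z))) <= _).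
      by rewrite mulrCA ler_wpM2l ?exprn_ge0 ?nm_ge0//; exact: cauchy_schwarz.
    by rewrite [leRHS]mulrCA ler_wpM2l ?nm_ge0.
  + by have [dx _] := is_derive_ip_conj x dwE.
- move=> p pd; apply: (@has_lap_sqnorm _ _ _ ip_norm (w 0%N) v1 v2); last exact: wn (cb _ pd).
  have oN := @open_nm R C (conjc z0) d; apply: filterS (open_nbhs_nbhs (conj oN (cb _ pd))) => l ld.
  exact: dv.
Qed.

Section AtFrame.
Variables (z0 : C) (d : R) (e : H) (v : C -> H).
Hypothesis d0 : 0 < d.
Hypothesis e0 : e != 0.
Hypothesis Ev : Eholo ip T (nball (conjc z0) d) v.
Hypothesis vF : forall z, nball z0 d z -> [/\ Fdag ip T z (v (conjc z)), v (conjc z) != 0 &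
      ip e (v (conjc z)) = ((nm e) ^+ 2)%:C].
Hypothesis vlap : forall p, nball z0 d (toC p) ->
  exists L, has_lap (fun q => ln (nm (v (conjc (toC q))) ^+ 2)) L p.

Lemma nball_conj z : nball z0 d z -> nball (conjc z0) d (conjc z).
Proof. by rewrite /nball /= -rmorphB nm_conj. Qed.

Lemma open_nball (z1 : C) (r : R) : open (nball z1 r). Proof. exact: open_nm. Qed.

Lemma near_nball z : nball z0 d z -> \forall y \near z, nball z0 d y.
Proof. by move=> zd; apply: open_nbhs_nbhs; split; [exact: open_nball|]. Qed.

Lemma frame_coord U sigma z : Fholo ip T U sigma -> U z -> nball z0 d z ->
  derivable (fun y => sigma y (v (conjc y)) : C) z 1.
Proof. by move=> [_ _ ds] Uz zd; exact: (ds _ _ Ev z Uz (nball_conj zd)). Qed.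

Lemma frame_coord_neq0 (phi : H -> C) z : nball z0 d z -> Ffib ip T z phi -> phi <> cst 0 ->
  phi (v (conjc z)) != 0.
Proof.
move=> zd Fp; apply: contra_notN => /eqP p0; apply/funext => w.
have [Fv vn _] := vF zd; have [Fw|nFw] := pselect (Fdag ip T z w); last by rewrite Fp.2.
by have [a ->] := Fdag_span Fv vn Fw; rewrite (FfibZ a Fp Fv) p0 mulr0.
Qed.

(** The product (e, v) has the nonzero constant value |e|^2, so this section has no zero on the
    ball. It shows that the set from which [curvature] chooses is inhabited. *)
Lemma hat_frame : Fframe ip T (nball z0 d) (hat ip T e).
Proof.
split; first by apply: Fholo_hat; exact: open_nball.
move=> z zd /(congr1 (@^~ (v (conjc z)))); have [Fv vn ev] := vF zd.
rewrite hatE// ev => /eqP; rewrite fmorph_eq0 sqrf_eq0 nm_eq0; exact/negP.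
Qed.

Let vn2 (q : R * R) := ln (nm (v (conjc (toC q))) ^+ 2).
Let lap q := px (px vn2) q + py (py vn2) q.

Lemma frame_lap p : nball z0 d (toC p) -> has_lap vn2 lap p.
Proof.
move=> /vlap[L Lh]; apply: (has_lap_eq _ _ Lh); first exact: near_all.
by apply: filterS (has_lap_smooth Lh) => q [_ <-].
Qed.

Lemma frame_lnE (phi : H -> C) z : nball z0 d z -> Ffib ip T z phi -> phi <> cst 0 ->
  ln (dual_norm ip T z phi ^+ 2) = ln (nm (phi (v (conjc z))) ^+ 2) + -1 * ln (nm (v (conjc z)) ^+ 2).
Proof.
move=> zd Fp p0; have [Fv vn _] := vF zd.
have pn : 0 < nm (phi (v (conjc z))) by rewrite nm_gt0; exact: frame_coord_neq0.
have vp : 0 < nm (v (conjc z)) by rewrite nm_gt0.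
by rewrite (dual_norm_span Fp Fv vn) expr_div_n ln_div ?posrE ?exprn_gt0// mulN1r.
Qed.

Lemma Re_curvature p : nball z0 d (toC p) -> Re (curvature ip T (toC p)) = - lap p / 4.
Proof.
move=> pd; rewrite /curvature; set S := (X in xget _ X).
(* The frame selected by [xget] is unknown, so the value is computed for an arbitrary frame [sigma]:
   its coordinate sigma(v) is holomorphic without zeros and adds only a harmonic term to -ln
   |v|^2. *)
have : S (xget 0 S) by apply: xgetPex; eexists; exists (nball z0 d), (hat ip T e); split; [exact: hat_frame|exact: pd|reflexivity].
move: (xget 0 S) => K [U [sigma [[Fs s0] Up ->]]].
have [oU Ff _] := Fs; have cp := @continuous_toC R p.
have nU : \forall z \near toC p, U z /\ nball z0 d z.
  by apply: filterI (near_nball pd); exact: open_nbhs_nbhs.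
have Uq : \forall q \near p, U (toC q) /\ nball z0 d (toC q) by exact: (near_continuous cp nU).
have := has_lapD (has_lap_ln_holo (g := fun z => sigma z (v (conjc z))) (p := p) _ _) (has_lapZ (-1) (frame_lap pd)).
move=> hl; rewrite (Re_d_zbar_d_z (L := fun q => 0 + -1 * lap q)) ?add0r ?mulN1r//.
apply: has_lap_eq (hl _ _); [|exact: near_all| |].
- by apply: filterS Uq => q [Uq qd]; rewrite frame_lnE//; [exact: Ff|exact: s0].
- by apply: filterS nU => z [Uz zd]; exact: frame_coord Fs Uz zd.
- by apply: frame_coord_neq0; [exact: pd|exact: Ff|exact: s0].
Qed.

(** The factor i / (2 pi) times 2i is -1 / pi, and the real part of the curvature is - [lap] / 4;
    together they give the factor 4 pi. *)
Lemma c1_density_frame p : nball z0 d (toC p) ->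
  has_lap (fun q => -1 * vn2 q) (fun q => - (4 * pi) * c1_density ip T (toC q)) p.
Proof.
move=> pd; apply: has_lap_eq (has_lapZ (-1) (frame_lap pd)); first exact: near_all.
apply: filterS (near_continuous (@continuous_toC R p) (near_nball pd)) => q qd.
rewrite /c1_density (_ : _ * _ = (- pi^-1)%:C * curvature ip T (toC q)); last first.
  move: (curvature _ _ _) => K; have E : (2 : R[i]) / (2 * pi)%:C = (pi^-1)%:C.
    rewrite -(rmorph_nat (real_complex R)) -fmorphV -rmorphM; congr (_%:C).
    by rewrite invfM mulrA divff// mul1r.
  have -> : 'i%C / (2 * pi)%:C * K * (2 * 'i%C) = ('i%C * 'i%C) * (2 / (2 * pi)%:C) * K by ring.
  by rewrite E -expr2 sqr_i rmorphN mulN1r.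
rewrite ReZ Re_curvature//; have p0 : (pi : R) != 0 by rewrite gt_eqF// pi_gt0.
by move: (pi : R) p0 => P P0; field.
Qed.

End AtFrame.
End Bundle.

(** * Zeros of sections *)

Section Zeros.
Context {R : realType} {H : completeNormedModType R[i]}.
Local Notation C := (cplx R).
Local Notation Re := complex.Re.
Local Notation Im := complex.Im.
Variable ip : {dot H for (@conjc R)}.
Hypothesis ip_norm : forall x : H, ip x x = `|x| ^+ 2.
Variable T : linear_operator H.
Hypothesis T_entire : entire_class ip T.

Lemma is_derive_affine (a b z : C) : is_derive z (1 : C) (fun z => a * z + b : C) a.
Proof.
apply/is_derive_nm => e e0; apply: near_all => y.
have -> : (a * y + b) - (a * z + b) - (y - z) *: a = 0 :> C by rewrite [_ *: _]/GRing.scale /=; ring.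
by rewrite nm0 mulr_ge0 ?nm_ge0// ltW.
Qed.

Lemma continuous_subl (l z : C) : {for z, continuous (fun z : C => z - l : C)}.
Proof.
have c1 := is_derive_continuous (is_derive_affine 1 (- l) z).
by apply: continuous_near_eq c1; apply: near_all => y; rewrite mul1r.
Qed.

Lemma toC_inj : injective (@toC R).
Proof. by move=> [a b] [a' b'] [-> ->]. Qed.

Definition ofC (z : C) : R * R := (Re z, Im z).

Lemma ofCK z : toC (ofC z) = z. Proof. by case: z. Qed.
Lemma toCK p : ofC (toC p) = p. Proof. by case: p. Qed.

Lemma continuous_ofC : continuous ofC.
Proof. by move=> z; apply: continuous_pair; [exact: continuous_Re|exact: continuous_Im]. Qed.

Lemma eq0_of_le_pow (a K : R) : 0 <= a -> (forall m, a <= 2^-1 ^+ m * K) -> a = 0.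
Proof.
move=> a0 aK; apply: contrapT => /eqP an; have ap : 0 < a by rewrite lt_def an.
have := aK (Num.truncn (K / a)).+1; set m := _.+1; apply/negP; rewrite -ltNge.
rewrite exprVn mulrC ltr_pdivrMr ?exprn_gt0// mulrC -ltr_pdivrMr//.
apply: lt_le_trans (truncnS_gt _) _; rewrite -/m -natrX ler_nat.
by apply: ltnW; exact: ltn_expl.
Qed.

Definition zero_order (s : C -> H -> C) (l : C) (m : nat) : Prop :=
  exists U tau, [/\ Fholo ip T U tau, U l, tau l <> cst 0 &
    forall z, U z -> forall w, s z w = (z - l) ^+ m * tau z w].

Lemma near_exists_neq (l : C) (P : set C) : (\forall z \near l, P z) -> exists2 z, z != l & P z.
Proof.
move=> /near_nm[d d0 dP]; exists (l + (d / 2)%:C).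
  by rewrite -subr_eq0 addrAC subrr add0r fmorph_eq0 gt_eqF ?divr_gt0.
by apply: dP; rewrite addrAC subrr add0r nm_real gtr0_norm ?divr_gt0//; lra.
Qed.

Lemma derivable_continuousC (g : C -> C) (z : C) : derivable g z 1 -> {for z, continuous g}.
Proof. by move=> dg; exact: (is_derive_continuous (derivableP dg)). Qed.

(** If m < m', cancelling (z - l)^m at points z <> l gives tau = (z - l)^(m' - m) tau' there. Read
    in a local frame, continuity would then force tau to vanish at [l]. *)
Lemma zero_order_le (s : C -> H -> C) (l : C) m m' : zero_order s l m -> zero_order s l m' -> (m' <= m)%N.
Proof.
move=> [U [tau [Ft Ul t0 sE]]] [U' [tau' [Ft' Ul' t0' sE']]]; rewrite leqNgt; apply/negP => mm'.
have [d [e [v [F [K [[d0 e0 Ev] vF _ _ _]]]]]] := bundle_frame ip_norm T_entire l.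
have ld : nball l d l by rewrite /nball /= subrr nm0.
pose g z : C := tau z (v (conjc z)); pose g' z : C := tau' z (v (conjc z)).
have dg : derivable g l 1 := frame_coord Ev Ft Ul ld.
have dg' : derivable g' l 1 := frame_coord Ev Ft' Ul' ld.
have [_ Ff _] := Ft.
have gl : g l != 0 by exact: (frame_coord_neq0 ip_norm T_entire vF ld (Ff l Ul) t0).
pose D z : C := g z - (z - l) ^+ (m' - m) * g' z.
have cX n : {for l, continuous (fun z : C => (z - l) ^+ n : C)}.
  elim: n => [|n IH].
    have c1 : {for l, continuous (fun=> 1 : C)} := @cst_continuous C C 1 l.
    by apply: continuous_near_eq c1; apply: near_all => z; rewrite expr0.
  have -> : (fun z : C => (z - l) ^+ n.+1 : C) = (fun z => (z - l) * (z - l) ^+ n).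
    by apply/funext => z; rewrite exprS.
  have c1 : {for l, continuous (fun z : C => z - l : C)} by exact: continuous_subl.
  exact: (cvgM c1 IH).
have cD : {for l, continuous D}.
  exact: (cvgB (derivable_continuousC dg) (cvgM (cX (m' - m)%N) (derivable_continuousC dg'))).
have Dl : D l != 0 by rewrite /D subrr expr0n subn_eq0 leqNgt mm' mul0r subr0.
have [oU _ _] := Ft; have [oU' _ _] := Ft'.
have nU := open_nbhs_nbhs (conj oU Ul); have nU' := open_nbhs_nbhs (conj oU' Ul').
have [z zl [Dz [Uz Uz']]] := near_exists_neq (filterI (near_neq0 cD Dl) (filterI nU nU')).
move/negP: Dz; apply; rewrite /D subr_eq0; apply/eqP.
have zl0 : (z - l) ^+ m != 0 by rewrite expf_neq0// subr_eq0.
by apply: (mulfI zl0); rewrite mulrA -exprD subnKC 1?ltnW// -[RHS]sE'// sE.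
Qed.

Lemma zero_multE s l m : zero_order s l m -> zero_mult ip T s l = m.
Proof.
move=> sm; apply: xget_unique => [//|m' sm'].
by apply/eqP; rewrite eqn_leq; apply/andP; split; [exact: zero_order_le sm sm'|exact: zero_order_le sm' sm].
Qed.

Variable x : H.
Let s := hat ip T x.
Local Notation mult := (zero_mult ip T s).
Local Notation dn z := (dual_norm ip T z (s z) ^+ 2).

Lemma mult_neq0 z : s z <> cst 0 -> mult z = 0%N.
Proof.
move=> sz; apply: zero_multE; exists setT, s; split=> //; first by apply: Fholo_hat => //; exact: openT.
by move=> y _ w; rewrite expr0 mul1r.
Qed.

(** The numbers [F x j l] act as Taylor coefficients of the section in the frame. If all were zero,
    the bound 2^-m K on the remainders would make the section vanish near [l]. Otherwise the first
    nonzero index is the multiplicity m, the coordinate is (z - l)^m times the zero-free [F x m],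
    and [k] is ln |F x m|^2 - ln |v|^2. *)
Lemma local_factor (p : R * R) : (~ \forall z \near toC p, s z = cst 0) -> exists k : R * R -> R,
  [/\ has_lap k (fun q => - (4 * pi) * c1_density ip T (toC q)) p,
    (mult (toC p) != 0%N -> s (toC p) = cst 0) &
    \forall q \near p, q != p \/ mult (toC p) = 0%N -> s (toC q) <> cst 0 /\
      ln (dn (toC q)) = k q + (mult (toC p))%:R * ln (nm (toC q - toC p) ^+ 2)].
Proof.
set l := toC p => nz.
have [d [e [v [F [K [[d0 e0 Ev] vF F0 FS vlap]]]]]] := bundle_frame ip_norm T_entire l.
have ld : nball l d l by rewrite /nball /= subrr nm0.
have Fm z m : nball l d z -> (forall j, (j < m)%N -> F x j l = 0) -> F x 0%N z = (z - l) ^+ m * F x m z.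
  move=> zd; elim: m => [|m IH] Fj; first by rewrite expr0 mul1r.
  rewrite IH; last by move=> j jm; apply: Fj; exact: ltnW.
  by have [-> _ _] := FS x m z zd; rewrite Fj// add0r exprSr mulrA.
have sV z : nball l d z -> s z (v (conjc z)) = F x 0%N z.
  by move=> zd; have [Fv _ _] := vF z zd; rewrite /s hatE// F0.
have ex_m : exists m, F x m l != 0.
  apply: contra_notP nz => nF; have F0l j : F x j l = 0.
    by apply/eqP/negP => Fj; apply: nF; exists j; apply/negP.
  apply: filterS (near_nball ld) => z zd; apply: contrapT => sz.
  have : s z (v (conjc z)) != 0 := frame_coord_neq0 ip_norm T_entire vF zd (Ffib_hat ip T x z) sz.
  rewrite sV//; apply/negP/negPn.
  rewrite -nm_eq0; apply/eqP/(@eq0_of_le_pow _ (K x) (nm_ge0 _)) => m.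
  have [_ Fle _] := FS x m z zd; apply: le_trans Fle.
  by rewrite (Fm z m zd)// nmM nmX.
pose m := ex_minn ex_m; have Fml : F x m l != 0 by rewrite /m; case: ex_minnP.
have Fj j : (j < m)%N -> F x j l = 0.
  rewrite /m; case: ex_minnP => n _ nmin jn; apply/eqP; apply: contraTT jn => /nmin.
  by rewrite -leqNgt.
have FE z : nball l d z -> F x 0%N z = (z - l) ^+ m * F x m z by move=> zd; exact: Fm.
have dFm z : nball l d z -> derivable (F x m) z 1 by move=> zd; have [] := FS x m z zd.
have mE : mult l = m.
  (* The section of [e] has the constant coordinate |e|^2 in the frame, whence the division by
     it. *)
  apply: zero_multE; exists (nball l d), (fun z w => F x m z / ((nm e) ^+ 2)%:C * hat ip T e z w).
  have e2 : ((nm e) ^+ 2)%:C != 0 :> R[i] by rewrite fmorph_eq0 sqrf_eq0 nm_eq0.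
  split; [|exact: ld| |].
  - apply: Fholo_mul; first by apply: (Fholo_hat ip_norm); exact: open_nball.
    move=> z zd; have c1 : derivable (fun=> (((nm e) ^+ 2)%:C^-1 : C)) z 1 by exact: derivable_cst.
    exact: (@derivableM R[i] C (F x m) (fun=> (((nm e) ^+ 2)%:C^-1 : C)) z 1 (dFm z zd) c1).
  - move=> /(congr1 (@^~ (v (conjc l)))); have [Fv _ ev] := vF l ld.
    by rewrite hatE// ev divfK// => /eqP; apply/negP.
  - move=> z zd w; have [Fv vn ev] := vF z zd.
    have [Fw|nFw] := pselect (Fdag ip T z w); last by rewrite /s /hat !patchC ?inE// !mulr0.
    have [a ->] := Fdag_span ip_norm T_entire Fv vn Fw.
    rewrite /s (FfibZ a (Ffib_hat ip T x z) Fv) (FfibZ a (Ffib_hat ip T e z) Fv) !hatE// ev -F0 FE//.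
    by rewrite [_ / _ * _]mulrACA mulVf// mulr1 mulrCA [conjc a * F x m z]mulrC.
pose k (q : R * R) := ln (nm (F x m (toC q)) ^+ 2) + -1 * ln (nm (v (conjc (toC q))) ^+ 2).
exists k; split.
- have hl := has_lapD (has_lap_ln_holo (g := F x m) (p := p) _ Fml) (c1_density_frame ip_norm T_entire e0 Ev vF vlap ld).
  apply: has_lap_eq (hl _); [exact: near_all|by apply: near_all => q; rewrite add0r|].
  by apply: filterS (near_nball ld) => z; exact: dFm.
- rewrite mE => m0; apply: contrapT => sl.
  have : s l (v (conjc l)) != 0 := frame_coord_neq0 ip_norm T_entire vF ld (Ffib_hat ip T x l) sl.
  by rewrite sV// FE// subrr expr0n (negbTE m0) mul0r eqxx.
have nF : \forall z \near l, F x m z != 0 := near_neq0 (derivable_continuousC (dFm l ld)) Fml.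
have nq : \forall q \near p, nball l d (toC q) /\ F x m (toC q) != 0.
  exact: (near_continuous (@continuous_toC R p) (filterI (near_nball ld) nF)).
apply: filterS nq => q [qd Fq] qp; rewrite mE in qp *.
have F0q : F x 0%N (toC q) != 0.
  rewrite FE// mulf_neq0//; case: qp => [qp|->]; last by rewrite expr0 oner_eq0.
  rewrite expf_neq0// subr_eq0; apply: contra_neq qp; exact: toC_inj.
have sq : s (toC q) <> cst 0 by move=> s0; move: F0q; rewrite -sV// s0 eqxx.
split=> //; rewrite (frame_lnE ip_norm T_entire vF qd (Ffib_hat ip T x _) sq) -/s sV// FE// nmM nmX.
have Fp : 0 < nm (F x m (toC q)) by rewrite nm_gt0.
have ap : 0 < nm (toC q - l) ^+ m.
  by rewrite lt_def exprn_ge0 ?nm_ge0// andbT; move: F0q; rewrite FE// mulf_eq0 negb_or -nm_eq0 nmX => /andP[].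
rewrite exprMn lnM; [|rewrite posrE; exact: exprn_gt0 ap|rewrite posrE; exact: exprn_gt0 Fp].
rewrite /k -addrA addrC; congr (_ + _).
rewrite -exprM mulnC exprM mulrC mulr_natr.
case: (m) ap => [|j] ap; first by rewrite expr0 ln1 mulr0n.
have np : 0 < nm (toC q - l).
  rewrite lt_def nm_ge0 andbT; apply: contraTneq ap => ->; by rewrite expr0n ltxx.
have np2 := exprn_gt0 2 np; by apply: lnXn.
Qed.

(* The vanishing of the germ is locally constant along the segment joining two points. *)
Lemma not_locally_zero : (exists z, s z <> cst 0) -> forall l : C, ~ \forall z \near l, s z = cst 0.
Proof.
move=> [z1 sz1] l sl; pose c (t : R) : C := l + t%:C * (z1 - l).
have cc : continuous c.
  move=> t; have cl : {for t, continuous (fun=> l)} := @cst_continuous R C l t.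
  have cz : {for t, continuous (fun=> z1 - l : C)} := @cst_continuous R C (z1 - l) t.
  exact: (cvgD cl (cvgM (@continuous_ofR R t) cz)).
pose Q (z : C) := \forall y \near z, s y = cst 0.
(* The indicator of a vanishing germ, taken real-valued so that local constancy becomes a zero
   derivative and yields phi 0 = phi 1. *)
pose phi (t : R) : R := (`[< Q (c t) >])%:R.
have phiT t : Q (c t) -> phi t = 1 by move=> h; rewrite /phi (asboolT h).
have phiF t : ~ Q (c t) -> phi t = 0 by move=> h; rewrite /phi (asboolF h).
have phi_loc t : \forall r \near t, phi r = phi t.
  have [Qt|nQt] := pselect (Q (c t)).
    apply: filterS (near_continuous (cc t) (near_near Qt)) => r Qr.
    by rewrite (phiT r Qr) (phiT t Qt).
  have [k [_ _ nk]] := @local_factor (ofC (c t)) (eq_ind_r (fun z => ~ Q z) nQt (ofCK (c t))).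
  have nr := near_continuous (cc t) (near_continuous (@continuous_ofC (c t)) nk).
  apply: filterS nr => r Hr; rewrite (phiF t nQt); apply: phiF.
  have [-> //|crt] := eqVneq (c r) (c t); move=> /nbhs_singleton.
  have [|sr _] := Hr; last by rewrite ofCK in sr.
  by left; apply: contra_neq crt => /(congr1 (@toC R)); rewrite !ofCK.
have dphi t : is_derive t (1 : R) phi 0.
  apply/is_derive_ler => e e0; apply: filterS (phi_loc t) => r ->.
  by rewrite subrr scaler0 subrr normr0 mulr_ge0// ltW.
have c0 : c 0 = l by rewrite /c mul0r addr0.
have c1 : c 1 = z1 by rewrite /c mul1r addrC subrK.
have : phi 0 = phi 1 by exact: (is_derive_0_is_cst _ _ dphi).
rewrite phiT ?phiF; first by move/eqP; rewrite oner_eq0.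
  by rewrite c1 => /nbhs_singleton.
by rewrite c0.
Qed.

Hypothesis s_neq0 : exists z, s z <> cst 0.

Lemma mult_near (l : C) : \forall z \near l, mult z != 0%N -> z = l.
Proof.
have [k [_ _ nk]] := @local_factor (ofC l) (eq_ind_r (fun z => ~ \forall y \near z, s y = cst 0)
  (@not_locally_zero s_neq0 l) (ofCK l)).
apply: filterS (near_continuous (@continuous_ofC l) nk) => z Hz mz; apply: contrapT => zl.
have [|] := Hz; first by left; apply: contra_not_neq zl => /(congr1 (@toC R)); rewrite !ofCK.
by rewrite ofCK => /mult_neq0 m0; rewrite m0 in mz.
Qed.

Lemma mult_eq0P z : mult z = 0%N -> s z <> cst 0.
Proof.
have [k [_ _ nk]] := @local_factor (ofC z) (eq_ind_r (fun z => ~ \forall y \near z, s y = cst 0)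
  (@not_locally_zero s_neq0 z) (ofCK z)).
move=> mz; have [|] := nbhs_singleton nk; first by right; rewrite ofCK.
by rewrite ofCK.
Qed.

(* [u] is [ln |s|^2] with the logarithmic poles removed at the zeros. *)
Lemma potential : exists u : C -> R,
  (forall z, s z <> cst 0 -> u z = ln (dn z)) /\
  forall l : C, exists2 k : R * R -> R,
    has_lap k (fun q => - (4 * pi) * c1_density ip T (toC q)) (ofC l) &
    \forall q \near ofC l, u (toC q) = k q + (mult l)%:R * ln (nm (toC q - l) ^+ 2).
Proof.
have exk (l : C) : exists k : R * R -> R,
    [/\ has_lap k (fun q => - (4 * pi) * c1_density ip T (toC q)) (ofC l),
    (mult l != 0%N -> s l = cst 0) &
    \forall q \near ofC l, q != ofC l \/ mult l = 0%N -> s (toC q) <> cst 0 /\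
      ln (dn (toC q)) = k q + (mult l)%:R * ln (nm (toC q - l) ^+ 2)].
  have := @local_factor (ofC l); rewrite !ofCK; apply.
  exact: (@not_locally_zero s_neq0 l).
have [K HK] := choice exk.
exists (fun z => if mult z == 0%N then ln (dn z) else K z (ofC z)); split.
  by move=> z /mult_neq0 ->; rewrite eqxx.
move=> l; have [hl ml nl] := HK l; exists (K l) => //.
apply: filterS nl => q Hq; have [ql|ql] := eqVneq q (ofC l).
  (* At q = l the convention [ln 0 = 0] removes the logarithmic term, so at a zero the assigned
     value [K l] agrees with the formula, which therefore holds on a full neighbourhood of [l]. *)
  rewrite ql ofCK subrr nm0 expr0n /= (ln0 (lexx _)) mulr0 addr0.
  case: eqVneq => // m0; have [|_] := Hq; first by right.
  by rewrite ql ofCK => ->; rewrite m0 mul0r addr0.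
have [|sq <-] := Hq; first by left.
by rewrite mult_neq0.
Qed.

(** Each point has a neighbourhood in which it is the only possible zero. Finitely many of these
    cover the closed disc, and every zero there is one of the chosen centres. *)
Lemma finite_zeros (r : R) : 0 <= r -> exists2 S : seq C, uniq S &
  forall z, (z \in S) = (nm z <= r) && (mult z != 0%N).
Proof.
move=> r0; have cK : compact (@toC R @` cdisc r).
  apply: continuous_compact; last exact: compact_cdisc.
  by apply: continuous_subspaceT; exact: continuous_toC.
rewrite (@compact_cover C) in cK.
pose f (a : C) : set C := [set z | mult z != 0%N -> z = a]^°.
have [|z _|D _ KD] := cK _ setT f; first by move=> a _; exact: open_interior.
  by exists z => //; exact: mult_near.
have nmr z : nm z <= r -> (@toC R @` cdisc r) z.
  by move=> zr; exists (ofC z); [rewrite /cdisc /= -nm_sqr ler_pXn2r ?nnegrE ?nm_ge0|exact: ofCK].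
exists (undup [seq z <- finmap.enum_fset D | (nm z <= r) && (mult z != 0%N)]).
  exact: undup_uniq.
move=> z; rewrite mem_undup mem_filter; apply/andP/idP => [[]//|h]; split=> //.
move/andP: h => [zr mz].
have [a Da /interior_subset fz] := KD _ (nmr z zr).
by rewrite (fz mz); exact: Da.
Qed.

End Zeros.

(** * Jensen's formula for sections *)

Section Counting.
Context {R : realType}.
Local Notation C := (cplx R).
Local Notation Re := complex.Re.
Local Notation Im := complex.Im.
Local Notation mu := (@lebesgue_measure R).

Lemma Rintegral_inv (b r : R) : 0 < b <= r ->
  mu.-integrable `]b, r] (EFin \o (fun t => t^-1)) /\ \int[mu]_(t in `]b, r]) t^-1 = ln r - ln b.
Proof.
move=> /andP[b0 br]; have ci : forall t, b <= t <= r -> {for t, continuous (fun t : R => t^-1)}.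
  by move=> t /andP[bt _]; apply: inv_continuous; rewrite gt_eqF// (lt_le_trans b0).
have ii := continuous_itv_integrable ci.
have i2 : mu.-integrable `]b, r] (EFin \o (fun t => t^-1)).
  apply: (integrableS _ _ _ ii) => //.
  by move=> t /=; rewrite !in_itv /= => /andP[/ltW -> ->].
split=> //; rewrite (Rintegral_itv_obnd_cbnd i2); apply: Rintegral_FTC => // t /andP[bt _].
by apply: is_derive1_ln; exact: lt_le_trans bt.
Qed.

(** The count is a sum of indicators, and a zero [a] contributes its multiplicity times the integral
    of 1/t over ]|a|, r]. *)
Lemma Rintegral_step_sum (S : seq C) (m : C -> nat) (r : R) :
  (forall a, a \in S -> 0 < nm a <= r) ->
  \int[mu]_(t in `]0, r]) ((\sum_(a <- S | (nm a < t)%R) m a)%N%:R / t) =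
  \sum_(a <- S) (m a)%:R * (ln r - ln (nm a)).
Proof.
move=> Sr; pose F (a : C) := (fun t => t^-1) \_ `]nm a, r].
have Fint a : 0 < nm a <= r -> mu.-integrable `]0, r] (EFin \o F a) /\
    \int[mu]_(t in `]0, r]) F a t = ln r - ln (nm a).
  move=> ar; have [ia ea] := Rintegral_inv ar.
  have I : ([set` `]0, r]] `&` [set` `]nm a, r]] : set R) = [set` `]nm a, r]].
    apply/setIidr => t; rewrite /= !in_itv /= => /andP[at_ ->]; rewrite andbT.
    by apply: le_lt_trans at_; exact: nm_ge0.
  split; last by rewrite -Rintegral_mkcondr I.
  have mI : measurable ([set` `]0, r]] : set R) by exact: measurable_itv.
  have mJ : measurable ([set` `]nm a, r]] : set R) by exact: measurable_itv.
  by rewrite /F -restrict_EFin; apply/integrable_restrict => //; rewrite I.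
have FE a t : 0 < t <= r -> F a t = (nm a < t)%R%:R / t.
  move=> /andP[t0 tr]; rewrite /F patchE; case: ifPn => [|].
    by rewrite inE /= in_itv /= => /andP[-> _]; rewrite mul1r.
  by rewrite notin_setE /= in_itv /= tr andbT => /negP/negbTE ->; rewrite mul0r.
transitivity (\int[mu]_(t in `]0, r]) \sum_(a <- S) (m a)%:R * F a t).
  apply: eq_Rintegral => t; rewrite inE /= in_itv /= => tr.
  rewrite natr_sum mulr_suml big_mkcond; apply: eq_bigr => a _.
  by rewrite FE//; case: ifP; rewrite ?mul1r ?mul0r ?mulr0.
suff [_ //] : mu.-integrable `]0, r] (EFin \o (fun t => \sum_(a <- S) (m a)%:R * F a t)) /\
  \int[mu]_(t in `]0, r]) (\sum_(a <- S) (m a)%:R * F a t) = \sum_(a <- S) (m a)%:R * (ln r - ln (nm a)).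
have mI : measurable ([set` `]0, r]] : set R) by exact: measurable_itv.
elim: S Sr => [_|a S IH Sr].
  have E0 : (fun t => \sum_(a <- [::]) (m a)%:R * F a t) = (fun=> 0) by apply/funext => t; rewrite big_nil.
  rewrite E0 big_nil; split; first exact: integrable0.
  by rewrite Rintegral_cst// mul0r.
have [ia ea] := Fint a (Sr a (mem_head _ _)).
have [i2 e2] := IH (fun b bS => Sr b (mem_behead (s := a :: S) bS)).
have i1 : mu.-integrable `]0, r] (EFin \o (fun t => (m a)%:R * F a t)).
  exact: (@integrableZl _ _ _ mu _ mI (m a)%:R _ ia).
have ES : (fun t => \sum_(b <- a :: S) (m b)%:R * F b t) =
    (fun t => (m a)%:R * F a t + \sum_(b <- S) (m b)%:R * F b t).
  by apply/funext => t; rewrite big_cons.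
rewrite ES big_cons; split; first exact: (@integrableD _ _ _ mu _ mI _ _ i1 i2).
by rewrite RintegralD// e2 RintegralZl// ea.
Qed.

(** On [D] the function [g eta] exceeds [f] by at most a multiple of eta, uniformly. Nonnegativity
    and the bound on [f] belong to the notion so that it passes to products. *)
Definition perturb (I : Type) (D : set I) (f : I -> R) (g : R -> I -> R) : Prop :=
  exists2 K : R, 0 <= K & forall i eta, D i -> 0 <= eta <= 1 ->
    (0 <= f i <= K) /\ (0 <= g eta i <= f i + K * eta).

Lemma perturb1 (I : Type) (D : set I) : perturb D (fun=> 1) (fun _ _ => 1).
Proof.
exists 1 => // i eta _ /andP[e0 e1]; split; first by rewrite ler01 lexx.
by rewrite ler01 mul1r lerDl.
Qed.

(** Three cross terms, each at most K K' eta, the last one because eta^2 <= eta. *)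
Lemma perturbM (I : Type) (D : set I) f g f' g' : perturb D f g -> perturb D f' g' ->
  perturb D (fun i => f i * f' i) (fun eta i => g eta i * g' eta i).
Proof.
move=> [K K0 H] [K' K'0 H']; exists (3 * (K * K')); first by rewrite mulr_ge0// mulr_ge0.
move=> i eta Di ee; have [/andP[f0 fK] /andP[g0 gK]] := H i eta Di ee.
have [/andP[f'0 f'K] /andP[g'0 g'K]] := H' i eta Di ee; have /andP[e0 e1] := ee.
have KK : 0 <= K * K' by rewrite mulr_ge0.
have ff : f i * f' i <= K * K' by exact: ler_pM.
split; first by rewrite mulr_ge0//= (le_trans ff)//; lra.
rewrite mulr_ge0//=; apply: le_trans (ler_pM g0 g'0 gK g'K) _.
have h1 : f i * (K' * eta) <= K * K' * eta by rewrite mulrA ler_wpM2r// ler_wpM2r.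
have h2 : K * eta * f' i <= K * K' * eta by rewrite mulrAC ler_wpM2r// ler_wpM2l.
have h3 : K * eta * (K' * eta) <= K * K' * eta.
  by rewrite mulrACA ler_wpM2l// ler_piMr.
have -> : (f i + K * eta) * (f' i + K' * eta) =
  f i * f' i + f i * (K' * eta) + K * eta * f' i + K * eta * (K' * eta) by ring.
have -> : 3 * (K * K') * eta = K * K' * eta + K * K' * eta + K * K' * eta by ring.
lra.
Qed.

Lemma perturb_prod (I : Type) (J : eqType) (D : set I) (S : seq J) (m : J -> nat) (f : J -> I -> R) (g : J -> R -> I -> R) :
  (forall j, j \in S -> perturb D (f j) (g j)) ->
  perturb D (fun i => \prod_(j <- S) f j i ^+ m j) (fun eta i => \prod_(j <- S) g j eta i ^+ m j).
Proof.
have ext f1 f2 (g1 g2 : R -> I -> R) : f1 = f2 -> g1 = g2 -> perturb D f1 g1 -> perturb D f2 g2 by move=> -> ->.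
elim: S => [_|j S IH H].
  by apply: ext (perturb1 D); [apply/funext => i|apply/funext => e; apply/funext => i]; rewrite big_nil.
have HX n : perturb D (fun i => f j i ^+ n) (fun eta i => g j eta i ^+ n).
  elim: n => [|n IHn].
    by apply: ext (perturb1 D); [apply/funext => i|apply/funext => e; apply/funext => i]; rewrite expr0.
  apply: ext (perturbM (H j (mem_head _ _)) IHn); [apply/funext => i|apply/funext => e; apply/funext => i];
    by rewrite exprS.
apply: ext (perturbM (HX (m j)) (IH (fun k kS => H k (mem_behead (s := j :: S) kS)))).
  by apply/funext => i; rewrite big_cons.
by apply/funext => e; apply/funext => i; rewrite big_cons.
Qed.

(* The left-hand side is the modulus of [z - a] divided by the Blaschke factor of [a] for the disc
   of radius [rho]: unlike [z - a] it has no zero in that disc. *)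
Lemma blaschke_le (r rho : R) (a z : C) : 0 < r -> r <= rho -> nm z = r ->
  nm (rho%:C - conjc a * z / rho%:C : C) ^+ 2 <= nm (z - a) ^+ 2 + (rho ^+ 2 - r ^+ 2).
Proof.
move=> r0 rrho zr; have rho0 : 0 < rho by exact: lt_le_trans rrho.
have zr2 : nm z ^+ 2 = r ^+ 2 by rewrite zr.
rewrite -fmorphV !nm_sqr; move: zr2; rewrite nm_sqr.
case: a z {zr} => a1 a2 [z1 z2] /= zr2; rewrite -zr2.
have q1 : (z1 ^+ 2 + z2 ^+ 2) / rho ^+ 2 <= 1.
  by rewrite zr2 ler_pdivrMr ?exprn_gt0// mul1r ler_pXn2r ?nnegrE ?(ltW r0) ?(ltW rho0).
have q2 : (a1 ^+ 2 + a2 ^+ 2) * ((z1 ^+ 2 + z2 ^+ 2) / rho ^+ 2) <= a1 ^+ 2 + a2 ^+ 2.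
  by rewrite ler_piMr// addr_ge0 ?sqr_ge0.
apply: le_trans (_ : rho ^+ 2 - 2 * (a1 * z1 + a2 * z2) + (a1 ^+ 2 + a2 ^+ 2) * ((z1 ^+ 2 + z2 ^+ 2) / rho ^+ 2) <= _).
  rewrite le_eqVlt; apply/orP; left; apply/eqP; field; by rewrite gt_eqF.
by move: q2; move: (_ / _) => q q2; lra.
Qed.

(** At the centre every replacement factor has modulus rho. A zero a <> 0 thus gains 2 (ln rho - ln
    |a|), and a zero at the origin 2 ln rho, since its own term is [ln 0 = 0]; then ln r <= ln
    rho. *)
Lemma zeros_center_le (S : seq C) (m : C -> nat) (r rho : R) : 0 < r <= rho ->
  2 * (\sum_(a <- S | a != 0) (m a)%:R * (ln r - ln (nm a)) + (m 0)%:R * ln r) <=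
  - ((m 0)%:R * ln (nm (0 - 0 : C) ^+ 2) + \sum_(a <- S | a != 0) (m a)%:R * ln (nm (0 - a) ^+ 2)) +
  ((m 0)%:R * ln (nm (rho%:C - conjc 0 * 0 / rho%:C : C) ^+ 2) +
   \sum_(a <- S | a != 0) (m a)%:R * ln (nm (rho%:C - conjc a * 0 / rho%:C : C) ^+ 2)).
Proof.
move=> /andP[r0 rrho]; have rho0 : 0 < rho by exact: lt_le_trans rrho.
have lnr : ln r <= ln rho by rewrite ler_ln ?posrE.
have bE (a : C) : ln (nm (rho%:C - conjc a * 0 / rho%:C : C) ^+ 2) = 2 * ln rho.
  by rewrite mulr0 mul0r subr0 nm_real gtr0_norm// lnXn// mulr2n; ring.
have -> : ln (nm (0 - 0 : C) ^+ 2) = 0 by rewrite subrr nm0 expr0n; exact: ln0.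
rewrite mulr0 add0r bE.
have -> : \sum_(a <- S | a != 0) (m a)%:R * ln (nm (rho%:C - conjc a * 0 / rho%:C : C) ^+ 2) =
   2 * \sum_(a <- S | a != 0) (m a)%:R * ln rho.
  by rewrite mulr_sumr; apply: eq_bigr => a _; rewrite bE; ring.
have -> : \sum_(a <- S | a != 0) (m a)%:R * ln (nm (0 - a) ^+ 2) =
   2 * \sum_(a <- S | a != 0) (m a)%:R * ln (nm a).
  rewrite mulr_sumr; apply: eq_bigr => a a0; rewrite sub0r nmN lnXn ?nm_gt0// mulr2n; ring.
have -> : \sum_(a <- S | a != 0) (m a)%:R * (ln r - ln (nm a)) =
   \sum_(a <- S | a != 0) (m a)%:R * ln r - \sum_(a <- S | a != 0) (m a)%:R * ln (nm a).
  by rewrite -sumrB; apply: eq_bigr => a _; rewrite mulrBr.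
have h1 : \sum_(a <- S | a != 0) (m a)%:R * ln r <= \sum_(a <- S | a != 0) (m a)%:R * ln rho.
  by apply: ler_sum => a _; rewrite ler_wpM2l.
have h2 : (m 0)%:R * ln r <= (m 0)%:R * ln rho by rewrite ler_wpM2l.
move: h1 h2; rewrite [_ * (2 * ln rho)]mulrCA.
move: (\sum_(a <- S | _) _ * ln r) (\sum_(a <- S | _) _ * ln rho) (\sum_(a <- S | _) _ * ln (nm a)) => A B D.
move: ((m 0)%:R * ln r) ((m 0)%:R * ln rho) => E F; lra.
Qed.

End Counting.

(** * The inequality at a fixed radius *)

Section FirstMainInequality.
Context {R : realType} {H : completeNormedModType R[i]}.
Local Notation C := (cplx R).
Local Notation Re := complex.Re.
Local Notation Im := complex.Im.
Local Notation mu := (@lebesgue_measure R).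
Variable ip : {dot H for (@conjc R)}.
Hypothesis ip_norm : forall x : H, ip x x = `|x| ^+ 2.
Variable T : linear_operator H.
Hypothesis T_entire : entire_class ip T.
Variable x : H.
Let s := hat ip T x.
Local Notation mult := (zero_mult ip T s).
Local Notation dn z := (dual_norm ip T z (s z) ^+ 2).
Hypothesis s_neq0 : exists z, s z <> cst 0.
Variable u : C -> R.
Hypothesis uE : forall z, s z <> cst 0 -> u z = ln (dn z).
Hypothesis u_lap : forall l : C, exists2 k : R * R -> R,
    has_lap k (fun q => - (4 * pi) * c1_density ip T (toC q)) (ofC l) &
    \forall q \near ofC l, u (toC q) = k q + (mult l)%:R * ln (nm (toC q - l) ^+ 2).

Lemma has_lap_affine (c : R) (a b : C) (p : R * R) : a * toC p + b != 0 ->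
  has_lap (fun q => c * ln (nm (a * toC q + b : C) ^+ 2)) (fun=> 0) p.
Proof.
move=> ab; have hl : has_lap (fun q => ln (nm (a * toC q + b : C) ^+ 2)) (fun=> 0) p.
  apply: (has_lap_ln_holo (g := fun z : C => a * z + b)) => //.
  by apply: near_all => z; have [dz _] := is_derive_affine a b z.
apply: (has_lap_eq _ _ (has_lapZ c hl)); first exact: near_all.
by apply: near_all => q; rewrite mulr0.
Qed.

Lemma dn_bounds z : s z <> cst 0 -> 0 < dn z <= nm x ^+ 2.
Proof.
move=> sz; have [d [e [v [F [K [[d0 e0 Ev] vF _ _ _]]]]]] := bundle_frame ip_norm T_entire z.
have zd : nball z d z by rewrite /nball /= subrr nm0.
have [Fv vn _] := vF z zd; have Fs := Ffib_hat ip T x z.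
have sv : s z (v (conjc z)) != 0 := frame_coord_neq0 ip_norm T_entire vF zd Fs sz.
have vp : 0 < nm (v (conjc z)) by rewrite nm_gt0.
have sp : 0 < nm (s z (v (conjc z))) by rewrite nm_gt0.
rewrite (dual_norm_span ip_norm T_entire Fs Fv vn) exprn_gt0 ?divr_gt0//=.
rewrite ler_pXn2r ?nnegrE ?divr_ge0 ?nm_ge0// ler_pdivrMr// /s hatE//.
exact: cauchy_schwarz.
Qed.

Section Radius.
Variables (r : R) (S : seq C).
Hypothesis r0 : 0 < r.
Hypothesis S_uniq : uniq S.
Hypothesis SE : forall z, (z \in S) = (nm z <= r) && (mult z != 0%N).

(** Subtracting the logarithms belonging to the zeros in the closed disc cancels the singularities
    of [u] there. At a zero itself [u] has its regular value and the subtracted term is 0. *)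
Let w (z : C) : R := u z - \sum_(a <- S) (mult a)%:R * ln (nm (z - a) ^+ 2).

Let cdisc_nm p : cdisc r p -> nm (toC p) <= r.
Proof. by rewrite /cdisc /= => h; rewrite -(ler_pXn2r (n := 2)) ?nnegrE ?nm_ge0 ?(ltW r0)// nm_sqr. Qed.

Lemma sum_zeros_split (l : C) (G : C -> R) : nm l <= r ->
  \sum_(a <- S) (mult a)%:R * G a = (mult l)%:R * G l + \sum_(a <- S | a != l) (mult a)%:R * G a.
Proof.
move=> lr; have [lS|lS] := boolP (l \in S); first by rewrite (bigD1_seq l).
have m0 : mult l = 0%N by move: lS; rewrite SE lr /= negbK => /eqP.
rewrite m0 mul0r add0r big_seq [RHS]big_seq_cond; apply: eq_bigl => a.
by rewrite andb_idr// => aS; apply: contraNneq lS => <-.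
Qed.

Lemma w_lap p : cdisc r p ->
  has_lap (fun q => w (toC q)) (fun q => - (4 * pi) * c1_density ip T (toC q)) p.
Proof.
move=> /cdisc_nm pr; set l := toC p in pr *; have [k kl uk] := u_lap l.
rewrite toCK in kl uk.
have hs : has_lap (fun q => \sum_(a <- S | a != l) (mult a)%:R * ln (nm (toC q - a) ^+ 2)) (fun=> 0) p.
  apply: has_lap_sum => a al; have := @has_lap_affine (mult a)%:R 1 (- a) p.
  rewrite mul1r subr_eq0 eq_sym => /(_ al); apply: has_lap_eq; last exact: near_all.
  by apply: near_all => q; rewrite mul1r.
apply: (has_lap_eq _ _ (has_lapD kl (has_lapZ (-1) hs))); last first.
  by apply: near_all => q; rewrite mulr0 addr0.
apply: filterS uk => q uq; rewrite /w uq (sum_zeros_split _ pr).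
by rewrite mulN1r opprD addrA addrK.
Qed.

(** Away from the zeros the left side is the squared norm of the section; at a zero the product
    vanishes. Written with exponentials, the bound also holds at zeros on the circle. *)
Lemma exp_w_prod z : nm z <= r -> expR (w z) * \prod_(a <- S) (nm (z - a) ^+ 2) ^+ mult a <= nm x ^+ 2.
Proof.
move=> zr; have [s0|sz] := pselect (s z = cst 0).
  have zS : z \in S.
    by rewrite SE zr /=; apply/eqP => m0; have := mult_eq0P ip_norm T_entire s_neq0 m0.
  rewrite (bigD1_seq z)//= subrr nm0 expr0n /= expr0n.
  move: zS; rewrite SE => /andP[_ /negbTE ->]; by rewrite mul0r mulr0 sqr_ge0.
have /andP[dp dx] := dn_bounds sz.
apply: le_trans dx; rewrite /w (uE sz) expRD expRN lnK ?posrE//.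
have -> : \prod_(a <- S) (nm (z - a) ^+ 2) ^+ mult a =
    expR (\sum_(a <- S) (mult a)%:R * ln (nm (z - a) ^+ 2)).
  rewrite expR_sum; apply: eq_big_seq => a aS.
  rewrite expRM_natl lnK// posrE exprn_gt0// nm_gt0 subr_eq0.
  apply: contraTneq aS => <-; rewrite SE (mult_neq0 ip_norm T_entire sz) eqxx andbF//.
by rewrite divfK// gt_eqF// expR_gt0.
Qed.

(** The bound depends on [r], but it enters only into the choice of rho and not into the final
    constant. *)
Lemma w_bound : exists2 W : R, 0 <= W & forall z, nm z <= r -> expR (w z) <= W.
Proof.
have cw p : cdisc r p -> {for p, continuous (fun q => w (toC q))}.
  by move=> /w_lap [hx [hy [hxx [hyy sm]]]]; have [[_ []]] := nbhs_singleton sm.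
have [M [_ Mb]] : bounded_set ((fun q => w (toC q)) @` cdisc r).
  apply: compact_bounded; apply: continuous_compact; last exact: compact_cdisc (ltW r0).
  by apply: continuous_in_subspaceT => p; rewrite inE => /cw.
exists (expR (`|M| + 1)); first exact: expR_ge0.
move=> z zr; rewrite ler_expR; apply: le_trans (ler_norm _) _.
apply: (Mb (`|M| + 1)); first by rewrite ltr_pwDr// ler_norm.
exists (ofC z); last by rewrite ofCK.
by rewrite /cdisc /= -nm_sqr ler_pXn2r ?nnegrE ?nm_ge0 ?(ltW r0).
Qed.

Let blaschke (rho : R) (a z : C) : C := rho%:C - conjc a * z / rho%:C.

Lemma blaschke_neq0 rho a z : r < rho -> nm a <= r -> nm z <= r -> blaschke rho a z != 0.
Proof.
move=> rrho ar zr; have rho0 : 0 < rho by exact: lt_trans rrho.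
rewrite -nm_gt0; apply: lt_le_trans (nm_sub_le _ _).
rewrite -fmorphV !nmM nm_conj !nm_real gtr0_norm// gtr0_norm ?invr_gt0// subr_gt0 ltr_pdivrMr//.
apply: le_lt_trans (ler_pM (nm_ge0 _) (nm_ge0 _) ar zr) _.
by apply: ltr_pM; rewrite // ltW.
Qed.

Let h (rho : R) (z : C) : R := w z + \sum_(a <- S) (mult a)%:R * ln (nm (blaschke rho a z) ^+ 2).

Lemma h_lap rho p : r < rho -> cdisc r p ->
  has_lap (fun q => h rho (toC q)) (fun q => - (4 * pi) * c1_density ip T (toC q)) p.
Proof.
move=> rrho pr; have hs : has_lap (fun q => \sum_(a <- S | a \in S) (mult a)%:R * ln (nm (blaschke rho a (toC q)) ^+ 2)) (fun=> 0) p.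
  apply: has_lap_sum => a aS; have := aS; rewrite SE => /andP[ar _].
  have E q : - conjc a / rho%:C * toC q + rho%:C = blaschke rho a (toC q).
    by rewrite /blaschke addrC mulNr mulNr mulrAC.
  have := @has_lap_affine (mult a)%:R (- conjc a / rho%:C) rho%:C p.
  rewrite E => /(_ (blaschke_neq0 rrho ar (cdisc_nm pr))); apply: has_lap_eq; last exact: near_all.
  by apply: near_all => q; rewrite E.
apply: (has_lap_eq _ _ (has_lapD (w_lap pr) hs)); apply: near_all => q; last by rewrite addr0.
by rewrite /h -big_seq.
Qed.

(** With rho^2 = r^2 + eta, replacing the factors raises their product by at most K eta on the
    circle, and exp w is at most W. Taking eta with W K eta <= 1 costs the summand 1, whatever [r]
    is. *)
Lemma h_circle : exists2 rho, r < rho & forall z, nm z = r -> h rho z <= ln (nm x ^+ 2 + 1).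
Proof.
pose g (a : C) (eta : R) (z : C) := nm (blaschke (Num.sqrt (r ^+ 2 + eta)) a z) ^+ 2.
have srt eta : 0 <= eta -> Num.sqrt (r ^+ 2 + eta) ^+ 2 = r ^+ 2 + eta.
  by move=> e0; rewrite sqr_sqrtr// addr_ge0// sqr_ge0.
have rle eta : 0 <= eta -> r <= Num.sqrt (r ^+ 2 + eta).
  by move=> e0; rewrite -(ler_pXn2r (n := 2)) ?nnegrE ?sqrtr_ge0 ?(ltW r0)// srt// lerDl.
have [K K0 HK] : perturb [set z : C | nm z = r] (fun z => \prod_(a <- S) (nm (z - a) ^+ 2) ^+ mult a)
    (fun eta z => \prod_(a <- S) g a eta z ^+ mult a).
  apply: (@perturb_prod _ _ _ _ S mult (fun a z => nm (z - a) ^+ 2) g) => a.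
  (* Here 4 r^2 bounds |z - a|^2, and 1 is the rate in [blaschke_le], as rho^2 - r^2 = eta. *)
  rewrite SE => /andP[ar _]; exists (1 + 4 * r ^+ 2); first by have := sqr_ge0 r; lra.
  move=> z eta /= zr /andP[e0 e1]; rewrite !sqr_ge0 /=; split.
    have za : nm (z - a) <= 2 * r by apply: le_trans (nmBD _ _) _; rewrite zr; lra.
    apply: le_trans (_ : (2 * r) ^+ 2 <= _); last by rewrite exprMn; have := sqr_ge0 r; lra.
    by rewrite ler_pXn2r ?nnegrE ?nm_ge0// mulr_ge0// ltW.
  apply: le_trans (blaschke_le a r0 (rle _ e0) zr) _; rewrite srt// [r ^+ 2 + eta]addrC addrK lerD2l.
  by rewrite ler_peMl// lerDl mulr_ge0// sqr_ge0.
have [W W0 HW] := w_bound.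
have WK : 0 < W * K + 1 by rewrite ltr_wpDl// mulr_ge0.
pose eta := Num.min 1 (W * K + 1)^-1.
have eta0 : 0 < eta by rewrite lt_min ltr01 invr_gt0.
have eta1 : eta <= 1 by rewrite ge_min lexx.
have etaK : W * K * eta <= 1.
  apply: le_trans (_ : W * K * (W * K + 1)^-1 <= _); first by rewrite ler_wpM2l ?mulr_ge0// ge_min lexx orbT.
  by rewrite ler_pdivrMr// mul1r lerDl.
have rrho : r < Num.sqrt (r ^+ 2 + eta).
  by rewrite -(ltr_pXn2r (n := 2)) ?nnegrE ?sqrtr_ge0 ?(ltW r0)// srt ?ltW// ltrDl.
exists (Num.sqrt (r ^+ 2 + eta)) => // z zr.
have zr' : nm z <= r by rewrite zr.
have x1 : 0 < nm x ^+ 2 + 1 by rewrite ltr_wpDl ?sqr_ge0.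
rewrite -ler_expR lnK ?posrE// /h expRD.
have -> : expR (\sum_(a <- S) (mult a)%:R * ln (nm (blaschke (Num.sqrt (r ^+ 2 + eta)) a z) ^+ 2)) =
    \prod_(a <- S) g a eta z ^+ mult a.
  rewrite expR_sum; apply: eq_big_seq => a; rewrite SE => /andP[ar _].
  by rewrite expRM_natl lnK// posrE exprn_gt0// nm_gt0; exact: blaschke_neq0.
have [|_ /andP[_ gle]] := HK z eta zr; first by rewrite (ltW eta0) eta1.
apply: le_trans (ler_wpM2l (expR_ge0 _) gle) _; rewrite mulrDr.
apply: lerD; first exact: exp_w_prod.
apply: le_trans etaK; rewrite -mulrA; apply: ler_wpM2r; last exact: HW.
by rewrite mulr_ge0// ltW.
Qed.

(* Jensen's formula for [- h / (4 pi)], whose Laplacian is the density of [c_1(F)]. *)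
Lemma char_fun_ge rho M : r < rho -> (forall z, nm z = r -> h rho z <= M) ->
  h rho 0 <= M + 2 * char_fun ip T r.
Proof.
move=> rrho hM; have p0 : 0 < (pi : R) := pi_gt0 R.
pose c := - (4 * pi : R)^-1; pose g q := c * h rho (toC q).
have gl p : cdisc r p -> has_lap g (fun q => c1_density ip T (toC q)) p.
  move=> pr; apply: (has_lap_eq _ _ (has_lapZ c (h_lap rrho pr))); first exact: near_all.
  apply: near_all => q; rewrite /c mulrA mulrNN mulVf ?mul1r//.
  by rewrite mulf_neq0// gt_eqF.
have gs p : cdisc r p -> \forall q \near p, smooth_at g (px g) (py g) (px (px g)) (py (py g)) q.
  by move=> /gl /has_lap_smooth; apply: filterS => q [].
have cg p : cdisc r p -> {for p, continuous g}.
  by move=> /gs /nbhs_singleton[_ []].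
have := jensen_smooth gs r0.
have -> : \int[mu]_(t in `]0, r]) (t^-1 * \int[(mu \x mu)%E]_(p in odisc t) (px (px g) p + py (py g) p)) =
    char_fun ip T r.
  apply: eq_Rintegral => t; rewrite inE /= in_itv /= => /andP[t0 tr]; congr (_ * _).
  rewrite /area_c1; have -> : [set p : R * R | disc t (p.1 +i* p.2)] = odisc t.
    have E p : (`|toC p| < t%:C) = (p.1 ^+ 2 + p.2 ^+ 2 < t ^+ 2).
      by rewrite nmE ltcR -(ltr_pXn2r (n := 2)) ?nnegrE ?nm_ge0 ?(ltW t0)// nm_sqr.
    by apply/seteqP; split=> p; rewrite /disc /odisc /= -/(toC p) E.
  apply: eq_Rintegral => p; rewrite inE => pt.
  have pr : cdisc r p by apply: (@cdiscS _ r t) (odisc_cdisc pt); rewrite (ltW t0).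
  by have [_ <-] := nbhs_singleton (has_lap_smooth (gl p pr)).
move=> ->.
pose pt (e1 e2 a : R) : R * R := (e1 * (r * cos a), e2 * (r * sin a)).
have ptr e1 e2 a : e1 ^+ 2 = 1 -> e2 ^+ 2 = 1 -> nm (toC (pt e1 e2 a)) = r.
  move=> E1 E2; apply/eqP; rewrite -(eqrXn2 (n := 2)) ?nm_ge0 ?(ltW r0)// nm_sqr /= !exprMn E1 E2 !mul1r -mulrDr.
  by rewrite cos2Dsin2 mulr1.
have ptc e1 e2 a : e1 ^+ 2 = 1 -> e2 ^+ 2 = 1 -> cdisc r (pt e1 e2 a).
  by move=> E1 E2; rewrite /cdisc /= -(nm_sqr (toC (pt e1 e2 a))) ptr.
have c0 : c < 0 by rewrite oppr_lt0 invr_gt0 mulr_gt0.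
have gM e1 e2 a : e1 ^+ 2 = 1 -> e2 ^+ 2 = 1 -> c * M <= g (pt e1 e2 a).
  by move=> E1 E2; rewrite /g ler_nM2l//; apply: hM; exact: ptr.
have cgp e1 e2 a : e1 ^+ 2 = 1 -> e2 ^+ 2 = 1 -> {for a, continuous (fun a => g (pt e1 e2 a))}.
  move=> E1 E2; apply: (@continuous_comp _ _ _ (pt e1 e2) g); last by apply: cg; exact: ptc.
  have cst k : {for a, continuous (fun=> k : R)} by exact: cst_continuous.
  apply: continuous_pair.
    exact: (cvgM (cst e1) (cvgM (cst r) (@continuous_cos R a))).
  exact: (cvgM (cst e2) (cvgM (cst r) (@continuous_sin R a))).
have one : (1 : R) ^+ 2 = 1 by rewrite expr1n.
have mone : (-1 : R) ^+ 2 = 1 by rewrite sqrrN expr1n.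
have g0 : g (0, 0) = c * h rho 0 by rewrite /g.
pose f a := g (pt 1 1 a) + g (pt 1 (-1) a) + (g (pt (-1) 1 a) + g (pt (-1) (-1) a)) - 4 * g (0, 0).
have -> : \int[mu]_(a in `[0, pi / 2])
    (g (r * cos a, r * sin a) + g (r * cos a, - (r * sin a)) +
     (g (- (r * cos a), r * sin a) + g (- (r * cos a), - (r * sin a))) - 4 * g (0, 0)) =
    \int[mu]_(a in `[0, pi / 2]) f a.
  by apply: eq_Rintegral => a _; rewrite /f /pt !mul1r !mulN1r.
have cf (a : R) : 0 <= a <= pi / 2 -> {for a, continuous f}.
  move=> _; have cst k : {for a, continuous (fun=> k : R)} by exact: cst_continuous.
  exact: (cvgB (cvgD (cvgD (cgp 1 1 a one one) (cgp 1 (-1) a one mone)) (cvgD (cgp (-1) 1 a mone one) (cgp (-1) (-1) a mone mone)))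
    (cst (4 * g (0, 0)))).
(* As [c] is negative, the upper bound M for h turns into the lower bound c M for [g] on the circle,
   once for each quadrant. *)
pose k := 4 * (c * M - c * h rho 0).
have kf (a : R) : 0 <= a <= pi / 2 -> k <= f a.
  move=> _; rewrite /f g0 /k; have := gM 1 1 a one one; have := gM 1 (-1) a one mone.
  have := gM (-1) 1 a mone one; have := gM (-1) (-1) a mone mone; lra.
have ck (a : R) : 0 <= a <= pi / 2 -> {for a, continuous (fun=> k : R)} by move=> _; exact: cst_continuous.
have pi2 : 0 <= pi / 2 :> R by rewrite divr_ge0// ltW.
have : \int[mu]_(a in `[0, pi / 2]) k <= \int[mu]_(a in `[0, pi / 2]) f a.
  apply: le_Rintegral; [by []|exact: (continuous_itv_integrable ck)|exact: (continuous_itv_integrable cf)|].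
  by move=> a; rewrite /= in_itv /=; exact: kf.
have dk (a : R) : 0 <= a <= pi / 2 -> is_derive a 1 (fun a => k * a) k.
  move=> _; apply: is_derive_eq (is_deriveZ k (is_derive_id a (1 : R))) _.
  by rewrite /GRing.scale /= mulr1.
have -> : \int[mu]_(a in `[0, pi / 2]) k = k * (pi / 2) - k * 0.
  exact: (@Rintegral_FTC _ (fun=> k) (fun a => k * a) 0 (pi / 2) pi2 ck dk).
rewrite mulr0 subr0; have -> : k * (pi / 2) = (h rho 0 - M) / 2.
  rewrite /k /c; move: (pi : R) p0 => P P0; field; by rewrite gt_eqF.
by move: (h rho 0) (Rintegral _ _ _) => A B; lra.
Qed.

Lemma zero_countE t : 0 < t <= r -> zero_count ip T s t = (\sum_(a <- S | (nm a < t)%R) mult a)%N.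
Proof.
move=> /andP[t0 tr]; rewrite /zero_count.
have dE z : disc t z <-> nm z < t by rewrite /disc /= nmE ltcR.
rewrite (@fsbigE _ _ _ _ _ [seq a <- S | nm a < t]); first last.
- move=> z /dE zt; rewrite mem_filter zt SE /= (le_trans (ltW zt) tr) /= negbK => /eqP.
  exact.
- by move=> z /=; rewrite mem_filter => /andP[zt _]; exact/dE.
- exact: filter_uniq.
rewrite big_filter_cond; apply: eq_bigl => a; case: (boolP (nm a < t)) => //= at_.
by rewrite mem_set//; exact/dE.
Qed.

(** Subtracting the multiplicity at 0 in the integrand takes the zero at the origin out of the
    count; the remaining zeros satisfy 0 < |a| <= r, as [Rintegral_step_sum] requires. *)
Lemma counting_funE : counting_fun ip T s r =
  \sum_(a <- S | a != 0) (mult a)%:R * (ln r - ln (nm a)) + (mult 0)%:R * ln r.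
Proof.
rewrite /counting_fun; congr (_ + _); rewrite -big_filter -Rintegral_step_sum; last first.
  by move=> a; rewrite mem_filter SE nm_gt0 => /andP[-> /andP[]].
apply: eq_Rintegral => t; rewrite inE /= in_itv /= => tr; congr (_ / _).
have nS a : a \in S -> (a == 0) || (a != 0) by move=> _; case: eqP.
rewrite zero_countE// natr_sum natr_sum big_filter_cond big_mkcond /=.
have E a : (if nm a < t then (mult a)%:R else 0) = (mult a)%:R * (nm a < t)%R%:R :> R.
  by case: ifP; rewrite ?mulr1 ?mulr0.
rewrite (eq_bigr _ (fun a _ => E a)) (sum_zeros_split _ (l := 0)) ?nm0 ?(ltW r0)//.
have /andP[t0 _] := tr; have red (m0 A : R) : m0 * true%:R + A - m0 = A by rewrite mulr1 addrAC subrr add0r.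
rewrite t0 red.
rewrite [RHS]big_mkcondr; apply: eq_bigr => a _; by case: ifP; rewrite ?mulr1 ?mulr0.
Qed.

(** At the centre h is u(0) plus the gain of [zeros_center_le], and [char_fun_ge] bounds it from
    above with the constant of [h_circle]. *)
Lemma counting_le_char : 2 * counting_fun ip T s r + u 0 <= ln (nm x ^+ 2 + 1) + 2 * char_fun ip T r.
Proof.
have [rho rrho hM] := h_circle; apply: le_trans (char_fun_ge rrho hM).
have nm00 : nm (0 : C) <= r by rewrite nm0 ltW.
rewrite counting_funE /h /w (sum_zeros_split (fun a => ln (nm (0 - a) ^+ 2)) nm00).
rewrite (sum_zeros_split (fun a => ln (nm (blaschke rho a 0) ^+ 2)) nm00).
have rr : 0 < r <= rho by rewrite r0 ltW.
by rewrite addrC -[leRHS]addrA lerD2l; exact: zeros_center_le rr.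
Qed.

End Radius.
End FirstMainInequality.

Theorem proposition7p5 (R : realType) (H : completeNormedModType R[i])
    (ip : {dot H for (@conjc R)})
    (ip_norm : forall x : H, ip x x = `|x| ^+ 2)
    (H_separable : separable_space H)
    (H_infinite_dim : infinite_dimensional H)
    (T : linear_operator H)
    (T_entire : entire_class ip T)
    (s : cplx R -> H -> cplx R)
    (s_model : model_space ip T s)
    (s_neq0 : s <> (fun _ _ => 0)) :
  exists c : R, \forall r \near +oo%R,
    counting_fun ip T s r <= char_fun ip T r + c.
Proof.
have [x _ xs] := s_model; rewrite -{s}xs in s_model s_neq0 *.
have x_neq0 : exists z, hat ip T x z <> cst 0.
  apply: contra_notP s_neq0 => nz; apply/funext => z; apply: contrapT => sz.
  by apply: nz; exists z.
have [u [uE u_lap]] := potential ip_norm T_entire x_neq0.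
(* The factor 1/2 passes from ln |s|^2, in which the estimate is written, to ln |s|. *)
exists ((ln (nm x ^+ 2 + 1) - u 0) / 2).
near=> r; have r0 : 0 < r by near: r; exact: nbhs_pinfty_gt.
have [S S_uniq SE] := finite_zeros ip_norm T_entire x_neq0 (ltW r0).
have := counting_le_char ip_norm T_entire x_neq0 uE u_lap r0 S_uniq SE; lra.
Unshelve. all: by end_near. Qed.
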